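(* Let $f\in\mathcal G^+[1]$ with $f'(1)=\beta$. Put $$\Omega_\pm=\{\omega\in\mathbb C:\ |\omega\mp\beta|\le\beta,\ \omega\ne0\},\qquad \Omega=\Omega_+\cup\Omega_-.$$ For a complex number $\lambda\neq 0$, the initial value problem $$\lambda h(z)=h'(z)f(z),\qquad h(0)=1,$$ has a univalent solution $h$ holomorphic on $\Delta$ if and only if $\lambda\in\Omega$. Moreover, with $h$ denoting the solution of this initial value problem: (1) for each $\mu\in\Omega_+$ and each $\tau\in\Delta$ there are functions $h_\tau\in\mathrm{Sp}[\tau]$ which converge (uniformly on compact subsets of $\Delta$) to the function $h_1(z)=h(z)^{\mu/\lambda}$ as $\tau$ tends to $1$ unrestrictedly. In particular, if $\lambda\in\Omega_+$, then choosing $\mu=\lambda$ one finds $h_\tau\in\mathrm{Sp}[\tau]$ which converge to the original function $h$ as $\tau\to1$. (2) for each $\mu\in\Omega_-$ and each $\tau\in\Delta$ there are meromorphic functions $\widetilde h_\tau$ on $\Delta$ with a unique simple pole at $\tau$ and such that $\widetilde h_\tau$ converges (uniformly on compact subsets of $\Delta$) to the holomorphic function $\widetilde h(z)=h(z)^{\mu/\lambda}$ as $\tau$ tends to $1$ unrestrictedly.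
   Context: $\Delta=\{z\in\mathbb C:|z|<1\}$; $\angle\lim$ denotes the angular (non-tangential) limit. A one-parameter continuous semigroup is a family $\{F_t\}_{t\ge0}$ of holomorphic self-mappings of $\Delta$ with $F_{t+s}=F_t\circ F_s$ for $t,s\ge0$, $F_0=\mathrm{id}$, and $\lim_{t\to s}F_t(z)=F_s(z)$ for all $z\in\Delta$, $s\ge0$. Its generator is $f(z)=\lim_{t\to0^+}\frac{z-F_t(z)}{t}$; $\mathcal G$ is the set of all such generators. $\mathcal G^+[1]$ is the set of $f\in\mathcal G$ with $\angle\lim_{z\to1}f(z)=0$ and $f'(1):=\angle\lim_{z\to1}\frac{f(z)}{z-1}=\beta>0$; such $f$ has no zeros in $\Delta$. A univalent holomorphic function $h$ on $\Delta$ is spirallike if there is $\mu\in\mathbb C$ with $\operatorname{Re}\mu>0$ such that for every $z\in\Delta$ the curve $\{e^{-t\mu}h(z):t\ge0\}$ lies in $h(\Delta)$. For $\tau\in\Delta$, $\mathrm{Sp}[\tau]$ is the set of spirallike functions $h$ with $h(\tau)=0$. The solution $h$ of the initial value problem has no zeros in $\Delta$, and its powers are taken with the branch $h(0)^{\mu/\lambda}=1$ coming from $h=\exp\bigl(\lambda\int_0^z d\zeta/f(\zeta)\bigr)$, i.e. $h^{\mu/\lambda}=\exp\bigl(\mu\int_0^z d\zeta/f(\zeta)\bigr)$. ''$\tau\to1$ unrestrictedly'' means $\tau\in\Delta$, $|\tau-1|\to0$, with no restriction on the manner of approach. *)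

(* Defs.v *)
(* Stdlib reals with Coquelicot's complex numbers. *)
From Stdlib Require Export Reals List.
From Coquelicot Require Export Coquelicot.
Open Scope R_scope.
Open Scope C_scope.

(* Functions on the disk are total functions C -> C; only their values on
   Delta are ever constrained. *)
Definition Delta (z : C) : Prop := (Cmod z < 1)%R.

Definition Cexp (z : C) : C :=
  (exp (Re z) * cos (Im z), exp (Re z) * sin (Im z))%R.

(* Complex differentiability: the scalar field is C, not R. *)
Definition C_differentiable (h : C -> C) (z : C) : Prop :=
  ex_derive (K := C_AbsRing) (V := C_NormedModule) h z.

Definition holomorphic_on (D : C -> Prop) (h : C -> C) : Prop :=
  forall z, D z -> C_differentiable h z.

Definition C_cvg {T : Type} (g : T -> C) (F : (T -> Prop) -> Prop) (l : C) : Prop :=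
  filterlim g F (locally (T := C_UniformSpace) l).

Definition Stolz (k : R) (z : C) : Prop :=
  Delta z /\ (Cmod (1 - z) < k * (1 - Cmod z))%R.

Definition angular_lim_at_1 (g : C -> C) (l : C) : Prop :=
  forall k : R, (1 < k)%R ->
    C_cvg g (within (Stolz k) (locally (T := C_UniformSpace) (RtoC 1))) l.

Record continuous_semigroup (F : R -> C -> C) : Prop := {
  semigroup_hol : forall t, (0 <= t)%R -> holomorphic_on Delta (F t);
  semigroup_self : forall t z, (0 <= t)%R -> Delta z -> Delta (F t z);
  semigroup_add : forall t s z, (0 <= t)%R -> (0 <= s)%R -> Delta z ->
    F (t + s)%R z = F t (F s z);
  semigroup_id : forall z, Delta z -> F 0%R z = z;
  semigroup_cont : forall s z, (0 <= s)%R -> Delta z ->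
    C_cvg (fun t => F t z) (within (fun t : R => (0 <= t)%R) (locally s)) (F s z)
}.

Definition generates (F : R -> C -> C) (f : C -> C) : Prop :=
  forall z, Delta z ->
    C_cvg (fun t : R => (z - F t z) / RtoC t) (at_right 0%R) (f z).

Definition G (f : C -> C) : Prop :=
  exists F, continuous_semigroup F /\ generates F f.

(* f belongs to G^+[1] and f'(1) = beta. *)
Record Gplus1 (f : C -> C) (beta : R) : Prop := {
  Gplus1_G : G f;
  Gplus1_zero : angular_lim_at_1 f 0;
  Gplus1_deriv : angular_lim_at_1 (fun z => f z / (z - 1)) (RtoC beta);
  Gplus1_pos : (0 < beta)%R
}.

Definition univalent (h : C -> C) : Prop :=
  holomorphic_on Delta h /\
  forall z w, Delta z -> Delta w -> h z = h w -> z = w.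

Definition spirallike (h : C -> C) : Prop :=
  univalent h /\
  exists mu : C, (0 < Re mu)%R /\
    forall z t, Delta z -> (0 <= t)%R ->
      exists w, Delta w /\ h w = Cexp (- (RtoC t * mu)) * h z.

Definition Sp (tau : C) (h : C -> C) : Prop :=
  spirallike h /\ h tau = 0.

Definition Omega_plus (beta : R) (w : C) : Prop :=
  (Cmod (w - RtoC beta) <= beta)%R /\ w <> 0.

Definition Omega_minus (beta : R) (w : C) : Prop :=
  (Cmod (w + RtoC beta) <= beta)%R /\ w <> 0.

Definition Omega (beta : R) (w : C) : Prop :=
  Omega_plus beta w \/ Omega_minus beta w.

Definition IVP_solution (f : C -> C) (lambda : C) (h : C -> C) : Prop :=
  holomorphic_on Delta h /\
  (forall z, Delta z -> lambda * h z = C_derive h z * f z) /\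
  h 0 = 1.

(* g = h^a on Delta, for h zero-free with h(0) = 1, with the branch g(0) = 1:
   L is the holomorphic logarithm of h vanishing at 0, which is unique on Delta.
   When h solves the initial value problem, L(z) is lambda times the integral
   of 1/f from 0 to z. *)
Definition branch_power (h : C -> C) (a : C) (g : C -> C) : Prop :=
  exists L : C -> C,
    holomorphic_on Delta L /\ L 0 = 0 /\
    (forall z, Delta z -> h z = Cexp (L z)) /\
    (forall z, Delta z -> g z = Cexp (a * L z)).

Definition C_compact (K : C -> Prop) : Prop :=
  forall cover : (C -> Prop) -> Prop,
    (forall U, cover U -> open (T := C_UniformSpace) U) ->
    (forall z, K z -> exists U, cover U /\ U z) ->
    exists l : list (C -> Prop),
      (forall U, In U l -> cover U) /\
      (forall z, K z -> exists U, In U l /\ U z).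

(* The value of H tau at a pole is irrelevant here when that pole is at tau:
   it lies outside a given compact subset of Delta once tau is close to 1. *)
Definition cvg_compacts_tau_to_1 (H : C -> C -> C) (g : C -> C) : Prop :=
  forall K : C -> Prop, C_compact K -> (forall z, K z -> Delta z) ->
  forall eps : R, (0 < eps)%R ->
  within Delta (locally (T := C_UniformSpace) (RtoC 1))
    (fun tau => forall z, K z -> (Cmod (H tau z - g z) < eps)%R).

Definition simple_pole (h : C -> C) (tau : C) : Prop :=
  exists g : C -> C,
    locally (T := C_UniformSpace) tau (C_differentiable g) /\
    g tau <> 0 /\
    locally' (T := C_UniformSpace) tau (fun z => h z = g z / (z - tau)).

Definition meromorphic_unique_simple_pole (tau : C) (h : C -> C) : Prop :=
  holomorphic_on (fun z => Delta z /\ z <> tau) h /\ simple_pole h tau.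

(* Main.v *)
Require Import Defs.
From Stdlib Require Import Lra Lia Psatz Classical IndefiniteDescription.

(* Julia's inequality. Differentiating the Schwarz-Pick inequality between [F t z] and [F t w] at
   [t = 0] and letting [w] tend radially to 1 gives [f z = - (1 - z)^2 p z] with
   [p = (beta / 2) (1 + z) / (1 - z) + q] and [Re q >= 0]. The solution of the initial value
   problem is [exp (lambda * Phi)] with [Phi' = 1 / f].

   Approximation. Replacing [(1 + z) / (1 - z)] by [(1 + sig z) / (1 - sig z)] and [q] by the bounded
   function [q / (1 + ep q)] in [p] gives [p_tau], and [(z - tau) (1 - conj tau z) p_tau z] generates
   a flow with attracting point [tau], linearized by a spirallike function; its multiplier
   [(1 - |tau|^2) p_tau tau] can be made to tend to any prescribed [mu] in [Omega_plus beta] by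
   choosing how [sig] tends to 1. Hurwitz's theorem then gives the univalence of [exp (mu * Phi)].

   Necessity. In the coordinate [log ((1 + z) / (1 - z))] the function [Phi] is asymptotically affine
   of slope [- 1 / beta] on the strip [|Im| < PI / 2], hence takes two values differing by
   [2 PI i / lambda] as soon as [|Re (1 / lambda)| < 1 / (2 beta)]. *)

(** The disc [Omega_plus] is the set of attainable multipliers. Writing
    [sig tau * tau = 1 - (1 - |tau|^2) s], the part of [(1 - |tau|^2) p_tau tau] that comes from
    [beta] tends to [beta / s]. The bound [|sig| <= 1] needed for a generator amounts in the limit
    to [Re s >= 1 / 2], and [mu = beta / s] then means [|mu - beta| <= beta]. With [sig = 1] the
    limit would depend on the way [tau] approaches 1.

    The term [q] must disappear from the multiplier for every approach of [tau], and [Re q >= 0]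
    alone only bounds [(1 - |tau|^2) q tau]. The cut-off replaces an argument with representing
    measures: [|q / (1 + ep q)| <= 1 / ep], while [1 - |tau|^2 <= 2 ep^2] for [ep = sqrt |1 - tau|].

    No differential equation of a flow is solved. Invariance under the spirals is the solvability of
    [Phi v = Phi u - t] in a logarithmic coordinate on a half-plane.

    All powers of the solution are [exp (mu * Phi)] for one function [Phi], so no branch is ever
    chosen. The statements on [Omega_minus] follow by taking reciprocals, which turns the zero at
    [tau] into a simple pole. *)

(** * Moduli of complex numbers and neighbourhoods *)

Lemma Cmod_minus_sym (a b : C) : Cmod (a - b) = Cmod (b - a).
Proof. rewrite <- Cmod_opp. f_equal. ring. Qed.

Lemma Cmod_triangle_minus (a b : C) : (Cmod (a - b) <= Cmod a + Cmod b)%R.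
Proof. unfold Cminus. rewrite <- (Cmod_opp b). apply Cmod_triangle. Qed.

Lemma Cmod_triangle_rev (a b : C) : (Cmod a - Cmod b <= Cmod (a - b))%R.
Proof.
  pose proof (Cmod_triangle (a - b) b) as H.
  replace (a - b + b) with a in H by ring. lra.
Qed.

Lemma Cmod_sqr (z : C) : (Cmod z * Cmod z = Re z * Re z + Im z * Im z)%R.
Proof. pose proof (Cmod2_alt z). simpl in H. lra. Qed.

Lemma Cmod_le_sqr (a b : C) :
  (Cmod a * Cmod a <= Cmod b * Cmod b)%R -> (Cmod a <= Cmod b)%R.
Proof. intros H. pose proof (Cmod_ge_0 a). pose proof (Cmod_ge_0 b). nra. Qed.

Lemma Cmod_le_Rabs (z : C) : (Cmod z <= Rabs (Re z) + Rabs (Im z))%R.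
Proof.
  pose proof (Cmod_sqr z). pose proof (Cmod_ge_0 z).
  pose proof (Rabs_pos (Re z)). pose proof (Rabs_pos (Im z)).
  pose proof (Rsqr_abs (Re z)). pose proof (Rsqr_abs (Im z)). unfold Rsqr in *. nra.
Qed.

Lemma im_le_Cmod (z : C) : (Rabs (Im z) <= Cmod z)%R.
Proof. eapply Rle_trans; [| apply Rmax_Cmod]. apply Rmax_r. Qed.

Lemma C_ext (a b : C) : Re a = Re b -> Im a = Im b -> a = b.
Proof. destruct a, b. simpl. congruence. Qed.

Lemma Cmod_neq_0 (z : C) : (0 < Cmod z)%R -> z <> 0.
Proof. intros H. apply Cmod_gt_0. exact H. Qed.

(** The balls of the product uniform structure are squares; they are comparable with the discs of
    [Cmod] up to the factor [sqrt 2]. *)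
Lemma locally_C_iff (z : C) (P : C -> Prop) :
  locally (T := C_UniformSpace) z P <->
  exists d : R, (0 < d)%R /\ forall w, (Cmod (w - z) < d)%R -> P w.
Proof.
  split.
  - intros [d Hd]. exists d. split; [apply cond_pos |].
    intros w Hw. apply Hd. apply C_NormedModule_mixin_compat1. exact Hw.
  - intros (d & Hd & H).
    assert (Hs : (0 < sqrt 2)%R) by (apply sqrt_lt_R0; lra).
    assert (Hd' : (0 < d / sqrt 2)%R) by (apply Rdiv_lt_0_compat; lra).
    exists (mkposreal _ Hd'). intros w Hw. apply H.
    pose proof (C_NormedModule_mixin_compat2 z w _ Hw) as K.
    eapply Rlt_le_trans; [exact K |]. simpl. right. field. lra.
Qed.

(** * Limits along a filter *)

Instance locally_C_proper (z : C) :
  @ProperFilter C (locally (T := C_UniformSpace) z) := locally_filter z.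

Instance locally_C_filter (z : C) :
  @Filter C (locally (T := C_UniformSpace) z) := filter_filter.


(* The target [l] may vary with the point, so that uniform convergence is also an instance. *)
Definition ulim {T : Type} (F : (T -> Prop) -> Prop) (g l : T -> C) : Prop :=
  forall eps : R, (0 < eps)%R -> F (fun x => (Cmod (g x - l x) < eps)%R).

(** Needed because the targets vary: a product of uniform limits converges when the targets are
    bounded, a quotient when the inverse of the target is bounded too. *)
Definition ubdd {T : Type} (F : (T -> Prop) -> Prop) (l : T -> C) : Prop :=
  exists M : R, F (fun x => (Cmod (l x) <= M)%R).

Lemma C_cvg_ulim {T : Type} (F : (T -> Prop) -> Prop) {FF : Filter F} (g : T -> C) (l : C) :
  C_cvg g F l <-> ulim F g (fun _ => l).
Proof.
  unfold C_cvg, ulim. split.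
  - intros H eps He.
    apply (H (fun y => (Cmod (y - l) < eps)%R)). apply locally_C_iff. exists eps. auto.
  - intros H P HP. apply locally_C_iff in HP. destruct HP as (d & Hd & HP).
    unfold filtermap. eapply filter_imp; [| apply (H d Hd)]. intros x Hx. auto.
Qed.

Section ULim.
Context {T : Type} {F : (T -> Prop) -> Prop} {FF : Filter F}.

Lemma ubdd_const (c : C) : ubdd F (fun _ => c).
Proof. exists (Cmod c). apply filter_forall. intros. apply Rle_refl. Qed.

Lemma ubdd_plus (l l' : T -> C) : ubdd F l -> ubdd F l' -> ubdd F (fun x => l x + l' x).
Proof.
  intros [M HM] [M' HM']. exists (M + M')%R.
  generalize (filter_and _ _ HM HM'). apply filter_imp. intros x [H1 H2].
  eapply Rle_trans; [apply Cmod_triangle |]. lra.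
Qed.

Lemma ubdd_mult (l l' : T -> C) : ubdd F l -> ubdd F l' -> ubdd F (fun x => l x * l' x).
Proof.
  intros [M HM] [M' HM']. exists (M * M')%R.
  generalize (filter_and _ _ HM HM'). apply filter_imp. intros x [H1 H2].
  rewrite Cmod_mult. apply Rmult_le_compat; auto using Cmod_ge_0.
Qed.

Lemma ubdd_opp (l : T -> C) : ubdd F l -> ubdd F (fun x => - l x).
Proof.
  intros [M HM]. exists M. revert HM. apply filter_imp. intros x H. now rewrite Cmod_opp.
Qed.

Lemma ulim_ext (g g' l l' : T -> C) :
  F (fun x => g x = g' x) -> F (fun x => l x = l' x) -> ulim F g l -> ulim F g' l'.
Proof.
  intros H1 H2 H eps He. generalize (filter_and _ _ (filter_and _ _ H1 H2) (H eps He)).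
  apply filter_imp. intros x [[E1 E2] E]. now rewrite <- E1, <- E2.
Qed.

Lemma ulim_refl (l : T -> C) : ulim F l l.
Proof.
  intros eps He. apply filter_forall. intros x.
  replace (l x - l x) with (RtoC 0) by ring. rewrite Cmod_0. exact He.
Qed.

Lemma ulim_plus (g g' l l' : T -> C) :
  ulim F g l -> ulim F g' l' -> ulim F (fun x => g x + g' x) (fun x => l x + l' x).
Proof.
  intros H H' eps He.
  assert (He2 : (0 < eps / 2)%R) by lra.
  generalize (filter_and _ _ (H _ He2) (H' _ He2)).
  apply filter_imp. intros x [H1 H2].
  replace (g x + g' x - (l x + l' x)) with ((g x - l x) + (g' x - l' x)) by ring.
  eapply Rle_lt_trans; [apply Cmod_triangle |]. lra.
Qed.

Lemma ulim_opp (g l : T -> C) : ulim F g l -> ulim F (fun x => - g x) (fun x => - l x).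
Proof.
  intros H eps He. generalize (H eps He). apply filter_imp. intros x H1.
  replace (- g x - - l x) with (- (g x - l x)) by ring. now rewrite Cmod_opp.
Qed.

Lemma ulim_minus (g g' l l' : T -> C) :
  ulim F g l -> ulim F g' l' -> ulim F (fun x => g x - g' x) (fun x => l x - l' x).
Proof. intros H H'. apply ulim_plus; [exact H |]. now apply ulim_opp. Qed.

Lemma ulim_bdd (g l : T -> C) : ulim F g l -> ubdd F l -> ubdd F g.
Proof.
  intros H [M HM]. exists (M + 1)%R. generalize (filter_and _ _ (H 1%R Rlt_0_1) HM).
  apply filter_imp. intros x [H1 H2].
  pose proof (Cmod_triangle_rev (g x) (l x)). lra.
Qed.

Lemma ulim_0_mult (g g' : T -> C) :
  ulim F g (fun _ => 0) -> ubdd F g' -> ulim F (fun x => g x * g' x) (fun _ => 0).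
Proof.
  intros H [M HM] eps He.
  set (N := (Rabs M + 1)%R). assert (0 < N)%R by (unfold N; pose proof (Rabs_pos M); lra).
  assert (He2 : (0 < eps / N)%R) by (apply Rdiv_lt_0_compat; lra).
  generalize (filter_and _ _ (H _ He2) HM).
  apply filter_imp. intros x [H1 H2].
  replace (g x - 0) with (g x) in H1 by ring.
  replace (g x * g' x - 0) with (g x * g' x) by ring. rewrite Cmod_mult.
  apply Rle_lt_trans with (Cmod (g x) * N)%R.
  - apply Rmult_le_compat_l; [apply Cmod_ge_0 |]. unfold N. pose proof (Rle_abs M). lra.
  - replace eps with (eps / N * N)%R by (field; lra). apply Rmult_lt_compat_r; auto.
Qed.

Lemma ulim_mult (g g' l l' : T -> C) :
  ulim F g l -> ulim F g' l' -> ubdd F l -> ubdd F l' ->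
  ulim F (fun x => g x * g' x) (fun x => l x * l' x).
Proof.
  intros H H' B B'.
  assert (K : ulim F (fun x => (g x - l x) * g' x + (g' x - l' x) * l x)
                     (fun _ => 0 + 0)).
  { apply (ulim_plus _ _ (fun _ => 0) (fun _ => 0)); apply ulim_0_mult; auto.
    - intros eps He. generalize (H eps He). apply filter_imp. intros x.
      now replace (g x - l x - 0) with (g x - l x) by ring.
    - now apply ulim_bdd with l'.
    - intros eps He. generalize (H' eps He). apply filter_imp. intros x.
      now replace (g' x - l' x - 0) with (g' x - l' x) by ring. }
  intros eps He. generalize (K eps He). apply filter_imp. intros x.
  now replace ((g x - l x) * g' x + (g' x - l' x) * l x - (0 + 0))
    with (g x * g' x - l x * l' x) by ring.
Qed.

(** A bound [N] on [/ l] gives [|l| >= / N], so [|g| >= / (2 * N)] once [g] is that close to [l].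
    Since the inverse is a total function, [l <> 0] is a separate hypothesis. *)
Lemma ulim_neq_0 (g l : T -> C) :
  ulim F g l -> ubdd F (fun x => / l x) -> F (fun x => l x <> 0) ->
  ubdd F (fun x => / g x) /\ F (fun x => g x <> 0).
Proof.
  intros H [M HM] Hl.
  set (N := (Rabs M + 1)%R). assert (HN : (0 < N)%R) by (unfold N; pose proof (Rabs_pos M); lra).
  assert (K : F (fun x => (/ (2 * N) <= Cmod (g x))%R)).
  { assert (Hp : (0 < / (2 * N))%R) by (apply Rinv_0_lt_compat; lra).
    generalize (filter_and _ _ (filter_and _ _ HM Hl) (H _ Hp)).
    apply filter_imp. intros x [[H1 H2] H3].
    rewrite Cmod_inv in H1 by auto.
    assert (0 < Cmod (l x))%R by now apply Cmod_gt_0.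
    assert (/ N <= Cmod (l x))%R.
    { rewrite <- (Rinv_inv (Cmod (l x))). apply Rinv_le_contravar.
      - now apply Rinv_0_lt_compat.
      - unfold N. pose proof (Rle_abs M). lra. }
    pose proof (Cmod_triangle_rev (l x) (g x)). rewrite Cmod_minus_sym in H5.
    assert (/ (2 * N) = / N / 2)%R by (field; lra). lra. }
  assert (K2 : F (fun x => g x <> 0)).
  { revert K. apply filter_imp. intros x Hx. apply Cmod_neq_0.
    eapply Rlt_le_trans; [| exact Hx]. apply Rinv_0_lt_compat. lra. }
  split; auto. exists (2 * N)%R. generalize (filter_and _ _ K K2). apply filter_imp.
  intros x [H1 H2]. rewrite Cmod_inv by auto.
  rewrite <- (Rinv_inv (2 * N)). apply Rinv_le_contravar; auto. apply Rinv_0_lt_compat; lra.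
Qed.

Lemma ulim_inv (g l : T -> C) :
  ulim F g l -> ubdd F (fun x => / l x) -> F (fun x => l x <> 0) ->
  ulim F (fun x => / g x) (fun x => / l x).
Proof.
  intros H B Hl. destruct (ulim_neq_0 _ _ H B Hl) as [B' Hg].
  assert (K : ulim F (fun x => - (g x - l x) * (/ g x * / l x)) (fun _ => 0)).
  { apply ulim_0_mult; [| now apply ubdd_mult].
    intros eps He. generalize (H eps He). apply filter_imp. intros x.
    replace (- (g x - l x) - 0) with (- (g x - l x)) by ring. now rewrite Cmod_opp. }
  intros eps He. generalize (filter_and _ _ (filter_and _ _ Hl Hg) (K eps He)).
  apply filter_imp. intros x [[H1 H2] H3].
  now replace (/ g x - / l x) with (- (g x - l x) * (/ g x * / l x) - 0) by (field; auto).
Qed.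

Lemma ulim_div (g g' l l' : T -> C) :
  ulim F g l -> ulim F g' l' -> ubdd F l -> ubdd F (fun x => / l' x) ->
  F (fun x => l' x <> 0) -> ulim F (fun x => g x / g' x) (fun x => l x / l' x).
Proof. intros. apply ulim_mult; auto. now apply ulim_inv. Qed.

Lemma ulim_conj (g l : T -> C) :
  ulim F g l -> ulim F (fun x => Cconj (g x)) (fun x => Cconj (l x)).
Proof.
  intros H eps He. generalize (H eps He). apply filter_imp. intros x.
  now rewrite <- Cminus_conj, Cmod_conj.
Qed.

Lemma ulim_re_le (g : T -> C) (l : C) {PF : ProperFilter F} :
  ulim F g (fun _ => l) -> F (fun x => (0 <= Re (g x))%R) -> (0 <= Re l)%R.
Proof.
  intros H H1. destruct (Rle_lt_dec 0 (Re l)) as [|Hn]; auto. exfalso.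
  assert (He : (0 < - Re l)%R) by lra.
  destruct (filter_ex _ (filter_and _ _ (H _ He) H1)) as [x [H2 H3]].
  pose proof (re_le_Cmod (g x - l)). unfold Cminus in *.
  rewrite re_plus, re_opp in H0. pose proof (Rle_abs (Re (g x) + - Re l)). lra.
Qed.

End ULim.

Lemma ulim_le {T : Type} (F F' : (T -> Prop) -> Prop) (g l : T -> C) :
  filter_le F F' -> ulim F' g l -> ulim F g l.
Proof. intros H K eps He. apply H. now apply K. Qed.

Lemma ulim_comp {T U : Type} (F : (T -> Prop) -> Prop) (F' : (U -> Prop) -> Prop)
  (phi : T -> U) (g l : U -> C) :
  filterlim phi F F' -> ulim F' g l -> ulim F (fun x => g (phi x)) (fun x => l (phi x)).
Proof. intros H K eps He. apply (H (fun y => (Cmod (g y - l y) < eps)%R)). now apply K. Qed.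

(** * Continuity and derivatives *)

Definition ccont (g : C -> C) (z : C) : Prop :=
  ulim (locally (T := C_UniformSpace) z) g (fun _ => g z).

Lemma ccont_iff (g : C -> C) (z : C) : ccont g z <->
  forall eps, (0 < eps)%R -> exists d, (0 < d)%R /\
    forall w, (Cmod (w - z) < d)%R -> (Cmod (g w - g z) < eps)%R.
Proof.
  split; intros H eps He.
  - apply locally_C_iff. now apply H.
  - apply locally_C_iff. now apply H.
Qed.

Lemma ulim_id (z : C) : ulim (locally (T := C_UniformSpace) z) (fun w => w) (fun _ => z).
Proof. intros eps He. apply locally_C_iff. exists eps. auto. Qed.

Ltac ulim_tac :=
  repeat first [ assumption | apply ubdd_const | apply ulim_id | apply ulim_refl | apply ulim_opp
    | apply ulim_minus | apply ulim_plus | apply ulim_mult | apply ubdd_plus | apply ubdd_mult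
    | apply ubdd_opp ].

Definition cd (g : C -> C) (z d : C) : Prop :=
  is_derive (K := C_AbsRing) (V := C_NormedModule) g z d.

(** Caratheodory's form of the derivative. The slope identity holds for all [w], so each rule of
    calculus below reduces to an algebraic identity between slopes and a limit rule for [ulim]. *)
Lemma cd_slope (g : C -> C) (z d : C) :
  cd g z d <-> exists s : C -> C, ulim (locally (T := C_UniformSpace) z) s (fun _ => d) /\
    forall w, g w = g z + (w - z) * s w.
Proof.
  split.
  - intros [_ H]. specialize (H z (fun P HP => HP)).
    exists (fun w => match Ceq_dec w z with left _ => d | _ => (g w - g z) / (w - z) end). split.
    + intros eps He. assert (He2 : (0 < eps / 2)%R) by lra.
      specialize (H (mkposreal _ He2)). simpl in H.
      assert (H' : locally (T := C_UniformSpace) z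
        (fun w => (Cmod (g w - g z - (w - z) * d) <= eps / 2 * Cmod (w - z))%R)).
      { apply locally_C in H. exact H. }
      revert H'. apply filter_imp. intros w Hw. destruct (Ceq_dec w z) as [E | E].
      * replace (d - d) with (RtoC 0) by ring. rewrite Cmod_0. lra.
      * assert (w - z <> 0) by now apply Cminus_eq_contra.
        replace ((g w - g z) / (w - z) - d) with ((g w - g z - (w - z) * d) / (w - z)) by (field; auto).
        rewrite Cmod_div by auto. apply Rle_lt_trans with (eps / 2)%R; [| lra].
        assert (0 < Cmod (w - z))%R by now apply Cmod_gt_0.
        apply (Rmult_le_reg_r (Cmod (w - z))); auto.
        unfold Rdiv at 1. rewrite Rmult_assoc, Rinv_l by lra. lra.
    + intros w. destruct (Ceq_dec w z) as [E | E].
      * subst. ring.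
      * assert (w - z <> 0) by now apply Cminus_eq_contra. field. auto.
  - intros (s & Hs & E). split; [apply is_linear_scal_l |].
    intros x Hx. apply (is_filter_lim_locally_unique (K := C_AbsRing) (V := AbsRing_NormedModule C_AbsRing)) in Hx. subst x.
    intros eps. apply locally_C.
    generalize (Hs eps (cond_pos eps)). apply filter_imp. intros w Hw.
    change (Cmod (g w - g z - (w - z) * d) <= eps * Cmod (w - z))%R.
    rewrite (E w). replace (g z + (w - z) * s w - g z - (w - z) * d) with ((s w - d) * (w - z)) by ring.
    rewrite Cmod_mult. apply Rmult_le_compat_r; [apply Cmod_ge_0 | lra].
Qed.

Lemma cd_eps (g : C -> C) (z d : C) :
  (forall eps, (0 < eps)%R -> exists r, (0 < r)%R /\ forall w, (Cmod (w - z) < r)%R ->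
     (Cmod (g w - g z - (w - z) * d) <= eps * Cmod (w - z))%R) -> cd g z d.
Proof.
  intros H. split; [apply is_linear_scal_l |].
  intros x Hx. apply (is_filter_lim_locally_unique (K := C_AbsRing) (V := AbsRing_NormedModule C_AbsRing)) in Hx. subst x.
  intros eps. apply locally_C. apply locally_C_iff. exact (H eps (cond_pos eps)).
Qed.

Lemma cd_eps_inv (g : C -> C) (z d : C) : cd g z d ->
  forall eps, (0 < eps)%R -> exists r, (0 < r)%R /\ forall w, (Cmod (w - z) < r)%R ->
     (Cmod (g w - g z - (w - z) * d) <= eps * Cmod (w - z))%R.
Proof.
  intros [_ H] eps He. specialize (H z (fun P HP => HP) (mkposreal eps He)).
  apply locally_C in H. apply locally_C_iff in H. exact H.
Qed.

Lemma cd_cont (g : C -> C) (z d : C) : cd g z d -> ccont g z.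
Proof.
  intros H. apply cd_slope in H. destruct H as (s & Hs & E).
  apply (ulim_ext (fun w => g z + (w - z) * s w) _ (fun _ => g z + (z - z) * d)).
  - apply filter_forall. intros. now rewrite <- E.
  - apply filter_forall. intros. ring.
  - ulim_tac.
Qed.

Lemma cd_eq (g : C -> C) (z d d' : C) : cd g z d -> d = d' -> cd g z d'.
Proof. now intros H <-. Qed.

Lemma cd_unique (g : C -> C) (z d d' : C) : cd g z d -> cd g z d' -> d = d'.
Proof. intros H H'. apply is_C_derive_unique in H, H'. congruence. Qed.

Lemma cd_ext_loc (g g' : C -> C) (z d : C) :
  locally (T := C_UniformSpace) z (fun w => g w = g' w) -> cd g z d -> cd g' z d.
Proof.
  intros H K. eapply is_derive_ext_loc; [| exact K]. apply locally_C. exact H.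
Qed.

Lemma cd_const (c z : C) : cd (fun _ => c) z 0.
Proof. apply cd_slope. exists (fun _ => 0). split; [apply ulim_refl | intros; ring]. Qed.

Lemma cd_id (z : C) : cd (fun w => w) z 1.
Proof. apply cd_slope. exists (fun _ => 1). split; [apply ulim_refl | intros; ring]. Qed.

Lemma cd_plus (g k : C -> C) (z d e : C) :
  cd g z d -> cd k z e -> cd (fun w => g w + k w) z (d + e).
Proof.
  rewrite !cd_slope. intros (s & Hs & E) (s' & Hs' & E').
  exists (fun w => s w + s' w). split; [now apply ulim_plus |].
  intros w. rewrite (E w), (E' w). ring.
Qed.

Lemma cd_opp (g : C -> C) (z d : C) : cd g z d -> cd (fun w => - g w) z (- d).
Proof.
  rewrite !cd_slope. intros (s & Hs & E).
  exists (fun w => - s w). split; [now apply ulim_opp |].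
  intros w. rewrite (E w). ring.
Qed.

Lemma cd_minus (g k : C -> C) (z d e : C) :
  cd g z d -> cd k z e -> cd (fun w => g w - k w) z (d - e).
Proof. intros. apply cd_plus; auto. now apply cd_opp. Qed.

Lemma cd_mult (g k : C -> C) (z d e : C) :
  cd g z d -> cd k z e -> cd (fun w => g w * k w) z (d * k z + g z * e).
Proof.
  intros H H'. pose proof (cd_cont _ _ _ H') as Hk.
  rewrite cd_slope in *. destruct H as (s & Hs & E), H' as (s' & Hs' & E').
  exists (fun w => s w * k w + g z * s' w). split.
  - ulim_tac.
  - intros w. rewrite (E w), (E' w). ring.
Qed.

Lemma cd_inv (g : C -> C) (z d : C) : cd g z d -> g z <> 0 ->
  cd (fun w => / g w) z (- d / (g z * g z)).
Proof.
  intros H Hz. pose proof (cd_cont _ _ _ H) as Hg.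
  assert (Hn : locally (T := C_UniformSpace) z (fun w => g w <> 0)).
  { apply (fun H1 H2 H3 =>
      proj2 (ulim_neq_0 (F := locally (T := C_UniformSpace) z) g (fun _ => g z) H1 H2 H3));
      [exact Hg | apply ubdd_const | now apply filter_forall]. }
  rewrite cd_slope in H. destruct H as (s & Hs & E).
  assert (Hn' := Hn). apply locally_C_iff in Hn'. destruct Hn' as (r & Hr & Hn').
  apply cd_slope.
  (* The slope identity is required even where [g w = 0], with the default value of [/ g w]. Such
     [w] differ from [z], so the plain difference quotient serves there; near [z] the other branch
     is in force. *)
  exists (fun w => match Ceq_dec (g w) 0 with left _ => (/ g w - / g z) / (w - z)
                   | _ => - s w / (g w * g z) end). split.
  - apply (ulim_ext (fun w => - s w / (g w * g z)) _ (fun _ => - d / (g z * g z))).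
    + revert Hn. apply filter_imp. intros w Hw. now destruct (Ceq_dec (g w) 0).
    + apply filter_forall. intros; reflexivity.
    + apply ulim_div; ulim_tac.
      * apply filter_forall. intros _. now apply Cmult_neq_0.
  - intros w. destruct (Ceq_dec (g w) 0) as [E0 | E0].
    + assert (w - z <> 0). { intros E1. apply Hz. rewrite <- E0. f_equal.
        apply Ceq_minus. replace (z - w) with (- (w - z)) by ring. rewrite E1. ring. }
      generalize (/ g w) (/ g z). intros a b. field. auto.
    + transitivity (/ g z + (g z - g w) / (g w * g z)).
      * field; auto.
      * rewrite (E w). rewrite (E w) in E0. field. auto.
Qed.

Lemma cd_div (g k : C -> C) (z d e : C) :
  cd g z d -> cd k z e -> k z <> 0 ->
  cd (fun w => g w / k w) z ((d * k z - g z * e) / (k z * k z)).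
Proof.
  intros H H' Hz. eapply cd_eq; [apply cd_mult; [exact H | apply cd_inv; eauto] |].
  cbv beta. field. auto.
Qed.

Lemma cd_comp (g phi : C -> C) (z d e : C) :
  cd g (phi z) d -> cd phi z e -> cd (fun w => g (phi w)) z (d * e).
Proof.
  intros H H'. pose proof (cd_cont _ _ _ H') as Hp.
  rewrite cd_slope in *. destruct H as (s & Hs & E), H' as (s' & Hs' & E').
  exists (fun w => s (phi w) * s' w). split.
  - ulim_tac.
    apply (ulim_comp _ (locally (T := C_UniformSpace) (phi z)) phi s (fun _ => d)); auto.
    apply (proj2 (C_cvg_ulim _ _ _)). exact Hp.
  - intros w. rewrite (E (phi w)). rewrite (E' w) at 1. ring.
Qed.

Lemma C_derive_cd (g : C -> C) (z : C) : C_differentiable g z -> cd g z (C_derive g z).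
Proof. intros H. apply C_derive_correct; [exact 0 | exact H]. Qed.

(** * Differentiable curves in C *)

Definition rd (g : R -> C) (t : R) (d : C) : Prop :=
  is_derive (K := R_AbsRing) (V := C_R_NormedModule) g t d.

Lemma locally_R_iff (t : R) (P : R -> Prop) :
  locally t P <-> exists d : R, (0 < d)%R /\ forall w, (Rabs (w - t) < d)%R -> P w.
Proof.
  split.
  - intros [d Hd]. exists d. split; [apply cond_pos |]. intros w Hw. apply Hd. exact Hw.
  - intros (d & Hd & H). exists (mkposreal d Hd). intros w Hw. apply H. exact Hw.
Qed.

Lemma C_scal_R (x : R) (y : C) :
  @scal R_AbsRing (NormedModule.ModuleSpace R_AbsRing C_R_NormedModule) x y = RtoC x * y.
Proof. exact (scal_R_Cmult x y). Qed.

Lemma rd_slope (g : R -> C) (t : R) (d : C) :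
  rd g t d <-> exists s : R -> C, ulim (locally t) s (fun _ => d) /\
    forall w, g w = g t + RtoC (w - t) * s w.
Proof.
  split.
  - intros [_ H]. specialize (H t (fun P HP => HP)).
    exists (fun w => match Req_dec_T w t with left _ => d | _ => (g w - g t) / RtoC (w - t) end). split.
    + intros eps He. assert (He2 : (0 < eps / 2)%R) by lra.
      specialize (H (mkposreal _ He2)). simpl in H.
      assert (H' : locally t
        (fun w => (Cmod (g w - g t - RtoC (w - t) * d) <= eps / 2 * Rabs (w - t))%R)).
      { revert H. apply filter_imp. intros w Hw.
        rewrite C_scal_R in Hw. rewrite Cmod_norm. exact Hw. }
      revert H'. apply filter_imp. intros w Hw. destruct (Req_dec_T w t) as [E | E].
      * replace (d - d) with (RtoC 0) by ring. rewrite Cmod_0. lra.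
      * assert (RtoC (w - t) <> 0). { intros K. apply RtoC_inj in K. lra. }
        replace ((g w - g t) / RtoC (w - t) - d)
          with ((g w - g t - RtoC (w - t) * d) / RtoC (w - t)) by (field; auto).
        rewrite Cmod_div by auto. apply Rle_lt_trans with (eps / 2)%R; [| lra].
        rewrite Cmod_R. assert (0 < Rabs (w - t))%R by (apply Rabs_pos_lt; lra).
        apply (Rmult_le_reg_r (Rabs (w - t))); auto.
        unfold Rdiv at 1. rewrite Rmult_assoc, Rinv_l by lra. lra.
    + intros w. destruct (Req_dec_T w t) as [E | E].
      * subst. replace (t - t)%R with 0%R by ring. ring.
      * assert (RtoC (w - t) <> 0). { intros K. apply RtoC_inj in K. lra. } field. auto.
  - intros (s & Hs & E). split; [apply is_linear_scal_l |].
    intros x Hx. apply (is_filter_lim_locally_unique (K := R_AbsRing) (V := R_NormedModule)) in Hx. subst x.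
    intros eps.
    generalize (Hs eps (cond_pos eps)). apply filter_imp. intros w Hw.
    rewrite C_scal_R.
    match goal with |- (?A <= _)%R => replace A with (Cmod (g w - g t - RtoC (w - t) * d)) by apply Cmod_norm end.
    change (Cmod (g w - g t - RtoC (w - t) * d) <= eps * Rabs (w - t))%R.
    rewrite (E w). replace (g t + RtoC (w - t) * s w - g t - RtoC (w - t) * d)
      with ((s w - d) * RtoC (w - t)) by ring.
    rewrite Cmod_mult, Cmod_R. apply Rmult_le_compat_r; [apply Rabs_pos | lra].
Qed.

Lemma rd_eq (g : R -> C) (t : R) (d d' : C) : rd g t d -> d = d' -> rd g t d'.
Proof. now intros H <-. Qed.

Lemma ulim_R_id (t : R) : ulim (locally t) RtoC (fun _ => RtoC t).
Proof.
  intros eps He. apply locally_R_iff. exists eps. split; auto. intros w Hw.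
  rewrite <- RtoC_minus, Cmod_R. exact Hw.
Qed.

Lemma rd_cont (g : R -> C) (t : R) (d : C) : rd g t d -> ulim (locally t) g (fun _ => g t).
Proof.
  intros H. apply rd_slope in H. destruct H as (s & Hs & E).
  apply (ulim_ext (fun w => g t + (RtoC w - RtoC t) * s w) _ (fun _ => g t + (RtoC t - RtoC t) * d)).
  - apply filter_forall. intros x. now rewrite <- RtoC_minus, <- E.
  - apply filter_forall. intros. ring.
  - ulim_tac. apply ulim_R_id.
Qed.

Lemma rd_comp (g : C -> C) (phi : R -> C) (t : R) (d e : C) :
  cd g (phi t) d -> rd phi t e -> rd (fun w => g (phi w)) t (d * e).
Proof.
  intros H H'. pose proof (rd_cont _ _ _ H') as Hp.
  rewrite cd_slope in H. rewrite rd_slope in *. destruct H as (s & Hs & E), H' as (s' & Hs' & E').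
  exists (fun w => s (phi w) * s' w). split.
  - ulim_tac.
    apply (ulim_comp _ (locally (T := C_UniformSpace) (phi t)) phi s (fun _ => d)); auto.
    apply (proj2 (C_cvg_ulim _ _ _)). exact Hp.
  - intros w. rewrite (E (phi w)). rewrite (E' w) at 1. ring.
Qed.

Lemma rd_affine (a b : C) (t : R) : rd (fun s => a + RtoC s * b) t b.
Proof.
  apply rd_slope. exists (fun _ => b). split; [apply ulim_refl |].
  intros w. rewrite RtoC_minus. ring.
Qed.

Lemma rd_re (g : R -> C) (t : R) (d : C) : rd g t d -> is_derive (fun s => Re (g s)) t (Re d).
Proof.
  intros H. rewrite rd_slope in H. destruct H as (s & Hs & E).
  split; [apply is_linear_scal_l |].
  intros x Hx. apply (is_filter_lim_locally_unique (K := R_AbsRing) (V := R_NormedModule)) in Hx. subst x.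
  intros eps. generalize (Hs eps (cond_pos eps)). apply filter_imp. intros w Hw.
  change (Rabs (Re (g w) - Re (g t) - (w - t) * Re d) <= eps * Rabs (w - t))%R.
  rewrite (E w), re_plus, re_scal_l.
  replace (Re (g t) + (w - t) * Re (s w) - Re (g t) - (w - t) * Re d)%R
    with (Re (s w - d) * (w - t))%R by (unfold Cminus; rewrite re_plus, re_opp; ring).
  rewrite Rabs_mult. apply Rmult_le_compat_r; [apply Rabs_pos |].
  pose proof (re_le_Cmod (s w - d)). lra.
Qed.

(** * Mean value estimates *)

(** The mean value theorem fails for complex values. It holds for the real part of [c * g] along the
    segment, and the free factor [c] lets each application choose the direction to be tested. *)
Lemma segment_mvt (g g' : C -> C) (a b c : C) :
  (forall t, (0 <= t <= 1)%R -> cd g (a + RtoC t * (b - a)) (g' (a + RtoC t * (b - a)))) ->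
  exists t, (0 <= t <= 1)%R /\
    Re (c * (g b - g a)) = Re (c * (g' (a + RtoC t * (b - a)) * (b - a))).
Proof.
  intros H.
  assert (K : forall x, (0 <= x <= 1)%R ->
    rd (fun s => c * g (a + RtoC s * (b - a))) x (c * (g' (a + RtoC x * (b - a)) * (b - a)))).
  { intros x Hx. eapply rd_eq.
    - apply (rd_comp (fun w => c * g w) (fun s => a + RtoC s * (b - a))).
      + apply cd_mult; [apply cd_const | apply H; exact Hx].
      + apply rd_affine.
    - cbv beta. ring. }
  destruct (MVT_gen (fun s => Re (c * g (a + RtoC s * (b - a)))) 0 1
    (fun s => Re (c * (g' (a + RtoC s * (b - a)) * (b - a))))) as (t & Ht & E).
  - intros x Hx. rewrite Rmin_left, Rmax_right in Hx by lra.
    apply (rd_re (fun s => c * g (a + RtoC s * (b - a)))). apply K. lra.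
  - intros x Hx. rewrite Rmin_left, Rmax_right in Hx by lra.
    apply continuity_pt_filterlim. apply (ex_derive_continuous (K := R_AbsRing) (V := R_NormedModule)).
    eexists. apply (rd_re (fun s => c * g (a + RtoC s * (b - a)))). apply K. lra.
  - rewrite Rmin_left, Rmax_right in Ht by lra. exists t. split; [exact Ht |].
    rewrite Rminus_0_r, Rmult_1_r in E. rewrite <- E.
    replace (a + 1 * (b - a)) with b by ring. replace (a + 0 * (b - a)) with a by ring.
    unfold Cminus. rewrite Cmult_plus_distr_l, re_plus.
    replace (c * - g a) with (- (c * g a)) by ring. rewrite re_opp. reflexivity.
Qed.

Lemma segment_lip (g g' : C -> C) (a b : C) (M : R) :
  (forall t, (0 <= t <= 1)%R -> cd g (a + RtoC t * (b - a)) (g' (a + RtoC t * (b - a)))) ->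
  (forall t, (0 <= t <= 1)%R -> (Cmod (g' (a + RtoC t * (b - a))%C) <= M)%R) ->
  (Cmod (g b - g a) <= M * Cmod (b - a))%R.
Proof.
  (* With [c] the conjugate of the increment [u], the left side becomes [|u|^2], and one factor
     [|u|] cancels against the right side. *)
  intros H HM. destruct (segment_mvt g g' a b (Cconj (g b - g a)) H) as (t & Ht & E).
  set (u := g b - g a) in *.
  assert (E1 : Re (Cconj u * u) = (Cmod u * Cmod u)%R).
  { rewrite Cmod_sqr, re_mult, re_conj, im_conj. ring. }
  rewrite E1 in E.
  pose proof (re_le_Cmod (Cconj u * (g' (a + RtoC t * (b - a)) * (b - a)))) as K.
  rewrite <- E, !Cmod_mult, Cmod_conj in K.
  pose proof (Rle_abs (Cmod u * Cmod u)).
  pose proof (Cmod_ge_0 u). pose proof (Cmod_ge_0 (b - a)). pose proof (HM t Ht).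
  destruct (Req_dec (Cmod u) 0) as [Z | Z].
  - rewrite Z. apply Rmult_le_pos; auto. eapply Rle_trans; [apply Cmod_ge_0 | exact H3].
  - apply (Rmult_le_reg_l (Cmod u)); [lra |].
    eapply Rle_trans; [| apply (Rmult_le_compat_l (Cmod u)); [lra |
      apply (Rmult_le_compat_r (Cmod (b - a))); [lra | exact H3]]]. lra.
Qed.

Lemma segment_const (g : C -> C) (a b : C) :
  (forall t, (0 <= t <= 1)%R -> cd g (a + RtoC t * (b - a)) 0) -> g b = g a.
Proof.
  intros H. apply Ceq_minus. apply Cmod_eq_0.
  pose proof (segment_lip g (fun _ => 0) a b 0 H) as K.
  pose proof (Cmod_ge_0 (g b - g a)).
  specialize (K (fun _ _ => Req_le _ _ Cmod_0)). lra.
Qed.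

(** * The complex exponential *)

Lemma Cexp_plus (a b : C) : Cexp (a + b) = Cexp a * Cexp b.
Proof.
  unfold Cexp. rewrite re_plus, im_plus, exp_plus, cos_plus, sin_plus.
  apply C_ext; simpl; ring.
Qed.

Lemma Cexp_0 : Cexp 0 = 1.
Proof. unfold Cexp. simpl. rewrite exp_0, cos_0, sin_0. apply C_ext; simpl; ring. Qed.

Lemma Cexp_neq_0 (a : C) : Cexp a <> 0.
Proof.
  intros H. pose proof (Cexp_plus a (- a)) as K. rewrite H in K.
  replace (a + - a) with (RtoC 0) in K by ring. rewrite Cexp_0, Cmult_0_l in K.
  apply RtoC_inj in K. lra.
Qed.

Lemma Cexp_opp (a : C) : Cexp (- a) = / Cexp a.
Proof.
  pose proof (Cexp_plus a (- a)) as K. replace (a + - a) with (RtoC 0) in K by ring.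
  rewrite Cexp_0 in K. pose proof (Cexp_neq_0 a).
  replace (/ Cexp a) with (/ Cexp a * 1) by ring. rewrite K. field. auto.
Qed.

Lemma Cexp_minus (a b : C) : Cexp (a - b) = Cexp a / Cexp b.
Proof. unfold Cminus. rewrite Cexp_plus, Cexp_opp. reflexivity. Qed.

Lemma Cmod_Cexp (a : C) : Cmod (Cexp a) = exp (Re a).
Proof.
  pose proof (exp_pos (Re a)). pose proof (Cmod_ge_0 (Cexp a)).
  assert (Cmod (Cexp a) * Cmod (Cexp a) = exp (Re a) * exp (Re a))%R.
  { rewrite Cmod_sqr. unfold Cexp. simpl. pose proof (sin2_cos2 (Im a)). unfold Rsqr in *. nra. }
  nra.
Qed.

Lemma is_derive_eps (h : R -> R) (t l : R) : is_derive h t l ->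
  forall eps, (0 < eps)%R -> exists r, (0 < r)%R /\ forall w, (Rabs (w - t) < r)%R ->
     (Rabs (h w - h t - (w - t) * l) <= eps * Rabs (w - t))%R.
Proof.
  intros [_ H] eps He. specialize (H t (fun P HP => HP) (mkposreal eps He)).
  apply locally_R_iff in H. exact H.
Qed.

Lemma cd_Cexp_0 : cd Cexp 0 1.
Proof.
  apply cd_eps. intros eps He.
  assert (D1 : is_derive exp 0 1).
  { evar_last; [apply is_derive_exp | apply exp_0]. }
  assert (D2 : is_derive sin 0 1).
  { evar_last; [apply is_derive_sin | apply cos_0]. }
  assert (D3 : is_derive cos 0 0).
  { evar_last; [apply is_derive_cos | rewrite sin_0; apply Ropp_0]. }
  (* The errors below add up to [e * |x| + 5 * e * |y|], hence to at most [6 * e * |w|]. The bound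
     [e <= 1] gives [|exp x - 1| <= e] for [|x| < e / 2]. *)
  set (e := Rmin (eps / 6) 1).
  assert (He0 : (0 < e)%R) by (apply Rmin_glb_lt; lra).
  assert (He1 : (e <= eps / 6)%R) by apply Rmin_l.
  assert (He2 : (e <= 1)%R) by apply Rmin_r.
  destruct (is_derive_eps _ _ _ D1 e He0) as (r1 & Hr1 & B1).
  destruct (is_derive_eps _ _ _ D2 e He0) as (r2 & Hr2 & B2).
  destruct (is_derive_eps _ _ _ D3 e He0) as (r3 & Hr3 & B3).
  exists (Rmin (Rmin r1 r2) (Rmin r3 (e / 2))). split.
  { repeat apply Rmin_glb_lt; lra. }
  intros w Hw. rewrite Cexp_0. replace (w - 0) with w in * by ring.
  assert (Hw1 : (Cmod w < r1)%R).
  { eapply Rlt_le_trans; [exact Hw |]. eapply Rle_trans; [apply Rmin_l | apply Rmin_l]. }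
  assert (Hw2 : (Cmod w < r2)%R).
  { eapply Rlt_le_trans; [exact Hw |]. eapply Rle_trans; [apply Rmin_l | apply Rmin_r]. }
  assert (Hw3 : (Cmod w < r3)%R).
  { eapply Rlt_le_trans; [exact Hw |]. eapply Rle_trans; [apply Rmin_r | apply Rmin_l]. }
  assert (Hw4 : (Cmod w < e / 2)%R).
  { eapply Rlt_le_trans; [exact Hw |]. eapply Rle_trans; [apply Rmin_r | apply Rmin_r]. }
  pose proof (re_le_Cmod w) as Rx. pose proof (im_le_Cmod w) as Ry.
  set (x := Re w) in *. set (y := Im w) in *.
  specialize (B1 x). specialize (B2 y). specialize (B3 y).
  rewrite Rminus_0_r in B1, B2, B3. rewrite exp_0 in B1. rewrite sin_0 in B2. rewrite cos_0 in B3.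
  specialize (B1 ltac:(lra)). specialize (B2 ltac:(lra)). specialize (B3 ltac:(lra)).
  assert (Ex : (Rabs (exp x - 1) <= e)%R).
  { replace (exp x - 1)%R with ((exp x - 1 - x * 1) + x)%R by ring.
    eapply Rle_trans; [apply Rabs_triang |]. pose proof (Rabs_pos x). nra. }
  assert (Ex2 : (exp x <= 2)%R).
  { pose proof (Rle_abs (exp x - 1)). lra. }
  pose proof (exp_pos x) as Ex0.
  eapply Rle_trans; [apply Cmod_le_Rabs |].
  replace (Re (Cexp w - 1 - w * 1)) with ((exp x - 1 - x * 1) + exp x * (cos y - 1 - y * 0))%R.
  2:{ unfold Cminus. rewrite !re_plus, !re_opp, re_mult, !re_RtoC, im_RtoC. unfold Cexp. simpl.
      fold x y. ring. }
  replace (Im (Cexp w - 1 - w * 1)) with (exp x * (sin y - 0 - y * 1) + (exp x - 1) * y)%R.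
  2:{ unfold Cminus. rewrite !im_plus, !im_opp, im_mult, !re_RtoC, !im_RtoC. unfold Cexp. simpl.
      fold x y. ring. }
  pose proof (Rabs_triang (exp x - 1 - x * 1) (exp x * (cos y - 1 - y * 0))) as T1.
  pose proof (Rabs_triang (exp x * (sin y - 0 - y * 1)) ((exp x - 1) * y)) as T2.
  rewrite Rabs_mult in T1. rewrite !Rabs_mult in T2.
  rewrite (Rabs_pos_eq (exp x)) in T1, T2 by lra.
  pose proof (Rabs_pos (cos y - 1 - y * 0)). pose proof (Rabs_pos (sin y - 0 - y * 1)).
  pose proof (Rabs_pos x). pose proof (Rabs_pos y).
  assert (exp x * Rabs (cos y - 1 - y * 0) <= 2 * (e * Rabs y))%R by (apply Rmult_le_compat; lra).
  assert (exp x * Rabs (sin y - 0 - y * 1) <= 2 * (e * Rabs y))%R by (apply Rmult_le_compat; lra).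
  assert (Rabs (exp x - 1) * Rabs y <= e * Rabs y)%R by (apply Rmult_le_compat_r; lra).
  assert (e * Rabs x <= e * Cmod w)%R by (apply Rmult_le_compat_l; lra).
  assert (e * Rabs y <= e * Cmod w)%R by (apply Rmult_le_compat_l; lra).
  assert (e * Cmod w <= eps / 6 * Cmod w)%R by (apply Rmult_le_compat_r; [apply Cmod_ge_0 | lra]).
  lra.
Qed.

Lemma cd_Cexp (z : C) : cd Cexp z (Cexp z).
Proof.
  apply (cd_ext_loc (fun w => Cexp z * Cexp (w - z))).
  - apply filter_forall. intros w. rewrite <- Cexp_plus. f_equal. ring.
  - eapply cd_eq.
    + apply cd_mult; [apply cd_const |].
      apply (cd_comp Cexp (fun w => w - z) z 1 1).
      * replace (z - z) with (RtoC 0) by ring. apply cd_Cexp_0.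
      * eapply cd_eq; [apply cd_minus; [apply cd_id | apply cd_const] | ring].
    + cbv beta. ring.
Qed.

Lemma cd_Cexp_comp (g : C -> C) (z d : C) : cd g z d -> cd (fun w => Cexp (g w)) z (Cexp (g z) * d).
Proof. intros H. apply (cd_comp Cexp g); [apply cd_Cexp | exact H]. Qed.

Definition Cturn : C := (0, (2 * PI)%R).

Lemma Cexp_turn : Cexp Cturn = 1.
Proof.
  unfold Cexp, Cturn. simpl. rewrite cos_2PI, sin_2PI, exp_0. apply C_ext; simpl; ring.
Qed.

Lemma Cexp_Zturn (n : Z) : Cexp (IZR n * Cturn) = 1.
Proof.
  assert (K : forall m : nat, Cexp (INR m * Cturn) = 1).
  { induction m as [| m IH].
    - simpl. rewrite Cmult_0_l. apply Cexp_0.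
    - rewrite S_INR, RtoC_plus.
      replace ((RtoC (INR m) + 1) * Cturn) with (INR m * Cturn + Cturn) by ring.
      rewrite Cexp_plus, IH, Cexp_turn. ring. }
  destruct n as [| p | p].
  - rewrite Cmult_0_l. apply Cexp_0.
  - change (IZR (Z.pos p)) with (IPR p). rewrite <- INR_IPR. apply K.
  - change (IZR (Zneg p)) with (- IZR (Zpos p))%R.
    rewrite RtoC_opp. replace (- RtoC (IZR (Z.pos p)) * Cturn) with (- (RtoC (IZR (Z.pos p)) * Cturn)) by ring.
    rewrite Cexp_opp. change (IZR (Z.pos p)) with (IPR p). rewrite <- INR_IPR, K. field.
Qed.

Lemma Cexp_eq_1 (u : C) : Cexp u = 1 -> exists n : Z, u = IZR n * Cturn.
Proof.
  intros H.
  assert (Hx : Re u = 0%R).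
  { pose proof (Cmod_Cexp u) as K. rewrite H, Cmod_1 in K. symmetry in K.
    rewrite <- exp_0 in K. now apply exp_inv in K. }
  assert (Hc : cos (Im u) = 1%R).
  { apply (f_equal Re) in H. unfold Cexp in H. simpl in H. rewrite Hx, exp_0 in H. lra. }
  assert (Hs : sin (Im u) = 0%R).
  { apply (f_equal Im) in H. unfold Cexp in H. simpl in H. rewrite Hx, exp_0 in H. lra. }
  destruct (sin_eq_0_0 _ Hs) as [k Hk].
  (* The sine only shows that [Im u] is a multiple of [PI]; an odd multiple is excluded because the
     exponential would be [-1]. *)
  destruct (Z.Even_or_Odd k) as [[m E] | [m E]].
  - exists m. apply C_ext.
    + rewrite Hx, re_scal_l. simpl. ring.
    + rewrite Hk, im_scal_l, E, mult_IZR. simpl. ring.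
  - exfalso.
    assert (E2 : u = IZR m * Cturn + (0, PI)%R).
    { apply C_ext.
      - rewrite Hx, re_plus, re_scal_l. simpl. ring.
      - rewrite Hk, im_plus, im_scal_l, E, plus_IZR, mult_IZR. simpl. ring. }
    rewrite E2, Cexp_plus, Cexp_Zturn, Cmult_1_l in H.
    apply (f_equal Re) in H. unfold Cexp in H. simpl in H. rewrite exp_0, cos_PI in H. lra.
Qed.

Lemma Cexp_eq (u v : C) : Cexp u = Cexp v -> exists n : Z, u = v + IZR n * Cturn.
Proof.
  intros H. destruct (Cexp_eq_1 (u - v)) as [n Hn].
  - rewrite Cexp_minus, H. field. apply Cexp_neq_0.
  - exists n. rewrite <- Hn. ring.
Qed.

Lemma Cexp_surj (z : C) : z <> 0 -> exists u, Cexp u = z.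
Proof.
  intros Hz. assert (Hm : (0 < Cmod z)%R) by now apply Cmod_gt_0.
  set (x := (Re z / Cmod z)%R). set (y := (Im z / Cmod z)%R).
  assert (E : (x * x + y * y = 1)%R).
  { unfold x, y. pose proof (Cmod_sqr z).
    transitivity ((Re z * Re z + Im z * Im z) / (Cmod z * Cmod z))%R; [field; lra |].
    rewrite <- H. field. lra. }
  assert (Hx : (-1 <= x <= 1)%R) by (split; nra).
  assert (T : exists t, cos t = x /\ sin t = y).
  { destruct (Rle_lt_dec 0 y) as [Hy | Hy].
    - exists (acos x). rewrite cos_acos, sin_acos by lra. split; auto.
      rewrite <- (sqrt_Rsqr y Hy). f_equal. unfold Rsqr. lra.
    - exists (- acos x)%R. rewrite cos_neg, sin_neg, cos_acos, sin_acos by lra. split; auto.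
      replace y with (- (- y))%R by ring. rewrite <- (sqrt_Rsqr (- y)) by lra. do 2 f_equal.
      unfold Rsqr. lra. }
  destruct T as (t & Hc & Hs).
  exists (ln (Cmod z), t). unfold Cexp. simpl. rewrite exp_ln, Hc, Hs by auto.
  apply C_ext; simpl; unfold x, y; field; lra.
Qed.

(** * Line integrals and Goursat's lemma *)

Definition CRInt (g : R -> C) (a b : R) : C := RInt (V := C_R_CompleteNormedModule) g a b.

Definition rcont (g : R -> C) (t : R) : Prop := ulim (locally t) g (fun _ => g t).

Lemma rcont_continuous (g : R -> C) (t : R) :
  rcont g t -> continuous (T := R_UniformSpace) (U := C_R_CompleteNormedModule) g t.
Proof. intros H. exact (proj2 (C_cvg_ulim (locally t) g (g t)) H). Qed.

Lemma rcont_ex_RInt (g : R -> C) (a b : R) :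
  (forall t, (Rmin a b <= t <= Rmax a b)%R -> rcont g t) ->
  ex_RInt (V := C_R_CompleteNormedModule) g a b.
Proof. intros H. apply ex_RInt_continuous. intros t Ht. apply rcont_continuous. auto. Qed.

Lemma rcont_comp (g : C -> C) (phi : R -> C) (t : R) :
  rcont phi t -> ccont g (phi t) -> rcont (fun s => g (phi s)) t.
Proof.
  intros H K. apply (ulim_comp _ (locally (T := C_UniformSpace) (phi t)) phi g (fun _ => g (phi t))).
  - apply (proj2 (C_cvg_ulim _ _ _)). exact H.
  - exact K.
Qed.

Lemma rcont_mult (g k : R -> C) (t : R) : rcont g t -> rcont k t -> rcont (fun s => g s * k s) t.
Proof. intros. unfold rcont in *. ulim_tac. Qed.

Lemma rcont_const (c : C) (t : R) : rcont (fun _ => c) t.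
Proof. unfold rcont. ulim_tac. Qed.

Lemma CRInt_norm_le (g : R -> C) (a b M : R) : (a <= b)%R ->
  ex_RInt (V := C_R_CompleteNormedModule) g a b ->
  (forall t, (a <= t <= b)%R -> (Cmod (g t) <= M)%R) -> (Cmod (CRInt g a b) <= (b - a) * M)%R.
Proof.
  intros Hab Hex HM. rewrite Cmod_norm.
  apply (norm_RInt_le_const (V := C_R_NormedModule) g a b (CRInt g a b) M Hab).
  - intros t Ht. specialize (HM t Ht). rewrite Cmod_norm in HM. exact HM.
  - apply (RInt_correct (V := C_R_CompleteNormedModule)). exact Hex.
Qed.

Definition seg (a b z : C) : Prop := exists t, (0 <= t <= 1)%R /\ z = a + RtoC t * (b - a).

(** The line integral of [g] over the oriented segment from [a] to [b]. *)
Definition SI (g : C -> C) (a b : C) : C := CRInt (fun t => g (a + RtoC t * (b - a)) * (b - a)) 0 1.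

Lemma rcont_affine (a b : C) (t : R) : rcont (fun s => a + RtoC s * b) t.
Proof. apply (rd_cont _ _ _ (rd_affine a b t)). Qed.

Lemma rcont_line (g : C -> C) (a b : C) (t : R) :
  ccont g (a + RtoC t * b) -> rcont (fun s => g (a + RtoC s * b) * b) t.
Proof.
  intros H. apply rcont_mult; [| apply rcont_const].
  apply (rcont_comp g (fun s => a + RtoC s * b)); [apply rcont_affine | exact H].
Qed.

Lemma SI_ex (g : C -> C) (a b : C) : (forall z, seg a b z -> ccont g z) ->
  ex_RInt (V := C_R_CompleteNormedModule) (fun t => g (a + RtoC t * (b - a)) * (b - a)) 0 1.
Proof.
  intros H. apply rcont_ex_RInt. intros t Ht. rewrite Rmin_left, Rmax_right in Ht by lra.
  apply rcont_line. apply H. exists t. auto.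
Qed.

(** Segments of one line become integrals of one function of a real variable, so that reversal and
    subdivision of segments reduce to Chasles' relation. *)
Lemma SI_line (g : C -> C) (p u : C) (x y : R) :
  (forall t, (Rmin x y <= t <= Rmax x y)%R -> ccont g (p + RtoC t * u)) ->
  SI g (p + RtoC x * u) (p + RtoC y * u) = CRInt (fun t => g (p + RtoC t * u) * u) x y.
Proof.
  intros H. unfold SI.
  transitivity (CRInt (fun t => g (p + RtoC t * u) * u) ((y - x) * 0 + x) ((y - x) * 1 + x)).
  2:{ f_equal; ring. }
  unfold CRInt. rewrite <- RInt_comp_lin.
  - apply (RInt_ext (V := C_R_CompleteNormedModule)). intros t _. rewrite C_scal_R.
    rewrite RtoC_plus, RtoC_mult, RtoC_minus.
    replace (p + x * u + t * (p + y * u - (p + x * u))) with (p + ((y - x) * t + x) * u) by ring.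
    match goal with |- ?a = ?b => change (@eq C a b) end. ring.
  - replace ((y - x) * 0 + x)%R with x by ring. replace ((y - x) * 1 + x)%R with y by ring.
    apply rcont_ex_RInt. intros t Ht. apply rcont_line. auto.
Qed.

Lemma SI_norm_le (g : C -> C) (a b : C) (M : R) :
  (forall z, seg a b z -> ccont g z) -> (forall z, seg a b z -> (Cmod (g z) <= M)%R) ->
  (Cmod (SI g a b) <= M * Cmod (b - a))%R.
Proof.
  intros H HM.
  replace (M * Cmod (b - a))%R with ((1 - 0) * (M * Cmod (b - a)))%R by ring.
  apply CRInt_norm_le; [lra | now apply SI_ex |].
  intros t Ht. rewrite Cmod_mult. apply Rmult_le_compat_r; [apply Cmod_ge_0 |].
  apply HM. exists t. auto.
Qed.

Lemma SI_minus (g k : C -> C) (a b : C) :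
  (forall z, seg a b z -> ccont g z) -> (forall z, seg a b z -> ccont k z) ->
  SI (fun z => g z - k z) a b = SI g a b - SI k a b.
Proof.
  intros H K. unfold SI. 
  etransitivity.
  2:{ apply (RInt_minus (V := C_R_CompleteNormedModule)); now apply SI_ex. }
  apply (RInt_ext (V := C_R_CompleteNormedModule)). intros t _. 
  match goal with |- _ = minus ?x ?y => change (@eq C ((g (a + RtoC t * (b - a)) - k (a + RtoC t * (b - a))) * (b - a)) (Cminus x y)) end. ring.
Qed.

Lemma SI_primitive (g k : C -> C) (a b : C) :
  (forall z, seg a b z -> ccont k z) -> (forall z, seg a b z -> cd g z (k z)) ->
  SI k a b = g b - g a.
Proof.
  intros H K. unfold SI.
  replace (g b) with (g (a + RtoC 1 * (b - a))) by (f_equal; ring).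
  replace (g a) with (g (a + RtoC 0 * (b - a))) by (f_equal; ring).
  set (gam := fun t => g (a + RtoC t * (b - a))).
  set (dgam := fun t => k (a + RtoC t * (b - a)) * (b - a)).
  change (CRInt dgam 0 1 = gam 1%R - gam 0%R).
  apply (is_RInt_unique (V := C_R_CompleteNormedModule)).
  assert (Hd : forall t, (Rmin 0 1 <= t <= Rmax 0 1)%R -> rd gam t (dgam t)).
  { intros t Ht. rewrite Rmin_left, Rmax_right in Ht by lra.
    apply (rd_comp g (fun t => a + RtoC t * (b - a)) t); [| apply rd_affine].
    apply K. exists t. auto. }
  assert (Hc : forall t, (Rmin 0 1 <= t <= Rmax 0 1)%R ->
    continuous (T := R_UniformSpace) (U := C_R_CompleteNormedModule) dgam t).
  { intros t Ht. rewrite Rmin_left, Rmax_right in Ht by lra.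
    apply rcont_continuous. apply rcont_line. apply H. exists t. auto. }
  exact (is_RInt_derive (V := C_R_CompleteNormedModule) gam dgam 0 1 Hd Hc).
Qed.

Lemma SI_swap (g : C -> C) (a b : C) : (forall z, seg a b z -> ccont g z) -> SI g b a = - SI g a b.
Proof.
  intros H.
  assert (H' : forall t, (0 <= t <= 1)%R -> ccont g (a + RtoC t * (b - a))).
  { intros t Ht. apply H. exists t. auto. }
  assert (E1 := SI_line g a (b - a) 0 1). assert (E2 := SI_line g a (b - a) 1 0).
  rewrite Rmin_left, Rmax_right in E1 by lra. rewrite Rmin_right, Rmax_left in E2 by lra.
  specialize (E1 H'). specialize (E2 H').
  replace (a + 1 * (b - a)) with b in * by ring. replace (a + 0 * (b - a)) with a in * by ring.
  rewrite E1, E2. symmetry. apply (opp_RInt_swap (V := C_R_CompleteNormedModule)).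
  apply rcont_ex_RInt. intros t Ht. rewrite Rmin_left, Rmax_right in Ht by lra.
  apply rcont_line. auto.
Qed.

Lemma SI_split (g : C -> C) (a b : C) (s : R) : (0 <= s <= 1)%R ->
  (forall z, seg a b z -> ccont g z) ->
  SI g a b = SI g a (a + RtoC s * (b - a)) + SI g (a + RtoC s * (b - a)) b.
Proof.
  intros Hs H.
  assert (H' : forall t, (0 <= t <= 1)%R -> ccont g (a + RtoC t * (b - a))).
  { intros t Ht. apply H. exists t. auto. }
  assert (E1 := SI_line g a (b - a) 0 1). assert (E2 := SI_line g a (b - a) 0 s).
  assert (E3 := SI_line g a (b - a) s 1).
  rewrite Rmin_left, Rmax_right in E1, E2, E3 by lra.
  specialize (E1 H').
  assert (H2 : forall t, (0 <= t <= s)%R -> ccont g (a + RtoC t * (b - a))) by (intros; apply H'; lra).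
  assert (H3 : forall t, (s <= t <= 1)%R -> ccont g (a + RtoC t * (b - a))) by (intros; apply H'; lra).
  specialize (E2 H2). specialize (E3 H3).
  replace (a + 1 * (b - a)) with b in * by ring. replace (a + 0 * (b - a)) with a in * by ring.
  rewrite E1, E2, E3. symmetry.
  apply (RInt_Chasles (V := C_R_CompleteNormedModule)); apply rcont_ex_RInt; intros t Ht;
    rewrite Rmin_left, Rmax_right in Ht by lra; apply rcont_line; apply H'; lra.
Qed.

Definition tri (g : C -> C) (a b c : C) : C := SI g a b + SI g b c + SI g c a.

(** The closed triangle in affine coordinates. Degenerate triangles are allowed, and inclusions
    between triangles become inequalities and polynomial identities. *)
Definition hull (a b c z : C) : Prop :=
  exists x y, (0 <= x)%R /\ (0 <= y)%R /\ (x + y <= 1)%R /\ z = a + RtoC x * (b - a) + RtoC y * (c - a).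

Lemma seg_hull_1 (a b c z : C) : seg a b z -> hull a b c z.
Proof. intros (t & Ht & ->). exists t, 0%R. repeat split; try lra. ring. Qed.

Lemma seg_hull_2 (a b c z : C) : seg b c z -> hull a b c z.
Proof.
  intros (t & Ht & ->). exists (1 - t)%R, t. repeat split; try lra. rewrite RtoC_minus. ring.
Qed.

Lemma seg_hull_3 (a b c z : C) : seg c a z -> hull a b c z.
Proof.
  intros (t & Ht & ->). exists 0%R, (1 - t)%R. repeat split; try lra. rewrite RtoC_minus. ring.
Qed.

Lemma hull_rot (a b c z : C) : hull b c a z -> hull a b c z.
Proof.
  intros (x & y & Hx & Hy & Hxy & ->). exists (1 - x - y)%R, x. repeat split; try lra.
  rewrite !RtoC_minus. ring.
Qed.

Lemma tri_rot (g : C -> C) (a b c : C) : tri g b c a = tri g a b c.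
Proof. unfold tri. ring. Qed.

Lemma tri_primitive (g k : C -> C) (a b c : C) :
  (forall z, hull a b c z -> ccont k z) -> (forall z, hull a b c z -> cd g z (k z)) -> tri k a b c = 0.
Proof.
  intros H K. unfold tri.
  rewrite !(SI_primitive g k); [ring | ..]; intros z Hz; (apply H || apply K);
    auto using seg_hull_1, seg_hull_2, seg_hull_3.
Qed.

Lemma hull_sub (a b c p q r : C) :
  hull a b c p -> hull a b c q -> hull a b c r -> forall z, hull p q r z -> hull a b c z.
Proof.
  intros (x1 & y1 & ? & ? & ? & ->) (x2 & y2 & ? & ? & ? & ->) (x3 & y3 & ? & ? & ? & ->)
    z (x & y & ? & ? & ? & ->).
  exists ((1 - x - y) * x1 + x * x2 + y * x3)%R, ((1 - x - y) * y1 + x * y2 + y * y3)%R.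
  repeat split.
  - repeat apply Rplus_le_le_0_compat; apply Rmult_le_pos; lra.
  - repeat apply Rplus_le_le_0_compat; apply Rmult_le_pos; lra.
  - assert ((1 - x - y) * (x1 + y1) <= (1 - x - y) * 1)%R by (apply Rmult_le_compat_l; lra).
    assert (x * (x2 + y2) <= x * 1)%R by (apply Rmult_le_compat_l; lra).
    assert (y * (x3 + y3) <= y * 1)%R by (apply Rmult_le_compat_l; lra). lra.
  - rewrite !RtoC_plus, !RtoC_mult, !RtoC_minus. ring.
Qed.

Lemma hull_1 (a b c : C) : hull a b c a.
Proof. apply seg_hull_1. exists 0%R. split; [lra | ring]. Qed.
Lemma hull_2 (a b c : C) : hull a b c b.
Proof. apply hull_rot, hull_1. Qed.
Lemma hull_3 (a b c : C) : hull a b c c.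
Proof. apply hull_rot, hull_2. Qed.

Lemma hull_seg (a b c p q z : C) : hull a b c p -> hull a b c q -> seg p q z -> hull a b c z.
Proof. intros Hp Hq Hz. apply (hull_sub a b c p q p); auto. now apply seg_hull_1. Qed.

(** Completeness of [C] with an explicit rate. It serves twice: for the nested triangles in
    [goursat] and for the Newton iteration in [local_surj]. *)
Lemma geometric_cvg (u : nat -> C) (M : R) :
  (forall n, (Cmod (u (S n) - u n) <= M * (1 / 2) ^ n)%R) ->
  exists l, forall n, (Cmod (u n - l) <= 2 * M * (1 / 2) ^ n)%R.
Proof.
  intros H.
  assert (HM : (0 <= M)%R).
  { specialize (H 0%nat). simpl in H. pose proof (Cmod_ge_0 (u 1%nat - u 0%nat)). lra. }
  assert (K : forall n m, (Cmod (u (n + m)%nat - u n) <= 2 * M * ((1 / 2) ^ n - (1 / 2) ^ (n + m)))%R).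
  { intros n. induction m as [| m IH].
    - rewrite Nat.add_0_r. replace (u n - u n) with (RtoC 0) by ring. rewrite Cmod_0. lra.
    - rewrite Nat.add_succ_r.
      replace (u (S (n + m)) - u n) with ((u (S (n + m)) - u (n + m)%nat) + (u (n + m)%nat - u n)) by ring.
      eapply Rle_trans; [apply Cmod_triangle |]. specialize (H (n + m)%nat). simpl. lra. }
  assert (K2 : forall n m, (n <= m)%nat -> (Cmod (u m - u n) <= 2 * M * (1 / 2) ^ n)%R).
  { intros n m Hnm. replace m with (n + (m - n))%nat by lia. eapply Rle_trans; [apply K |].
    apply Rmult_le_compat_l; [lra |]. assert (0 <= (1 / 2) ^ (n + (m - n)))%R by (apply pow_le; lra). lra. }
  assert (L : forall eps, (0 < eps)%R -> exists N, (2 * M * (1 / 2) ^ N < eps)%R).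
  { intros eps He.
    assert (He2 : (0 < eps / (2 * M + 1))%R) by (apply Rdiv_lt_0_compat; lra).
    destruct (pow_lt_1_zero (1 / 2) ltac:(rewrite Rabs_pos_eq; lra) _ He2) as [N HN].
    exists N. specialize (HN N (Nat.le_refl N)). rewrite Rabs_pos_eq in HN by (apply pow_le; lra).
    assert (0 <= (1 / 2) ^ N)%R by (apply pow_le; lra).
    apply Rle_lt_trans with ((2 * M + 1) * (1 / 2) ^ N)%R; [apply Rmult_le_compat_r; lra |].
    replace eps with ((2 * M + 1) * (eps / (2 * M + 1)))%R by (field; lra).
    apply Rmult_lt_compat_l; lra. }
  destruct (proj1 (filterlim_locally_cauchy (U := C_R_CompleteNormedModule) (F := eventually) u)) as [l Hl].
  - intros eps. destruct (L (eps / 2)%R) as [N HN]; [pose proof (cond_pos eps); lra |].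
    exists (fun n => (N <= n)%nat). split; [now exists N |].
    intros n m Hn Hm. apply C_NormedModule_mixin_compat1.
    change (Cmod (u m - u n) < eps)%R.
    replace (u m - u n) with ((u m - u N) - (u n - u N)) by ring.
    eapply Rle_lt_trans; [apply Cmod_triangle_minus |].
    pose proof (K2 N n Hn). pose proof (K2 N m Hm). lra.
  - exists l. intros n. apply Rnot_lt_le. intros Hn.
    set (e := (Cmod (u n - l) - 2 * M * (1 / 2) ^ n)%R) in *.
    assert (He : (0 < e)%R) by (unfold e; lra).
    assert (Hl' : ulim eventually u (fun _ => l)).
    { apply (proj1 (C_cvg_ulim eventually u l)). exact Hl. }
    destruct (Hl' e He) as [N HN].
    specialize (HN (Nat.max N n) (Nat.le_max_l _ _)).
    pose proof (K2 n (Nat.max N n) (Nat.le_max_r _ _)) as K3.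
    pose proof (Cmod_triangle_minus (u (Nat.max N n) - l) (u (Nat.max N n) - u n)) as K4.
    replace (u (Nat.max N n) - l - (u (Nat.max N n) - u n)) with (u n - l) in K4 by ring.
    unfold e in HN. lra.
Qed.

(** Each inner edge is traversed twice, in opposite directions, and each outer edge splits at its
    midpoint. *)
Lemma tri_midpoints (g : C -> C) (a b c : C) : (forall z, hull a b c z -> ccont g z) ->
  tri g a b c =
    tri g a (a + RtoC (1 / 2) * (b - a)) (a + RtoC (1 / 2) * (c - a))
    + tri g (a + RtoC (1 / 2) * (b - a)) b (b + RtoC (1 / 2) * (c - b))
    + tri g (a + RtoC (1 / 2) * (c - a)) (b + RtoC (1 / 2) * (c - b)) c
    + tri g (b + RtoC (1 / 2) * (c - b)) (a + RtoC (1 / 2) * (c - a)) (a + RtoC (1 / 2) * (b - a)).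
Proof.
  intros H.
  assert (H12 : (0 <= 1 / 2 <= 1)%R) by lra.
  set (mab := a + RtoC (1 / 2) * (b - a)). set (mac := a + RtoC (1 / 2) * (c - a)).
  set (mbc := b + RtoC (1 / 2) * (c - b)).
  assert (Hab : hull a b c mab) by (apply seg_hull_1; exists (1 / 2)%R; auto).
  assert (Hbc : hull a b c mbc) by (apply seg_hull_2; exists (1 / 2)%R; auto).
  assert (Hac : hull a b c mac).
  { apply seg_hull_3. exists (1 / 2)%R. split; auto. unfold mac.
    transitivity (c + (1 - RtoC (1 / 2)) * (a - c)); [ring |].
    rewrite <- RtoC_minus. replace (1 - 1 / 2)%R with (1 / 2)%R by lra. reflexivity. }
  pose proof (hull_1 a b c) as Ha. pose proof (hull_2 a b c) as Hb. pose proof (hull_3 a b c) as Hc.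
  assert (K : forall p q, hull a b c p -> hull a b c q -> forall z, seg p q z -> ccont g z).
  { intros p q Hp Hq z Hz. apply H. now apply (hull_seg a b c p q). }
  unfold tri.
  rewrite (SI_split g a b (1 / 2) H12 (K _ _ Ha Hb)). fold mab.
  rewrite (SI_split g b c (1 / 2) H12 (K _ _ Hb Hc)). fold mbc.
  rewrite (SI_swap g a c (K _ _ Ha Hc)).
  rewrite (SI_split g a c (1 / 2) H12 (K _ _ Ha Hc)). fold mac.
  rewrite (SI_swap g a mac (K _ _ Ha Hac)).
  rewrite (SI_swap g mac c (K _ _ Hac Hc)).
  rewrite (SI_swap g mac mbc (K _ _ Hac Hbc)).
  rewrite (SI_swap g mab mac (K _ _ Hab Hac)).
  rewrite (SI_swap g mab mbc (K _ _ Hab Hbc)).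
  ring.
Qed.

(* In the coordinates of [T] on the affine plane spanned by [a, b, c] every triangle
   of the subdivision is homothetic to the initial one, of ratio [s], with [|s| = 2 ^ - n]. *)
Section Goursat.

Variables (g : C -> C) (a b c : C).
Hypothesis g_diff : forall z, hull a b c z -> exists d, cd g z d.

Let pt (x y : R) : C := a + RtoC x * (b - a) + RtoC y * (c - a).
Let I (T : C * R) : C :=
  let '(z, s) := T in tri g (pt (Re z) (Im z)) (pt (Re z + s) (Im z)) (pt (Re z) (Im z + s)).

Let T1 (T : C * R) : C * R := let '(z, s) := T in (z, s / 2)%R.
Let T2 (T : C * R) : C * R := let '(z, s) := T in ((Re z + s / 2, Im z), s / 2)%R.
Let T3 (T : C * R) : C * R := let '(z, s) := T in ((Re z, Im z + s / 2), s / 2)%R.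
(** The middle triangle is inverted, hence the negative ratio. *)
Let T4 (T : C * R) : C * R := let '(z, s) := T in ((Re z + s / 2, Im z + s / 2), - (s / 2))%R.

(** The three vertices [(x, y)], [(x + s, y)] and [(x, y + s)] lie in the standard simplex, whatever
    the sign of [s]. *)
Let inv (T : C * R) : Prop :=
  let '(z, s) := T in
  (0 <= Re z)%R /\ (0 <= Im z)%R /\ (Re z + Im z <= 1)%R /\
  (0 <= Re z + s)%R /\ (0 <= Im z + s)%R /\ (Re z + Im z + s <= 1)%R.

Let g_cont (z : C) : hull a b c z -> ccont g z.
Proof. intros H. destruct (g_diff z H) as [d Hd]. exact (cd_cont _ _ _ Hd). Qed.

Let hull_pt (x y : R) : (0 <= x)%R -> (0 <= y)%R -> (x + y <= 1)%R -> hull a b c (pt x y).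
Proof. intros. exists x, y. auto. Qed.

Let sub_hull (z : C) (s : R) : inv (z, s) -> forall w,
  hull (pt (Re z) (Im z)) (pt (Re z + s) (Im z)) (pt (Re z) (Im z + s)) w -> hull a b c w.
Proof.
  intros (H1 & H2 & H3 & H4 & H5 & H6). apply hull_sub; apply hull_pt; lra.
Qed.

Let I_split (T : C * R) : inv T -> I T = I (T1 T) + I (T2 T) + I (T3 T) + I (T4 T).
Proof.
  destruct T as [[x y] s]. intros H. unfold I, T1, T2, T3, T4. cbn [Re Im fst snd].
  rewrite tri_midpoints by (intros w Hw; apply g_cont; now apply (sub_hull (x, y) s H)).
  assert (E : forall x1 y1 x2 y2, pt x1 y1 + RtoC (1 / 2) * (pt x2 y2 - pt x1 y1)
                = pt ((x1 + x2) / 2) ((y1 + y2) / 2)).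
  { intros. unfold pt. rewrite !RtoC_div, !RtoC_plus by lra. field. }
  rewrite !E.
  replace ((x + (x + s)) / 2)%R with (x + s / 2)%R by field.
  replace ((y + y) / 2)%R with y by field. replace ((x + x) / 2)%R with x by field.
  replace ((y + (y + s)) / 2)%R with (y + s / 2)%R by field.
  replace ((x + s + x) / 2)%R with (x + s / 2)%R by field.
  replace (x + s / 2 + s / 2)%R with (x + s)%R by field.
  replace (y + s / 2 + s / 2)%R with (y + s)%R by field.
  replace (x + s / 2 + - (s / 2))%R with x by field.
  replace (y + s / 2 + - (s / 2))%R with y by field.
  reflexivity.
Qed.

Let step (eps : R) (T : C * R) : C * R :=
  let s := snd T in
  if Rlt_dec (eps * (s / 2 * (s / 2))) (Cmod (I (T1 T))) then T1 T else
  if Rlt_dec (eps * (s / 2 * (s / 2))) (Cmod (I (T2 T))) then T2 T else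
  if Rlt_dec (eps * (s / 2 * (s / 2))) (Cmod (I (T3 T))) then T3 T else T4 T.

Let bad (eps : R) (T : C * R) : Prop := (eps * (snd T * snd T) < Cmod (I T))%R.

Let step_spec (eps : R) (T : C * R) : inv T -> bad eps T ->
  inv (step eps T) /\ bad eps (step eps T) /\
  Rabs (snd (step eps T)) = (Rabs (snd T) / 2)%R /\
  (Cmod (fst (step eps T) - fst T) <= Rabs (snd T))%R.
Proof.
  intros HT Hb. pose proof (I_split T HT) as E.
  assert (J : forall T', T' = T1 T \/ T' = T2 T \/ T' = T3 T \/ T' = T4 T ->
    inv T' /\ (snd T' * snd T' = snd T / 2 * (snd T / 2))%R /\ Rabs (snd T') = (Rabs (snd T) / 2)%R /\
    (Cmod (fst T' - fst T) <= Rabs (snd T))%R).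
  { assert (A : Rabs (snd T / 2) = (Rabs (snd T) / 2)%R).
    { unfold Rdiv. rewrite Rabs_mult, (Rabs_pos_eq (/ 2)) by lra. reflexivity. }
    intros T' HT'. destruct T as [[x y] s]. cbn [snd fst] in *.
    assert (B : forall u v, (Rabs u <= Rabs s / 2)%R -> (Rabs v <= Rabs s / 2)%R ->
      (Cmod ((x + u, y + v)%R - (x, y)) <= Rabs s)%R).
    { intros u v Hu Hv. eapply Rle_trans; [apply Cmod_le_Rabs |]. simpl.
      replace (x + u + - x)%R with u by ring. replace (y + v + - y)%R with v by ring. lra. }
    assert (A0 : (Rabs 0 <= Rabs s / 2)%R) by (rewrite Rabs_R0; pose proof (Rabs_pos s); lra).
    assert (A1 : (Rabs (s / 2) <= Rabs s / 2)%R) by lra.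
    unfold inv, T1, T2, T3, T4 in *. cbn [Re Im fst snd] in *.
    destruct HT' as [-> | [-> | [-> | ->]]]; cbn [Re Im fst snd]; repeat split; try lra; try nra.
    - specialize (B 0 0 A0 A0)%R. now rewrite !Rplus_0_r in B.
    - specialize (B (s / 2) 0 A1 A0)%R. now rewrite !Rplus_0_r in B.
    - specialize (B 0 (s / 2) A0 A1)%R. now rewrite !Rplus_0_r in B.
    - rewrite Rabs_Ropp. exact A.
    - exact (B _ _ A1 A1). }
  assert (K : bad eps (step eps T) /\ (step eps T = T1 T \/ step eps T = T2 T \/ step eps T = T3 T \/ step eps T = T4 T)).
  { unfold bad, step in *.
    destruct (Rlt_dec _ (Cmod (I (T1 T)))) as [L1 | L1].
    { split; auto. destruct (J (T1 T)) as (_ & -> & _); auto. }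
    destruct (Rlt_dec _ (Cmod (I (T2 T)))) as [L2 | L2].
    { split; auto. destruct (J (T2 T)) as (_ & -> & _); auto. }
    destruct (Rlt_dec _ (Cmod (I (T3 T)))) as [L3 | L3].
    { split; auto. destruct (J (T3 T)) as (_ & -> & _); auto. }
    (* The four thresholds [eps * (s / 2) ^ 2] add up to [eps * s ^ 2]: if the first three pieces
       are not bad, the fourth one is. *)
    split; [| auto 6]. destruct (J (T4 T)) as (_ & -> & _); [auto 6 |].
    pose proof (Cmod_triangle (I (T1 T) + I (T2 T) + I (T3 T)) (I (T4 T))) as A1.
    pose proof (Cmod_triangle (I (T1 T) + I (T2 T)) (I (T3 T))) as A2.
    pose proof (Cmod_triangle (I (T1 T)) (I (T2 T))) as A3.
    rewrite <- E in A1. nra. }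
  destruct K as [K1 K2]. destruct (J _ K2) as (J1 & J2 & J3 & J4). auto.
Qed.

Lemma goursat : tri g a b c = 0.
Proof.
  apply Cmod_eq_0. apply Rle_antisym; [| apply Cmod_ge_0]. apply Rnot_lt_le. intros Hpos.
  set (eps := (Cmod (tri g a b c) / 2)%R).
  set (S0 := ((0, 0)%R, 1%R) : C * R).
  set (U := fun n => Nat.iter n (step eps) S0).
  assert (H0 : inv S0). { unfold inv, S0. simpl. repeat split; lra. }
  assert (B0 : bad eps S0).
  { unfold bad, S0, I, eps. cbn [fst snd Re Im].
    replace (pt 0 0) with a by (unfold pt; ring).
    replace (pt (0 + 1) 0) with b by (unfold pt; rewrite Rplus_0_l; ring).
    replace (pt 0 (0 + 1)) with c by (unfold pt; rewrite Rplus_0_l; ring). lra. }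
  assert (HU : forall n, inv (U n) /\ bad eps (U n) /\ Rabs (snd (U n)) = ((1 / 2) ^ n)%R).
  { induction n as [| n (IH1 & IH2 & IH3)].
    - split; [exact H0 |]. split; [exact B0 |]. unfold U, S0. simpl. apply Rabs_pos_eq. lra.
    - destruct (step_spec eps (U n) IH1 IH2) as (A & B & D & _).
      change (U (S n)) with (step eps (U n)). split; [exact A |]. split; [exact B |]. rewrite D, IH3. simpl. field. }
  destruct (geometric_cvg (fun n => fst (U n)) 1) as [l Hl].
  { intros n. destruct (HU n) as (A & B & D). destruct (step_spec eps (U n) A B) as (_ & _ & _ & K).
    change (U (S n)) with (step eps (U n)). lra. }
  assert (Hsmall : forall e, (0 < e)%R -> exists N, forall n, (N <= n)%nat -> ((1 / 2) ^ n < e)%R).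
  { intros e He. destruct (pow_lt_1_zero (1 / 2) ltac:(rewrite Rabs_pos_eq; lra) e He) as [N HN].
    exists N. intros n Hn. specialize (HN n Hn). now rewrite Rabs_pos_eq in HN by (apply pow_le; lra). }
  (* Closed conditions on the base points pass to the limit [l]. The constant 2 is a Lipschitz
     constant for [Re + Im]. *)
  assert (Hcl : forall (k : C -> R), (forall u v, k u <= k v + 2 * Cmod (u - v))%R ->
            (forall n, (k (fst (U n)) <= 0)%R) -> (k l <= 0)%R).
  { intros k Hk Hn. apply Rnot_lt_le. intros Hp. destruct (Hsmall (k l / 8)%R) as [N HN]; [lra |].
    specialize (HN N (Nat.le_refl N)). specialize (Hl N). specialize (Hn N).
    specialize (Hk l (fst (U N))). rewrite Cmod_minus_sym in Hk. lra. }
  assert (Hre : forall u v, (Rabs (Re u - Re v) <= Cmod (u - v))%R).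
  { intros u v. pose proof (re_le_Cmod (u - v)) as K. unfold Cminus in K at 1.
    now rewrite re_plus, re_opp in K. }
  assert (Him : forall u v, (Rabs (Im u - Im v) <= Cmod (u - v))%R).
  { intros u v. pose proof (im_le_Cmod (u - v)) as K. unfold Cminus in K at 1.
    now rewrite im_plus, im_opp in K. }
  assert (Hl1 : (0 <= Re l)%R).
  { cut (- Re l <= 0)%R; [lra |]. apply (Hcl (fun z => - Re z)%R).
    - intros u v. pose proof (Hre u v). pose proof (Rle_abs (- (Re u - Re v))).
      rewrite Rabs_Ropp in H1. pose proof (Cmod_ge_0 (u - v)). lra.
    - intros n. destruct (HU n) as (A & _). unfold inv in A. destruct (U n). simpl. lra. }
  assert (Hl2 : (0 <= Im l)%R).
  { cut (- Im l <= 0)%R; [lra |]. apply (Hcl (fun z => - Im z)%R).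
    - intros u v. pose proof (Him u v). pose proof (Rle_abs (- (Im u - Im v))).
      rewrite Rabs_Ropp in H1. pose proof (Cmod_ge_0 (u - v)). lra.
    - intros n. destruct (HU n) as (A & _). unfold inv in A. destruct (U n). simpl. lra. }
  assert (Hl3 : (Re l + Im l <= 1)%R).
  { cut (Re l + Im l - 1 <= 0)%R; [lra |]. apply (Hcl (fun z => Re z + Im z - 1)%R).
    - intros u v. pose proof (Hre u v). pose proof (Him u v).
      pose proof (Rle_abs (Re u - Re v)). pose proof (Rle_abs (Im u - Im v)). lra.
    - intros n. destruct (HU n) as (A & _). unfold inv in A. destruct (U n). simpl. lra. }
  set (z0 := pt (Re l) (Im l)).
  destruct (g_diff z0 (hull_pt _ _ Hl1 Hl2 Hl3)) as [d Hd].
  set (L := (Cmod (b - a) + Cmod (c - a) + 1)%R).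
  assert (HL : (1 <= L)%R).
  { unfold L. pose proof (Cmod_ge_0 (b - a)). pose proof (Cmod_ge_0 (c - a)). lra. }
  (* The perimeter of the small triangle and its distance to [z0] are both at most [4 * L * |s|], so
     an error [eta * |w - z0|] integrates to at most [16 * L * L * eta * s ^ 2 = eps * s ^ 2]. *)
  assert (Heta : (0 < eps / (16 * L * L))%R).
  { apply Rdiv_lt_0_compat; [unfold eps; lra | nra]. }
  set (eta := (eps / (16 * L * L))%R) in *.
  destruct (cd_eps_inv _ _ _ Hd eta Heta) as (r & Hr & Hlin).
  destruct (Hsmall (r / (4 * L))%R) as [N HN]; [apply Rdiv_lt_0_compat; lra |].
  specialize (HN N (Nat.le_refl N)). specialize (Hl N). cbv beta in Hl.
  destruct (HU N) as (A & B & D). destruct (U N) as [z s] eqn:EU. cbn [fst snd] in *.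
  assert (HNr : (4 * L * Rabs s < r)%R).
  { rewrite D. apply (Rmult_lt_compat_l (4 * L)) in HN; [| lra].
    replace (4 * L * (r / (4 * L)))%R with r in HN by (field; lra). exact HN. }
  (* The affine part of [g] at [z0] has the primitive [prim], so it contributes nothing to the
     integral and only the linearization error remains. *)
  set (aff := fun w : C => g z0 + (w - z0) * d).
  set (prim := fun w : C => g z0 * w + ((w - z0) * (w - z0) / 2) * d).
  assert (Haffc : forall w, ccont aff w).
  { intros w. apply (cd_cont aff w (0 + ((1 - 0) * d + (w - z0) * 0))).
    apply cd_plus; [apply cd_const |]. apply (cd_mult (fun w => w - z0) (fun _ => d)); [| apply cd_const].
    apply cd_minus; [apply cd_id | apply cd_const]. }
  assert (Hprim : forall w, cd prim w (aff w)).
  { intros w. assert (K : cd (fun w => w - z0) w 1).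
    { eapply cd_eq; [apply cd_minus; [apply cd_id | apply cd_const] | ring]. }
    eapply cd_eq.
    - apply cd_plus.
      + apply cd_mult; [apply cd_const | apply cd_id].
      + apply cd_mult; [| apply cd_const]. apply cd_mult; [| apply cd_const].
        apply cd_mult; exact K.
    - unfold aff. cbv beta. field. }
  set (p1 := pt (Re z) (Im z)) in *. set (p2 := pt (Re z + s) (Im z)) in *.
  set (p3 := pt (Re z) (Im z + s)) in *.
  assert (Hsub := sub_hull z s A). fold p1 p2 p3 in Hsub.
  assert (Hseg : forall k, (forall w, hull p1 p2 p3 w -> ccont k w) ->
    forall M, (forall w, hull p1 p2 p3 w -> (Cmod (k w) <= M)%R) -> (Cmod (tri k p1 p2 p3) <= M * (4 * L * Rabs s))%R).
  { intros k Hk M HM. unfold tri.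
    assert (HM0 : (0 <= M)%R) by (eapply Rle_trans; [apply Cmod_ge_0 | apply (HM p1), hull_1]).
    assert (E1 : (Cmod (p2 - p1) <= L * Rabs s)%R).
    { unfold p1, p2, pt. replace (a + (Re z + s)%R * (b - a) + Im z * (c - a) - (a + Re z * (b - a) + Im z * (c - a)))
        with (RtoC s * (b - a)) by (rewrite RtoC_plus; ring).
      rewrite Cmod_mult, Cmod_R, Rmult_comm. apply Rmult_le_compat_r; [apply Rabs_pos |].
      unfold L. pose proof (Cmod_ge_0 (c - a)). lra. }
    assert (E3 : (Cmod (p1 - p3) <= L * Rabs s)%R).
    { unfold p1, p3, pt. replace (a + Re z * (b - a) + Im z * (c - a) - (a + Re z * (b - a) + (Im z + s)%R * (c - a)))
        with (RtoC (- s) * (c - a)) by (rewrite RtoC_plus, RtoC_opp; ring).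
      rewrite Cmod_mult, Cmod_R, Rabs_Ropp, Rmult_comm. apply Rmult_le_compat_r; [apply Rabs_pos |].
      unfold L. pose proof (Cmod_ge_0 (b - a)). lra. }
    assert (E2 : (Cmod (p3 - p2) <= 2 * (L * Rabs s))%R).
    { replace (p3 - p2) with (- (p2 - p1) - (p1 - p3)) by ring.
      eapply Rle_trans; [apply Cmod_triangle_minus |]. rewrite Cmod_opp. lra. }
    pose proof (SI_norm_le k p1 p2 M (fun w Hw => Hk w (seg_hull_1 _ _ _ _ Hw)) (fun w Hw => HM w (seg_hull_1 _ _ _ _ Hw))).
    pose proof (SI_norm_le k p2 p3 M (fun w Hw => Hk w (seg_hull_2 _ _ _ _ Hw)) (fun w Hw => HM w (seg_hull_2 _ _ _ _ Hw))).
    pose proof (SI_norm_le k p3 p1 M (fun w Hw => Hk w (seg_hull_3 _ _ _ _ Hw)) (fun w Hw => HM w (seg_hull_3 _ _ _ _ Hw))).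
    pose proof (Cmod_triangle (SI k p1 p2 + SI k p2 p3) (SI k p3 p1)).
    pose proof (Cmod_triangle (SI k p1 p2) (SI k p2 p3)).
    assert (M * Cmod (p2 - p1) <= M * (L * Rabs s))%R by (apply Rmult_le_compat_l; auto).
    assert (M * Cmod (p1 - p3) <= M * (L * Rabs s))%R by (apply Rmult_le_compat_l; auto).
    assert (M * Cmod (p3 - p2) <= M * (2 * (L * Rabs s)))%R by (apply Rmult_le_compat_l; auto).
    lra. }
  assert (Hdist : forall w, hull p1 p2 p3 w -> (Cmod (w - z0) <= 3 * L * Rabs s)%R).
  { intros w (x & y & Hx & Hy & Hxy & ->).
    unfold p1, p2, p3, z0, pt.
    match goal with |- (Cmod ?e <= _)%R => replace e with
      (RtoC (Re z - Re l + x * s) * (b - a) + RtoC (Im z - Im l + y * s) * (c - a)) end.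
    2:{ rewrite !RtoC_plus, !RtoC_mult, !RtoC_minus. ring. }
    eapply Rle_trans; [apply Cmod_triangle |]. rewrite !Cmod_mult, !Cmod_R.
    pose proof (Hre z l) as R1. pose proof (Him z l) as R2. rewrite <- D in Hl.
    assert (R3 : (Rabs (Re z - Re l + x * s) <= 3 * Rabs s)%R).
    { eapply Rle_trans; [apply Rabs_triang |]. rewrite Rabs_mult, (Rabs_pos_eq x) by lra.
      pose proof (Rabs_pos s). nra. }
    assert (R4 : (Rabs (Im z - Im l + y * s) <= 3 * Rabs s)%R).
    { eapply Rle_trans; [apply Rabs_triang |]. rewrite Rabs_mult, (Rabs_pos_eq y) by lra.
      pose proof (Rabs_pos s). nra. }
    pose proof (Cmod_ge_0 (b - a)). pose proof (Cmod_ge_0 (c - a)). pose proof (Rabs_pos s).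
    assert (Rabs (Re z - Re l + x * s) * Cmod (b - a) <= 3 * Rabs s * Cmod (b - a))%R by (apply Rmult_le_compat_r; auto).
    assert (Rabs (Im z - Im l + y * s) * Cmod (c - a) <= 3 * Rabs s * Cmod (c - a))%R by (apply Rmult_le_compat_r; auto).
    unfold L. nra. }
  assert (Hs : (0 < Rabs s)%R). { rewrite D. apply pow_lt. lra. }
  assert (E : tri g p1 p2 p3 = tri (fun w => g w - aff w) p1 p2 p3).
  { unfold tri. rewrite !(SI_minus g aff); auto;
      try (intros w Hw; apply g_cont, Hsub; auto using seg_hull_1, seg_hull_2, seg_hull_3).
    transitivity (tri g p1 p2 p3 - tri aff p1 p2 p3); [| unfold tri; ring].
    rewrite (tri_primitive prim aff) by auto. unfold tri. ring. }
  unfold bad, I in B. cbn [snd] in B. fold p1 p2 p3 in B. rewrite E in B.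
  assert (Q := Hseg (fun w => g w - aff w)).
  specialize (Q ltac:(intros w Hw; pose proof (g_cont w (Hsub w Hw)) as G1; pose proof (Haffc w) as G2;
                     unfold ccont in *; ulim_tac)).
  specialize (Q (eta * (4 * L * Rabs s))%R).
  assert (Q2 : (Cmod (tri (fun w => (g w - aff w)%C) p1 p2 p3) <= eta * (4 * L * Rabs s) * (4 * L * Rabs s))%R).
  { apply Q. intros w Hw. unfold aff.
    replace (g w - (g z0 + (w - z0) * d)) with (g w - g z0 - (w - z0) * d) by ring.
    assert (W : (Cmod (w - z0) <= 4 * L * Rabs s)%R).
    { pose proof (Hdist w Hw). nra. }
    eapply Rle_trans; [apply Hlin; lra |]. apply Rmult_le_compat_l; lra. }
  assert (Ess : (s * s = Rabs s * Rabs s)%R) by (apply Rsqr_abs).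
  rewrite Ess in B.
  assert (eta * (4 * L * Rabs s) * (4 * L * Rabs s) = eps * (Rabs s * Rabs s))%R.
  { unfold eta. field. lra. }
  lra.
Qed.

End Goursat.

(** * Goursat's lemma with exceptional points *)

Lemma between_seg (x y t : R) : (Rmin x y <= t <= Rmax x y)%R ->
  exists s, (0 <= s <= 1)%R /\ t = (x + s * (y - x))%R.
Proof.
  intros Ht. destruct (Req_dec x y) as [E | E].
  - subst y. rewrite Rmin_left, Rmax_left in Ht by lra. exists 0%R. lra.
  - exists ((t - x) / (y - x))%R. split; [| field; lra].
    destruct (Rle_lt_dec x y).
    + rewrite Rmin_left, Rmax_right in Ht by lra. split.
      * apply Rdiv_le_0_compat; lra.
      * apply (Rmult_le_reg_r (y - x)); [lra |]. unfold Rdiv. rewrite Rmult_assoc, Rinv_l; lra.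
    + rewrite Rmin_right, Rmax_left in Ht by lra.
      replace ((t - x) / (y - x))%R with ((x - t) / (x - y))%R by (field; lra). split.
      * apply Rdiv_le_0_compat; lra.
      * apply (Rmult_le_reg_r (x - y)); [lra |]. unfold Rdiv. rewrite Rmult_assoc, Rinv_l; lra.
Qed.

(** Continuity alone suffices for a degenerate triangle: its three sides are integrals of one
    real-variable function over a closed chain of intervals. *)
Lemma tri_collinear (g : C -> C) (p u : C) (x y : R) :
  (forall z, hull p (p + RtoC x * u) (p + RtoC y * u) z -> ccont g z) ->
  tri g p (p + RtoC x * u) (p + RtoC y * u) = 0.
Proof.
  intros H.
  assert (K : forall s t, (s = 0 \/ s = x \/ s = y)%R -> (t = 0 \/ t = x \/ t = y)%R ->
    forall v, (Rmin s t <= v <= Rmax s t)%R -> ccont g (p + RtoC v * u)).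
  { intros s t Hs Ht v Hv. destruct (between_seg _ _ _ Hv) as (k & Hk & ->). apply H.
    apply (hull_seg _ _ _ (p + RtoC s * u) (p + RtoC t * u)).
    - destruct Hs as [-> | [-> | ->]]; [rewrite Cmult_0_l, Cplus_0_r; apply hull_1 | apply hull_2 | apply hull_3].
    - destruct Ht as [-> | [-> | ->]]; [rewrite Cmult_0_l, Cplus_0_r; apply hull_1 | apply hull_2 | apply hull_3].
    - exists k. split; auto. rewrite RtoC_plus, RtoC_mult, RtoC_minus. ring. }
  unfold tri.
  assert (E1 := SI_line g p u 0 x (K 0%R x ltac:(auto) ltac:(auto))).
  assert (E2 := SI_line g p u x y (K x y ltac:(auto) ltac:(auto))).
  assert (E3 := SI_line g p u y 0 (K y 0%R ltac:(auto) ltac:(auto))).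
  rewrite !Cmult_0_l, !Cplus_0_r in E1, E3. rewrite E1, E2, E3.
  set (k := fun t : R => g (p + RtoC t * u) * u).
  assert (Q : forall s t, (s = 0 \/ s = x \/ s = y)%R -> (t = 0 \/ t = x \/ t = y)%R ->
    ex_RInt (V := C_R_CompleteNormedModule) k s t).
  { intros s t Hs Ht. apply rcont_ex_RInt. intros v Hv. apply rcont_line. now apply (K s t). }
  assert (A1 := RInt_Chasles (V := C_R_CompleteNormedModule) k 0 x y (Q 0%R x ltac:(auto) ltac:(auto)) (Q x y ltac:(auto) ltac:(auto))).
  assert (A2 := RInt_Chasles (V := C_R_CompleteNormedModule) k 0 y 0 (Q 0%R y ltac:(auto) ltac:(auto)) (Q y 0%R ltac:(auto) ltac:(auto))).
  rewrite <- A1 in A2. rewrite (RInt_point (V := C_R_CompleteNormedModule)) in A2. exact A2.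
Qed.

(** A small corner at [p] is cut off. The rest consists of two triangles that avoid [p], and the
    integral over the corner is at most its perimeter times a local bound of [g]. *)
Lemma tri_vertex (g : C -> C) (a b p : C) :
  (forall z, hull a b p z -> ccont g z) ->
  (forall u v w, (forall z, hull u v w z -> hull a b p z /\ z <> p) -> tri g u v w = 0) ->
  tri g a b p = 0.
Proof.
  intros H K.
  (* When [a - p] and [b - p] are linearly dependent over the reals, the two remaining triangles
     could contain [p]; this case is left to [tri_collinear]. *)
  destruct (classic (exists x y : R, (x <> 0 \/ y <> 0)%R /\ RtoC x * (a - p) + RtoC y * (b - p) = 0))
    as [(x & y & Hxy & E) | Hind].
  - rewrite <- (tri_rot g a b p), <- tri_rot.
    assert (Q : exists u s t, a = p + RtoC s * u /\ b = p + RtoC t * u).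
    { destruct (Req_dec y 0) as [Hy | Hy].
      - destruct Hxy as [Hx | Hx]; [| contradiction]. exists (b - p), 0%R, 1%R. subst y.
        assert (RtoC x <> 0) by (intros Z; apply RtoC_inj in Z; auto).
        split; [| ring]. apply Ceq_minus.
        replace (a - (p + 0 * (b - p))) with ((x * (a - p) + 0 * (b - p)) / x) by (field; auto).
        rewrite E. field. auto.
      - exists (a - p), 1%R, (- (x / y))%R.
        assert (RtoC y <> 0) by (intros Z; apply RtoC_inj in Z; auto).
        split; [ring |]. apply Ceq_minus. rewrite RtoC_opp, RtoC_div by auto.
        replace (b - (p + - (x / y) * (a - p))) with ((x * (a - p) + y * (b - p)) / y) by (field; auto).
        rewrite E. field. auto. }
    destruct Q as (u & s & t & -> & ->). apply tri_collinear.
    intros z Hz. apply H. apply hull_rot, hull_rot. exact Hz.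
  - assert (Hind' : forall x y, RtoC x * (a - p) + RtoC y * (b - p) = 0 -> (x = 0 /\ y = 0)%R).
    { intros x y E. apply NNPP. intros N. apply Hind. exists x, y. split; auto.
      destruct (Req_dec x 0); destruct (Req_dec y 0); tauto. }
    assert (Hp := hull_3 a b p). assert (Ha := hull_1 a b p). assert (Hb := hull_2 a b p).
    apply Cmod_eq_0. apply Rle_antisym; [| apply Cmod_ge_0]. apply Rnot_lt_le. intros Hpos.
    set (e := Cmod (tri g a b p)) in *.
    destruct (proj1 (ccont_iff g p) (H p Hp) 1%R Rlt_0_1) as (r & Hr & Hb1).
    set (L := (Cmod (a - p) + Cmod (b - p) + 1)%R). set (M := (Cmod (g p) + 1)%R).
    assert (HL : (1 <= L)%R) by (unfold L; pose proof (Cmod_ge_0 (a - p)); pose proof (Cmod_ge_0 (b - p)); lra).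
    assert (HM : (1 <= M)%R) by (unfold M; pose proof (Cmod_ge_0 (g p)); lra).
    (* The second entry puts the corner inside the disc where [|g| <= M]; the third makes the
       boundary integral of the corner smaller than [e]. *)
    set (s := Rmin 1 (Rmin (r / (2 * L)) (e / (4 * L * M)))).
    assert (Hs0 : (0 < s)%R).
    { repeat apply Rmin_glb_lt; try lra; apply Rdiv_lt_0_compat; nra. }
    assert (Hs1 : (s <= 1)%R) by apply Rmin_l.
    assert (Hs2 : (s * L < r)%R).
    { assert (s <= r / (2 * L))%R by (eapply Rle_trans; [apply Rmin_r | apply Rmin_l]).
      apply (Rmult_le_compat_r L) in H0; [| lra].
      replace (r / (2 * L) * L)%R with (r / 2)%R in H0 by (field; lra). lra. }
    assert (Hs3 : (4 * (s * L * M) <= e)%R).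
    { assert (s <= e / (4 * L * M))%R by (eapply Rle_trans; [apply Rmin_r | apply Rmin_r]).
      apply (Rmult_le_compat_r (4 * L * M)) in H0; [| nra].
      replace (e / (4 * L * M) * (4 * L * M))%R with e in H0 by (field; lra). lra. }
    set (a' := p + RtoC s * (a - p)). set (b' := p + RtoC s * (b - p)).
    assert (Ha' : hull a b p a').
    { apply (hull_seg a b p p a); auto. exists s. split; [lra | reflexivity]. }
    assert (Hb' : hull a b p b').
    { apply (hull_seg a b p p b); auto. exists s. split; [lra | reflexivity]. }
    assert (HK : forall q1 q2, hull a b p q1 -> hull a b p q2 -> forall z, seg q1 q2 z -> ccont g z).
    { intros q1 q2 H1 H2 z Hz. apply H. now apply (hull_seg a b p q1 q2). }
    assert (E1 : tri g a b b' = 0).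
    { apply K. intros z Hz. split; [now apply (hull_sub a b p a b b') |].
      destruct Hz as (x & y & Hx & Hy & Hxy & ->). intros E.
      destruct (Hind' (1 - x - y)%R (x + y * s)%R) as [I1 I2]; [| nra].
      apply Ceq_minus in E. rewrite <- E. unfold b'. rewrite !RtoC_minus, RtoC_plus, RtoC_mult. ring. }
    assert (E2 : tri g a b' a' = 0).
    { apply K. intros z Hz. split; [now apply (hull_sub a b p a b' a') |].
      destruct Hz as (x & y & Hx & Hy & Hxy & ->). intros E.
      destruct (Hind' (1 - x - y + y * s)%R (x * s)%R) as [I1 I2]; [| nra].
      apply Ceq_minus in E. rewrite <- E. unfold b', a'.
      rewrite !RtoC_plus, !RtoC_minus, !RtoC_mult. ring. }
    assert (E3 : tri g a b p = tri g a' b' p).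
    { transitivity (tri g a' b' p + tri g a b b' + tri g a b' a'); [| rewrite E1, E2; ring].
      unfold tri.
      replace (SI g b p) with (SI g b b' + SI g b' p).
      2:{ assert (b' = b + RtoC (1 - s) * (p - b)) as Eb by (unfold b'; rewrite RtoC_minus; ring).
          rewrite Eb. symmetry. apply SI_split; [lra | now apply HK]. }
      replace (SI g p a) with (SI g p a' + SI g a' a).
      2:{ symmetry. apply SI_split; [lra | now apply HK]. }
      rewrite (SI_swap g a b'), (SI_swap g a' b') by now apply HK. ring. }
    assert (B : forall z, hull a' b' p z -> (Cmod (g z) <= M)%R).
    { intros z (x & y & Hx & Hy & Hxy & ->).
      assert (N : (Cmod (a' + x * (b' - a') + y * (p - a') - p) < r)%R).
      { replace (a' + x * (b' - a') + y * (p - a') - p)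
          with (RtoC (s * (1 - x - y)) * (a - p) + RtoC (s * x) * (b - p)).
        2:{ unfold a', b'. rewrite !RtoC_mult, !RtoC_minus. ring. }
        eapply Rle_lt_trans; [apply Cmod_triangle |]. rewrite !Cmod_mult, !Cmod_R, !Rabs_pos_eq by nra.
        pose proof (Cmod_ge_0 (a - p)). pose proof (Cmod_ge_0 (b - p)).
        assert (s * (1 - x - y) * Cmod (a - p) <= s * Cmod (a - p))%R by (apply Rmult_le_compat_r; nra).
        assert (s * x * Cmod (b - p) <= s * Cmod (b - p))%R by (apply Rmult_le_compat_r; nra).
        unfold L in Hs2. nra. }
      specialize (Hb1 _ N). unfold M.
      pose proof (Cmod_triangle_rev (g (a' + x * (b' - a') + y * (p - a'))) (g p)). lra. }
    assert (Hsub := hull_sub a b p a' b' p Ha' Hb' Hp).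
    assert (P1 := SI_norm_le g a' b' M (HK _ _ Ha' Hb') (fun w Hw => B w (seg_hull_1 _ _ _ _ Hw))).
    assert (P2 := SI_norm_le g b' p M (HK _ _ Hb' Hp) (fun w Hw => B w (seg_hull_2 _ _ _ _ Hw))).
    assert (P3 := SI_norm_le g p a' M (HK _ _ Hp Ha') (fun w Hw => B w (seg_hull_3 _ _ _ _ Hw))).
    assert (L2 : Cmod (p - b') = (s * Cmod (b - p))%R).
    { replace (p - b') with (RtoC (- s) * (b - p)) by (unfold b'; rewrite RtoC_opp; ring).
      rewrite Cmod_mult, Cmod_R, Rabs_Ropp, Rabs_pos_eq; lra. }
    assert (L3 : Cmod (a' - p) = (s * Cmod (a - p))%R).
    { replace (a' - p) with (RtoC s * (a - p)) by (unfold a'; ring).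
      rewrite Cmod_mult, Cmod_R, Rabs_pos_eq; lra. }
    assert (L1 : (Cmod (b' - a') <= s * Cmod (b - p) + s * Cmod (a - p))%R).
    { replace (b' - a') with (- (p - b') - (a' - p)) by ring.
      eapply Rle_trans; [apply Cmod_triangle_minus |]. rewrite Cmod_opp. lra. }
    rewrite L2 in P2. rewrite L3 in P3.
    assert (M * Cmod (b' - a') <= M * (s * Cmod (b - p) + s * Cmod (a - p)))%R by (apply Rmult_le_compat_l; lra).
    assert (F : (e <= 2 * (s * (Cmod (a - p) + Cmod (b - p)) * M))%R).
    { unfold e. rewrite E3. unfold tri.
      pose proof (Cmod_triangle (SI g a' b' + SI g b' p) (SI g p a')).
      pose proof (Cmod_triangle (SI g a' b') (SI g b' p)). lra. }
    assert (0 < s * M)%R by nra. unfold L in Hs3.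
    pose proof (Cmod_ge_0 (a - p)). pose proof (Cmod_ge_0 (b - p)).
    assert (0 <= s * M * (Cmod (a - p) + Cmod (b - p)))%R by nra. nra.
Qed.

(** If [p] lies in the triangle, joining it to the vertices gives three triangles with vertex [p],
    and the edges through [p] cancel. *)
Lemma tri_except (g : C -> C) (a b c p : C) :
  (forall z, hull a b c z -> ccont g z) ->
  (forall u v w, (forall z, hull u v w z -> hull a b c z /\ z <> p) -> tri g u v w = 0) ->
  tri g a b c = 0.
Proof.
  intros H K. destruct (classic (hull a b c p)) as [Hp | Hp].
  - assert (Ha := hull_1 a b c). assert (Hb := hull_2 a b c). assert (Hc := hull_3 a b c).
    assert (V : forall u v, hull a b c u -> hull a b c v -> tri g u v p = 0).
    { intros u v Hu Hv. apply tri_vertex.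
      - intros z Hz. apply H. now apply (hull_sub a b c u v p).
      - intros u' v' w' Hz'. apply K. intros z Hz. destruct (Hz' z Hz) as [H1 H2]. split; auto.
        now apply (hull_sub a b c u v p). }
    assert (HK : forall q1 q2, hull a b c q1 -> hull a b c q2 -> forall z, seg q1 q2 z -> ccont g z).
    { intros q1 q2 H1 H2 z Hz. apply H. now apply (hull_seg a b c q1 q2). }
    transitivity (tri g a b p + tri g b c p + tri g c a p).
    + unfold tri. rewrite (SI_swap g a p), (SI_swap g b p), (SI_swap g c p) by now apply HK. ring.
    + rewrite !V by auto. ring.
  - apply K. intros z Hz. split; auto. intros ->. auto.
Qed.

(** Two exceptional points are allowed because [Cauchy_formula] has two: the point [a] where the
    difference quotient is only continuous, and the point [p] whose singularity [removable] is to
    remove. *)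
Lemma goursat_except (g : C -> C) (a b c p q : C) :
  (forall z, hull a b c z -> ccont g z) ->
  (forall z, hull a b c z -> z <> p -> z <> q -> exists d, cd g z d) -> tri g a b c = 0.
Proof.
  intros H K. apply (tri_except g a b c p H). intros a1 b1 c1 H1.
  apply (tri_except g a1 b1 c1 q).
  - intros z Hz. apply H. now apply H1.
  - intros a2 b2 c2 H2. apply goursat. intros z Hz. destruct (H2 z Hz) as [Hz1 Hzq].
    destruct (H1 z Hz1) as [Hz0 Hzp]. auto.
Qed.

(** * Primitives on discs *)

Definition disc (r : R) (z : C) : Prop := (Cmod z < r)%R.

Lemma disc_seg (r : R) (a b z : C) : disc r a -> disc r b -> seg a b z -> disc r z.
Proof.
  unfold disc. intros Ha Hb (t & Ht & ->).
  replace (a + t * (b - a)) with (RtoC (1 - t) * a + RtoC t * b) by (rewrite RtoC_minus; ring).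
  eapply Rle_lt_trans; [apply Cmod_triangle |]. rewrite !Cmod_mult, !Cmod_R, !Rabs_pos_eq by lra.
  destruct (Req_dec t 0) as [-> | Ht0]; [lra |].
  assert ((1 - t) * Cmod a <= (1 - t) * r)%R by (apply Rmult_le_compat_l; lra).
  assert (t * Cmod b < t * r)%R by (apply Rmult_lt_compat_l; lra). lra.
Qed.

Lemma disc_hull (r : R) (a b c z : C) : disc r a -> disc r b -> disc r c -> hull a b c z -> disc r z.
Proof.
  intros Ha Hb Hc (x & y & Hx & Hy & Hxy & ->).
  destruct (Req_dec (x + y) 0) as [E | E].
  - assert (x = 0%R) as -> by lra. assert (y = 0%R) as -> by lra.
    now replace (a + 0 * (b - a) + 0 * (c - a)) with a by ring.
  - apply (disc_seg r a (b + RtoC (y / (x + y)) * (c - b))); auto.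
    + apply (disc_seg r b c); auto. exists (y / (x + y))%R. split; auto. split.
      * apply Rdiv_le_0_compat; lra.
      * apply (Rmult_le_reg_r (x + y)); [lra |]. unfold Rdiv. rewrite Rmult_assoc, Rinv_l; lra.
    + exists (x + y)%R. split; [lra |].
      assert (RtoC (x + y) <> 0) by (intros Z; apply RtoC_inj in Z; auto).
      rewrite RtoC_div by auto. rewrite RtoC_plus in *. field. auto.
Qed.

(** The primitive is the integral along the radius; the vanishing over the triangle [0, z, w] turns
    its increment into the integral over the segment from [z] to [w]. *)
Lemma primitive_disc (r : R) (g : C -> C) (p q : C) : (0 < r)%R ->
  (forall z, disc r z -> ccont g z) ->
  (forall z, disc r z -> z <> p -> z <> q -> exists d, cd g z d) ->
  exists k : C -> C, k 0 = 0 /\ forall z, disc r z -> cd k z (g z).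
Proof.
  intros Hr H K.
  assert (D0 : disc r 0) by (unfold disc; now rewrite Cmod_0).
  assert (HS : forall a b, disc r a -> disc r b -> forall z, seg a b z -> ccont g z).
  { intros a b Ha Hb z Hz. apply H. now apply (disc_seg r a b). }
  set (G0 := SI g 0). exists (fun z => G0 z - G0 0). split; [ring |].
  intros z Hz. eapply cd_eq; [apply cd_minus; [| apply cd_const] | ring_simplify; reflexivity].
  assert (Hdiff : forall w, disc r w -> G0 w - G0 z = SI g z w).
  { intros w Hw. unfold G0.
    assert (E : tri g 0 z w = 0).
    { apply (goursat_except g 0 z w p q); intros v Hv; [apply H | apply K]; now apply (disc_hull r 0 z w). }
    unfold tri in E. rewrite (SI_swap g 0 w) in E by now apply HS.
    replace (SI g z w) with (SI g z w - (SI g 0 z + SI g z w + - SI g 0 w)) by (rewrite E; ring). ring. }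
  apply cd_eps. intros eps He.
  destruct (proj1 (ccont_iff g z) (H z Hz) eps He) as (d & Hd & Hc).
  assert (Hz' : (0 < r - Cmod z)%R) by (unfold disc in Hz; lra).
  exists (Rmin d (r - Cmod z)). split; [now apply Rmin_glb_lt |].
  intros w Hw.
  assert (Hw1 : (Cmod (w - z) < d)%R) by (eapply Rlt_le_trans; [exact Hw | apply Rmin_l]).
  assert (Hw2 : (Cmod (w - z) < r - Cmod z)%R) by (eapply Rlt_le_trans; [exact Hw | apply Rmin_r]).
  assert (Dw : disc r w).
  { unfold disc. pose proof (Cmod_triangle_rev w z). lra. }
  rewrite (Hdiff w Dw).
  replace (SI g z w - (w - z) * g z) with (SI (fun v => g v - g z) z w).
  - apply SI_norm_le.
    + intros v Hv. pose proof (HS _ _ Hz Dw v Hv) as C1. unfold ccont in *. ulim_tac.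
    + intros v (t & Ht & ->). apply Rlt_le. apply Hc.
      replace (z + t * (w - z) - z) with (RtoC t * (w - z)) by ring.
      rewrite Cmod_mult, Cmod_R, Rabs_pos_eq by lra. pose proof (Cmod_ge_0 (w - z)). nra.
  - rewrite (SI_minus g (fun _ => g z)); [| now apply HS | intros v _; apply (cd_cont _ _ _ (cd_const (g z) v))].
    rewrite (SI_primitive (fun v => v * g z) (fun _ => g z)); [cbv beta; ring | |].
    + intros v _. apply (cd_cont _ _ _ (cd_const (g z) v)).
    + intros v _. eapply cd_eq; [apply cd_mult; [apply cd_id | apply cd_const] | cbv beta; ring].
Qed.

(** * Cauchy's formula *)

(** The integral takes values in [C] as a real vector space, so linearity over [C] has to be checked
    on the components. *)
Lemma is_RInt_Cmult (c : C) (g : R -> C) (a b : R) (l : C) :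
  is_RInt (V := C_R_NormedModule) g a b l -> is_RInt (V := C_R_NormedModule) (fun t => c * g t) a b (c * l).
Proof.
  intros H.
  assert (H1 : is_RInt (fun t => fst (g t)) a b (fst l)) by exact (is_RInt_fct_extend_fst (U := R_NormedModule) (V := R_NormedModule) g a b l H).
  assert (H2 : is_RInt (fun t => snd (g t)) a b (snd l)) by exact (is_RInt_fct_extend_snd (U := R_NormedModule) (V := R_NormedModule) g a b l H).
  apply (is_RInt_fct_extend_pair (U := R_NormedModule) (V := R_NormedModule)).
  - exact (is_RInt_minus (V := R_NormedModule) _ _ _ _ _ _ (is_RInt_scal (V := R_NormedModule) _ _ _ (fst c) _ H1)
             (is_RInt_scal (V := R_NormedModule) _ _ _ (snd c) _ H2)).
  - exact (is_RInt_plus (V := R_NormedModule) _ _ _ _ _ _ (is_RInt_scal (V := R_NormedModule) _ _ _ (fst c) _ H2)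
             (is_RInt_scal (V := R_NormedModule) _ _ _ (snd c) _ H1)).
Qed.

Lemma CRInt_Cmult (c : C) (g : R -> C) (a b : R) :
  ex_RInt (V := C_R_CompleteNormedModule) g a b -> CRInt (fun t => c * g t) a b = c * CRInt g a b.
Proof.
  intros H. apply (is_RInt_unique (V := C_R_CompleteNormedModule)).
  apply (is_RInt_Cmult c g a b (CRInt g a b)).
  apply (RInt_correct (V := C_R_CompleteNormedModule)). exact H.
Qed.

Lemma CRInt_primitive (gam dgam : R -> C) (a b : R) :
  (forall t, rd gam t (dgam t)) -> (forall t, rcont dgam t) -> CRInt dgam a b = gam b - gam a.
Proof.
  intros H K. apply (is_RInt_unique (V := C_R_CompleteNormedModule)).
  exact (is_RInt_derive (V := C_R_CompleteNormedModule) gam dgam a b (fun t _ => H t)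
    (fun t _ => rcont_continuous _ _ (K t))).
Qed.

Definition circ (r t : R) : C := RtoC r * Cexp (Ci * RtoC t).

Lemma rd_expi (c : C) (t : R) : rd (fun s => Cexp (c * RtoC s)) t (c * Cexp (c * RtoC t)).
Proof.
  assert (A : rd (fun s => 0 + RtoC s * c) t c) by apply rd_affine.
  assert (B := rd_comp Cexp (fun s => 0 + RtoC s * c) t _ _ (cd_Cexp _) A).
  assert (E : forall s : R, 0 + RtoC s * c = c * RtoC s) by (intros; ring).
  rewrite E in B. apply (is_derive_ext (fun s => Cexp (0 + RtoC s * c))).
  - intros s. now rewrite E.
  - eapply rd_eq; [exact B | ring].
Qed.

Lemma rd_circ (r t : R) : rd (circ r) t (Ci * circ r t).
Proof.
  unfold circ. eapply rd_eq.
  - apply (rd_comp (fun w => RtoC r * w) (fun s => Cexp (Ci * RtoC s))); [| apply rd_expi].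
    apply cd_mult; [apply cd_const | apply cd_id].
  - cbv beta. ring.
Qed.

Lemma rcont_circ (r t : R) : rcont (circ r) t.
Proof. exact (rd_cont _ _ _ (rd_circ r t)). Qed.

Lemma Cmod_expi (t : R) : Cmod (Cexp (Ci * RtoC t)) = 1%R.
Proof. rewrite Cmod_Cexp, re_mult, re_RtoC, im_RtoC. simpl. rewrite <- exp_0. f_equal. ring. Qed.

Lemma Cmod_circ (r t : R) : (0 <= r)%R -> Cmod (circ r t) = r.
Proof. intros H. unfold circ. rewrite Cmod_mult, Cmod_expi, Cmod_R, Rabs_pos_eq; lra. Qed.

Lemma Cexp_turn_Ci : Cexp (Ci * RtoC (2 * PI)) = 1.
Proof. rewrite <- Cexp_turn. f_equal. unfold Cturn. apply C_ext; simpl; ring. Qed.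

Lemma circ_closed (r : R) : circ r (2 * PI) = circ r 0.
Proof. unfold circ. rewrite Cexp_turn_Ci, Cmult_0_r, Cexp_0. reflexivity. Qed.

Lemma Cminus_neq_0_of_mod (z a : C) : (Cmod a < Cmod z)%R -> z - a <> 0.
Proof. intros H E. apply Ceq_minus in E. subst. lra. Qed.

Lemma rcont_inv (g : R -> C) (t : R) : rcont g t -> g t <> 0 -> rcont (fun s => / g s) t.
Proof.
  intros H E. unfold rcont in *.
  apply (ulim_inv g (fun _ => g t)); [exact H | apply ubdd_const | now apply filter_forall].
Qed.

Lemma rcont_minus_const (g : R -> C) (a : C) (t : R) : rcont g t -> rcont (fun s => g s - a) t.
Proof. intros H. unfold rcont in *. ulim_tac. Qed.

(** With [al = a / r] and [ze t = exp (- i t)] the integrand is [i + i * al * ze / (1 - al * ze)],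
    the derivative of [i t - L (ze t)] where [L] is a primitive of [al / (1 - al z)]. The second
    term is periodic, and no logarithm of [circ r t - a] is needed. *)
Lemma winding (r : R) (a : C) : (Cmod a < r)%R ->
  CRInt (fun t => Ci * circ r t / (circ r t - a)) 0 (2 * PI) = RtoC (2 * PI) * Ci.
Proof.
  intros Ha. assert (Hr : (0 < r)%R) by (pose proof (Cmod_ge_0 a); lra).
  assert (Hr0 : RtoC r <> 0) by (intros Z; apply RtoC_inj in Z; lra).
  set (al := a / RtoC r).
  assert (Hal : (Cmod al < 1)%R).
  { unfold al. rewrite Cmod_div, Cmod_R, Rabs_pos_eq by (auto; lra).
    apply (Rmult_lt_reg_r r); auto. unfold Rdiv. rewrite Rmult_assoc, Rinv_l; lra. }
  pose proof (Cmod_ge_0 al) as Hal0.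
  (* The radius [2 / (1 + |al|)] exceeds 1, so that the disc contains the unit circle, and is small
     enough to avoid the pole [1 / al]. *)
  assert (Hn : forall z, disc (2 / (1 + Cmod al)) z -> 1 - al * z <> 0).
  { intros z Hz. apply Cminus_neq_0_of_mod. rewrite Cmod_1, Cmod_mult. unfold disc in Hz.
    apply Rle_lt_trans with (Cmod al * (2 / (1 + Cmod al)))%R; [apply Rmult_le_compat_l; lra |].
    apply (Rmult_lt_reg_r (1 + Cmod al)); [lra |].
    replace (Cmod al * (2 / (1 + Cmod al)) * (1 + Cmod al))%R with (2 * Cmod al)%R by (field; lra). lra. }
  assert (Hder : forall z, disc (2 / (1 + Cmod al)) z -> exists d, cd (fun z => al / (1 - al * z)) z d).
  { intros z Hz. eexists. apply cd_div; [apply cd_const | | now apply Hn].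
    apply cd_minus; [apply cd_const |]. apply cd_mult; [apply cd_const | apply cd_id]. }
  destruct (primitive_disc (2 / (1 + Cmod al)) (fun z => al / (1 - al * z)) 0 0) as (L & _ & HL).
  { apply Rdiv_lt_0_compat; lra. }
  { intros z Hz. destruct (Hder z Hz) as [d Hd]. exact (cd_cont _ _ _ Hd). }
  { intros z Hz _ _. auto. }
  set (ze := fun t : R => Cexp (- Ci * RtoC t)).
  assert (Hze : forall t, disc (2 / (1 + Cmod al)) (ze t)).
  { intros t. unfold disc, ze. rewrite Cmod_Cexp, re_mult, re_RtoC, im_RtoC. simpl.
    replace (- 0 * t - -1 * 0)%R with 0%R by ring. replace (- (0) * t - - (1) * 0)%R with 0%R by ring.
    rewrite exp_0. apply (Rmult_lt_reg_r (1 + Cmod al)); [lra |].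
    unfold Rdiv. rewrite Rmult_assoc, Rinv_l; lra. }
  rewrite (CRInt_primitive (fun t => RtoC t * Ci - L (ze t)) (fun t => Ci * circ r t / (circ r t - a))).
  - assert (E : ze (2 * PI)%R = ze 0%R).
    { unfold ze. rewrite Cmult_0_r, Cexp_0. replace (- Ci * RtoC (2 * PI)) with (- (Ci * RtoC (2 * PI))) by ring.
      rewrite Cexp_opp, Cexp_turn_Ci. field. }
    rewrite E. ring.
  - intros t.
    assert (A : rd (fun s => L (ze s)) t (al / (1 - al * ze t) * (- Ci * ze t))).
    { apply (rd_comp L ze); [apply HL, Hze | apply rd_expi]. }
    assert (B : rd (fun s => 0 + RtoC s * Ci) t Ci) by apply rd_affine.
    assert (D : rd (fun s => RtoC s * Ci - L (ze s)) t (Ci - al / (1 - al * ze t) * (- Ci * ze t))).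
    { rewrite rd_slope in *. destruct A as (s1 & S1 & E1), B as (s2 & S2 & E2).
      exists (fun w => s2 w - s1 w). split; [now apply ulim_minus |].
      intros w. specialize (E2 w). rewrite !Cplus_0_l in E2. rewrite (E1 w), E2.
      match goal with |- ?x = ?y => change (@eq C x y) end. ring. }
    eapply rd_eq; [exact D |].
    assert (Ez : ze t * Cexp (Ci * RtoC t) = 1).
    { unfold ze. rewrite <- Cexp_plus, <- Cexp_0. f_equal. ring. }
    assert (E : ze t = RtoC r / circ r t).
    { unfold circ. replace (ze t) with (ze t * Cexp (Ci * RtoC t) / Cexp (Ci * RtoC t)) by (field; apply Cexp_neq_0).
      rewrite Ez. field. split; [apply Cexp_neq_0 | auto]. }
    assert (Hc : circ r t <> 0) by (apply Cmod_neq_0; rewrite Cmod_circ; lra).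
    assert (Hc2 : circ r t - a <> 0) by (apply Cminus_neq_0_of_mod; rewrite Cmod_circ; lra).
    rewrite E. unfold al. field. repeat split; auto.
  - intros t. unfold Cdiv. apply rcont_mult.
    + apply rcont_mult; [apply rcont_const | apply rcont_circ].
    + apply rcont_inv; [apply rcont_minus_const, rcont_circ |].
      apply Cminus_neq_0_of_mod. rewrite Cmod_circ; lra.
Qed.

(** The integral of [g z / (z - a)] over the circle of radius [r], without the factor
    [1 / (2 PI i)]. *)
Definition Cauchy_int (r : R) (g : C -> C) (a : C) : C :=
  CRInt (fun t => g (circ r t) * (Ci * circ r t / (circ r t - a))) 0 (2 * PI).

Lemma rcont_Cauchy (r : R) (g : C -> C) (a : C) (t : R) : (Cmod a < r)%R ->
  ccont g (circ r t) -> rcont (fun t => g (circ r t) * (Ci * circ r t / (circ r t - a))) t.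
Proof.
  intros Ha Hg. assert (Hr : (0 < r)%R) by (pose proof (Cmod_ge_0 a); lra).
  apply rcont_mult; [apply (rcont_comp g (circ r)); [apply rcont_circ | exact Hg] |].
  unfold Cdiv. apply rcont_mult.
  + apply rcont_mult; [apply rcont_const | apply rcont_circ].
  + apply rcont_inv; [apply rcont_minus_const, rcont_circ |].
    apply Cminus_neq_0_of_mod. rewrite Cmod_circ; lra.
Qed.

(** The difference quotient of [g] at [a] is continuous, and differentiable off [a] and [p]. It
    therefore has a primitive, its integral over the circle vanishes, and what is left is [g a]
    times the integral of [winding]. *)
Lemma Cauchy_formula (rho r : R) (g : C -> C) (p a : C) : (r < rho)%R -> (Cmod a < r)%R -> a <> p ->
  (forall z, disc rho z -> ccont g z) ->
  (forall z, disc rho z -> z <> p -> exists d, cd g z d) ->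
  Cauchy_int r g a = RtoC (2 * PI) * Ci * g a.
Proof.
  intros Hr Ha Hap H K. assert (Hr0 : (0 < r)%R) by (pose proof (Cmod_ge_0 a); lra).
  destruct (K a) as [d Hd]; [unfold disc; lra | auto |].
  apply cd_slope in Hd. destruct Hd as (s & Hs & E).
  set (k := fun z => match Ceq_dec z a with left _ => d | _ => (g z - g a) / (z - a) end).
  assert (Dk : forall z, disc rho z -> z <> a -> z <> p -> exists e, cd k z e).
  { intros z Hz Hza Hzp. destruct (K z Hz Hzp) as [e He]. eexists.
    apply (cd_ext_loc (fun z => (g z - g a) / (z - a))).
    - apply locally_C_iff. exists (Cmod (z - a)). split; [apply Cmod_gt_0, Cminus_eq_contra; auto |].
      intros w Hw. unfold k. destruct (Ceq_dec w a); auto. exfalso. subst w.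
      rewrite Cmod_minus_sym in Hw. lra.
    - apply cd_div; [apply cd_minus; [exact He | apply cd_const] | apply cd_minus; [apply cd_id | apply cd_const] |].
      now apply Cminus_eq_contra. }
  assert (Ck : forall z, disc rho z -> ccont k z).
  { intros z Hz. destruct (Ceq_dec z a) as [-> | Hza].
    - assert (Ea : k a = d) by (unfold k; destruct (Ceq_dec a a); congruence).
      unfold ccont. rewrite Ea. apply (ulim_ext (fun w => match Ceq_dec w a with left _ => d | _ => s w end) _ (fun _ => d)).
      + apply filter_forall. intros w. unfold k. destruct (Ceq_dec w a) as [|n]; auto.
        rewrite (E w). field. now apply Cminus_eq_contra.
      + apply filter_forall. auto.
      + intros eps He. generalize (Hs eps He). apply filter_imp. intros w Hw.
        destruct (Ceq_dec w a); auto. replace (d - d) with (RtoC 0) by ring. now rewrite Cmod_0.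
    - assert (Q : ccont (fun z => (g z - g a) / (z - a)) z).
      { unfold ccont. apply ulim_mult; [| | apply ubdd_const | apply ubdd_const].
        - pose proof (H z Hz). unfold ccont in *. ulim_tac.
        - apply ulim_inv; [ulim_tac | apply ubdd_const | apply filter_forall; intros _; now apply Cminus_eq_contra]. }
      assert (Ez : k z = (g z - g a) / (z - a)) by (unfold k; destruct (Ceq_dec z a); congruence).
      unfold ccont in *. rewrite Ez. eapply ulim_ext; [| | exact Q]; [| apply filter_forall; auto].
      apply locally_C_iff. exists (Cmod (z - a)). split; [apply Cmod_gt_0, Cminus_eq_contra; auto |].
      intros w Hw. unfold k. destruct (Ceq_dec w a); auto. exfalso. subst w.
      rewrite Cmod_minus_sym in Hw. lra. }
  destruct (primitive_disc rho k a p) as (G1 & _ & HG1); auto; [lra |].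
  assert (Hdc : forall t, disc rho (circ r t)) by (intros t; unfold disc; rewrite Cmod_circ; lra).
  assert (Hne : forall t, circ r t - a <> 0) by (intros t; apply Cminus_neq_0_of_mod; rewrite Cmod_circ; lra).
  assert (I0 : CRInt (fun t => k (circ r t) * (Ci * circ r t)) 0 (2 * PI) = 0).
  { rewrite (CRInt_primitive (fun t => G1 (circ r t))).
    - rewrite circ_closed. ring.
    - intros t. apply (rd_comp G1 (circ r)); [apply HG1, Hdc | apply rd_circ].
    - intros t. apply rcont_mult; [apply (rcont_comp k (circ r)); [apply rcont_circ | apply Ck, Hdc] |].
      apply rcont_mult; [apply rcont_const | apply rcont_circ]. }
  assert (R1 : forall t, rcont (fun t => g (circ r t) * (Ci * circ r t / (circ r t - a))) t).
  { intros t. apply rcont_Cauchy; auto. }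
  assert (R2 : forall t, rcont (fun t => Ci * circ r t / (circ r t - a)) t).
  { intros t. pose proof (rcont_Cauchy r (fun _ => 1) a t Ha (cd_cont _ _ _ (cd_const 1 _))) as Q.
    unfold rcont in *. eapply ulim_ext; [| | exact Q]; apply filter_forall; intros; ring. }
  transitivity (CRInt (fun t => k (circ r t) * (Ci * circ r t)) 0 (2 * PI)
                 + g a * CRInt (fun t => Ci * circ r t / (circ r t - a)) 0 (2 * PI)).
  - rewrite <- CRInt_Cmult by (apply rcont_ex_RInt; auto).
    etransitivity.
    2:{ apply (RInt_plus (V := C_R_CompleteNormedModule)).
        - apply rcont_ex_RInt. intros t _.
          apply rcont_mult; [apply (rcont_comp k (circ r)); [apply rcont_circ | apply Ck, Hdc] |].
          apply rcont_mult; [apply rcont_const | apply rcont_circ].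
        - apply rcont_ex_RInt. intros t _. apply rcont_mult; [apply rcont_const | apply R2]. }
    apply (RInt_ext (V := C_R_CompleteNormedModule)). intros t _.
    match goal with |- _ = plus ?x ?y =>
      change (@eq C (g (circ r t) * (Ci * circ r t / (circ r t - a))) (Cplus x y)) end.
    unfold k. destruct (Ceq_dec (circ r t) a) as [e | _].
    + exfalso. apply (Hne t). rewrite e. ring.
    + field. apply Hne.
  - rewrite I0, winding by auto. ring.
Qed.

Lemma Cauchy_int_bound (r M : R) (g : C -> C) (a : C) : (Cmod a < r)%R ->
  (forall t, ccont g (circ r t)) -> (forall t, (0 <= t <= 2 * PI)%R -> (Cmod (g (circ r t)) <= M)%R) ->
  (Cmod (Cauchy_int r g a) <= 2 * PI * (M * (r / (r - Cmod a))))%R.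
Proof.
  intros Ha Hc HM. assert (Hr0 : (0 < r)%R) by (pose proof (Cmod_ge_0 a); lra).
  unfold Cauchy_int. replace (2 * PI * (M * (r / (r - Cmod a))))%R with ((2 * PI - 0) * (M * (r / (r - Cmod a))))%R by ring.
  pose proof PI_RGT_0. apply CRInt_norm_le; [lra | |].
  - apply rcont_ex_RInt. intros t _. now apply rcont_Cauchy.
  - intros t Ht. rewrite Cmod_mult. apply Rmult_le_compat; try apply Cmod_ge_0.
    + now apply HM.
    + assert (Hne : circ r t - a <> 0) by (apply Cminus_neq_0_of_mod; rewrite Cmod_circ; lra).
      rewrite Cmod_div, Cmod_mult, Cmod_Ci, Rmult_1_l, Cmod_circ by (auto; lra).
      apply Rmult_le_compat_l; [lra |]. apply Rinv_le_contravar; [lra |].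
      pose proof (Cmod_triangle_rev (circ r t) a). rewrite Cmod_circ in H0; lra.
Qed.

(** The remainder depends on [g] only through [M], which later gives estimates uniform over families
    of functions. The integrand of the remainder has the factor [h ^ 2 / ((z - a) ^ 2 (z - a - h))];
    the 2 comes from [|z - a - h| >= (r - rho) / 2]. *)
Lemma Cauchy_int_taylor (r rho M : R) (g : C -> C) (a : C) : (0 < r)%R -> (rho < r)%R -> (Cmod a <= rho)%R ->
  (forall t, ccont g (circ r t)) -> (forall t, (0 <= t <= 2 * PI)%R -> (Cmod (g (circ r t)) <= M)%R) ->
  exists d, forall h, (Cmod h <= (r - rho) / 2)%R ->
    (Cmod (Cauchy_int r g (a + h) - Cauchy_int r g a - h * d)
      <= 2 * PI * (2 * r * M / (r - rho) ^ 3) * (Cmod h * Cmod h))%R.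
Proof.
  intros Hr Hrho Ha Hc HM.
  exists (CRInt (fun t => g (circ r t) * (Ci * circ r t / (circ r t - a)) * / (circ r t - a)) 0 (2 * PI)).
  intros h Hh.
  assert (Hah : (Cmod (a + h) < r)%R) by (eapply Rle_lt_trans; [apply Cmod_triangle | lra]).
  assert (Ha' : (Cmod a < r)%R) by lra.
  assert (R1 := fun t => rcont_Cauchy r g a t Ha' (Hc t)).
  assert (R2 := fun t => rcont_Cauchy r g (a + h) t Hah (Hc t)).
  assert (N1 : forall t, circ r t - a <> 0) by (intros t; apply Cminus_neq_0_of_mod; rewrite Cmod_circ; lra).
  assert (N2 : forall t, circ r t - (a + h) <> 0) by (intros t; apply Cminus_neq_0_of_mod; rewrite Cmod_circ; lra).
  assert (R3 : forall t, rcont (fun t => g (circ r t) * (Ci * circ r t / (circ r t - a)) * / (circ r t - a)) t).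
  { intros t. apply rcont_mult; [apply R1 |]. apply rcont_inv; [apply rcont_minus_const, rcont_circ | apply N1]. }
  assert (R4 : forall t, rcont (fun t => h * (g (circ r t) * (Ci * circ r t / (circ r t - a)) * / (circ r t - a))) t).
  { intros t. apply rcont_mult; [apply rcont_const | apply R3]. }
  unfold Cauchy_int. rewrite <- CRInt_Cmult by (apply rcont_ex_RInt; auto).
  set (k0 := fun t => g (circ r t) * (Ci * circ r t / (circ r t - (a + h)))) in *.
  set (k1 := fun t => g (circ r t) * (Ci * circ r t / (circ r t - a))) in *.
  set (k2 := fun t => h * (k1 t * / (circ r t - a))) in *.
  assert (E : CRInt k0 0 (2 * PI) - CRInt k1 0 (2 * PI) - CRInt k2 0 (2 * PI)
              = CRInt (fun t => (k0 t - k1 t) - k2 t) 0 (2 * PI)).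
  { symmetry. etransitivity.
    - apply (RInt_minus (V := C_R_CompleteNormedModule) (fun t => k0 t - k1 t) k2).
      + apply rcont_ex_RInt. intros t _. pose proof (R1 t). pose proof (R2 t). unfold rcont in *.
        apply ulim_minus; auto.
      + apply rcont_ex_RInt; auto.
    - apply (f_equal (fun u : C => u - CRInt k2 0 (2 * PI))).
      apply (RInt_minus (V := C_R_CompleteNormedModule) k0 k1); apply rcont_ex_RInt; auto. }
  match goal with |- (Cmod ?e <= _)%R => change e with (CRInt k0 0 (2 * PI) - CRInt k1 0 (2 * PI) - CRInt k2 0 (2 * PI)) end.
  rewrite E.
  replace (2 * PI * (2 * r * M / (r - rho) ^ 3) * (Cmod h * Cmod h))%R
    with ((2 * PI - 0) * (2 * r * M / (r - rho) ^ 3 * (Cmod h * Cmod h)))%R by ring.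
  pose proof PI_RGT_0. apply CRInt_norm_le; [lra | |].
  - apply rcont_ex_RInt. intros t _. pose proof (R1 t). pose proof (R2 t). pose proof (R4 t). unfold rcont in *.
    apply ulim_minus; [apply ulim_minus |]; auto.
  - intros t Ht. unfold k2, k1, k0. cbv beta.
    replace (g (circ r t) * (Ci * circ r t / (circ r t - (a + h))) - g (circ r t) * (Ci * circ r t / (circ r t - a)) -
      h * (g (circ r t) * (Ci * circ r t / (circ r t - a)) * / (circ r t - a)))
      with (g (circ r t) * (Ci * circ r t) * (h * h) * (/ (circ r t - a) * / (circ r t - a) * / (circ r t - (a + h))))
      by (field; auto).
    rewrite !Cmod_mult, Cmod_Ci, Rmult_1_l. rewrite !Cmod_inv by auto. rewrite Cmod_circ by lra.
    assert (B1 : (r - rho <= Cmod (circ r t - a))%R).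
    { pose proof (Cmod_triangle_rev (circ r t) a). rewrite Cmod_circ in H0; lra. }
    assert (B2 : ((r - rho) / 2 <= Cmod (circ r t - (a + h)))%R).
    { pose proof (Cmod_triangle_rev (circ r t) (a + h)). rewrite Cmod_circ in H0 by lra.
      pose proof (Cmod_triangle a h). lra. }
    assert (I1 : (/ Cmod (circ r t - a) <= / (r - rho))%R) by (apply Rinv_le_contravar; lra).
    assert (I2 : (/ Cmod (circ r t - (a + h)) <= / ((r - rho) / 2))%R) by (apply Rinv_le_contravar; lra).
    assert (P1 : (0 <= / Cmod (circ r t - a))%R) by (apply Rlt_le, Rinv_0_lt_compat; lra).
    assert (P2 : (0 <= / Cmod (circ r t - (a + h)))%R) by (apply Rlt_le, Rinv_0_lt_compat; lra).
    pose proof (HM t Ht) as HMt. pose proof (Cmod_ge_0 (g (circ r t))).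
    pose proof (Cmod_ge_0 h).
    replace (2 * r * M / (r - rho) ^ 3 * (Cmod h * Cmod h))%R
      with (M * r * (Cmod h * Cmod h) * (/ (r - rho) * / (r - rho) * / ((r - rho) / 2)))%R by (field; lra).
    repeat first [apply Rmult_le_compat | apply Rmult_le_pos]; try lra; auto.
Qed.

Lemma circ_bounded (r : R) (g : C -> C) : (forall t, ccont g (circ r t)) ->
  exists M, forall t, (0 <= t <= 2 * PI)%R -> (Cmod (g (circ r t)) <= M)%R.
Proof.
  intros H. pose proof PI_RGT_0.
  destruct (continuity_ab_maj (fun t => Cmod (g (circ r t))) 0 (2 * PI)) as (t0 & Ht0 & _); [lra | |].
  - intros t _. apply continuity_pt_filterlim. apply filterlim_locally. intros eps.
    generalize (rcont_comp g (circ r) t (rcont_circ r t) (H t) eps (cond_pos eps)). apply filter_imp.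
    intros s Hs. change (Rabs (Cmod (g (circ r s)) - Cmod (g (circ r t))) < eps)%R.
    pose proof (Cmod_triangle_rev (g (circ r s)) (g (circ r t))).
    pose proof (Cmod_triangle_rev (g (circ r t)) (g (circ r s))). rewrite Cmod_minus_sym in H2.
    apply Rabs_def1; lra.
  - exists (Cmod (g (circ r t0))). exact Ht0.
Qed.

Lemma two_pi_i_neq_0 : RtoC (2 * PI) * Ci <> 0.
Proof.
  apply Cmult_neq_0; [| apply Ci_nz]. intros Z. apply RtoC_inj in Z. pose proof PI_RGT_0. lra.
Qed.

Lemma cd_quadratic (g : C -> C) (a d : C) (e K : R) : (0 < e)%R ->
  (forall h, (Cmod h <= e)%R -> (Cmod (g (a + h)%C - g a - h * d) <= K * (Cmod h * Cmod h))%R) -> cd g a d.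
Proof.
  intros He H. apply cd_eps. intros eps Heps.
  set (N := (Rabs K + 1)%R). assert (HN : (0 < N)%R) by (unfold N; pose proof (Rabs_pos K); lra).
  exists (Rmin e (eps / N)). split; [apply Rmin_glb_lt; auto; now apply Rdiv_lt_0_compat |].
  intros w Hw.
  assert (W1 : (Cmod (w - a) < e)%R) by (eapply Rlt_le_trans; [exact Hw | apply Rmin_l]).
  assert (W2 : (Cmod (w - a) < eps / N)%R) by (eapply Rlt_le_trans; [exact Hw | apply Rmin_r]).
  specialize (H (w - a) ltac:(lra)). replace (a + (w - a)) with w in H by ring.
  eapply Rle_trans; [exact H |]. rewrite <- Rmult_assoc. apply Rmult_le_compat_r; [apply Cmod_ge_0 |].
  pose proof (Cmod_ge_0 (w - a)).
  apply Rle_trans with (N * (eps / N))%R.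
  - apply Rle_trans with (N * Cmod (w - a))%R; [| apply Rmult_le_compat_l; lra].
    apply Rmult_le_compat_r; auto. unfold N. pose proof (Rle_abs K). lra.
  - right. field. lra.
Qed.

Lemma cd_Cauchy_int (r : R) (g : C -> C) (a : C) : (Cmod a < r)%R ->
  (forall t, ccont g (circ r t)) -> exists d, cd (Cauchy_int r g) a d.
Proof.
  intros Ha Hc. pose proof (Cmod_ge_0 a).
  destruct (circ_bounded r g Hc) as [M HM].
  destruct (Cauchy_int_taylor r (Cmod a) M g a ltac:(lra) Ha (Rle_refl _) Hc HM) as [d Hd].
  exists d. eapply cd_quadratic; [| exact Hd]. lra.
Qed.

(* Cauchy's formula holds off [p], and both of its sides are continuous at [p]. *)
Lemma removable (rho : R) (g : C -> C) (p : C) :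
  (forall z, disc rho z -> ccont g z) ->
  (forall z, disc rho z -> z <> p -> exists d, cd g z d) ->
  forall z, disc rho z -> exists d, cd g z d.
Proof.
  intros H K z Hz. destruct (Ceq_dec z p) as [-> | Hzp]; auto.
  unfold disc in Hz. pose proof (Cmod_ge_0 p) as Hp0.
  set (r := ((Cmod p + rho) / 2)%R). assert (Hr : (Cmod p < r < rho)%R) by (unfold r; lra).
  assert (Hc : forall t, ccont g (circ r t)).
  { intros t. apply H. unfold disc. rewrite Cmod_circ; lra. }
  set (J := fun a => Cauchy_int r g a / (RtoC (2 * PI) * Ci)).
  assert (HJ : forall a, disc r a -> a <> p -> J a = g a).
  { intros a Ha Hap. unfold J. rewrite (Cauchy_formula rho r g p a); auto; [| lra].
    field. split; [apply Ci_nz |]. intros Z. apply RtoC_inj in Z. pose proof PI_RGT_0. lra. }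
  destruct (cd_Cauchy_int r g p ltac:(lra) Hc) as [d Hd].
  assert (HdJ : cd J p (d / (RtoC (2 * PI) * Ci))).
  { unfold J, Cdiv. eapply cd_eq; [apply cd_mult; [exact Hd | apply cd_const] | cbv beta; ring]. }
  assert (EJ : J p = g p).
  { apply Ceq_minus, Cmod_eq_0. apply Rle_antisym; [| apply Cmod_ge_0]. apply Rnot_lt_le. intros He.
    set (e := Cmod (J p - g p)) in *.
    destruct (proj1 (ccont_iff J p) (cd_cont _ _ _ HdJ) (e / 2)%R ltac:(lra)) as (d1 & Hd1 & C1).
    destruct (proj1 (ccont_iff g p) (H p Hz) (e / 2)%R ltac:(lra)) as (d2 & Hd2 & C2).
    set (m := Rmin (Rmin d1 d2) (r - Cmod p)).
    assert (Hm : (0 < m)%R) by (repeat apply Rmin_glb_lt; lra).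
    assert (Hm1 : (m <= d1)%R) by (eapply Rle_trans; apply Rmin_l).
    assert (Hm2 : (m <= d2)%R) by (eapply Rle_trans; [apply Rmin_l | apply Rmin_r]).
    assert (Hm3 : (m <= r - Cmod p)%R) by apply Rmin_r.
    set (w := p + RtoC (m / 2)).
    assert (Ew : Cmod (w - p) = (m / 2)%R).
    { unfold w. replace (p + (m / 2)%R - p) with (RtoC (m / 2)) by ring. rewrite Cmod_R, Rabs_pos_eq; lra. }
    specialize (C1 w ltac:(lra)). specialize (C2 w ltac:(lra)).
    rewrite HJ in C1.
    - pose proof (Cmod_triangle_minus (g w - g p) (g w - J p)) as T.
      replace (g w - g p - (g w - J p)) with (J p - g p) in T by ring. fold e in T. lra.
    - unfold disc. pose proof (Cmod_triangle_rev w p). lra.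
    - intros Z. rewrite Z in Ew. replace (p - p) with (RtoC 0) in Ew by ring. rewrite Cmod_0 in Ew. lra. }
  eexists. eapply cd_ext_loc; [| exact HdJ].
  apply locally_C_iff. exists (r - Cmod p)%R. split; [lra |]. intros w Hw.
  destruct (Ceq_dec w p) as [-> | Hwp]; auto. apply HJ; auto.
  unfold disc. pose proof (Cmod_triangle_rev w p). lra.
Qed.

Definition hol (r : R) (g : C -> C) : Prop := forall z, disc r z -> exists d, cd g z d.

Lemma hol_cont (r : R) (g : C -> C) (z : C) : hol r g -> disc r z -> ccont g z.
Proof. intros H Hz. destruct (H z Hz) as [d Hd]. exact (cd_cont _ _ _ Hd). Qed.

Lemma Cauchy_hol (rho r : R) (g : C -> C) (a : C) : (r < rho)%R -> (Cmod a < r)%R -> hol rho g ->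
  Cauchy_int r g a = RtoC (2 * PI) * Ci * g a.
Proof.
  intros Hr Ha Hg. apply (Cauchy_formula rho r g (a + 1) a); auto.
  - intros E. assert (E1 : RtoC 1 = 0) by (replace (RtoC 1) with (a + 1 - a) by ring; rewrite <- E; ring).
    apply RtoC_inj in E1. lra.
  - intros z Hz. now apply (hol_cont rho).
Qed.

Lemma hol_taylor (rho r s M : R) (g : C -> C) (a : C) : (0 < r)%R -> (r < rho)%R -> (s < r)%R -> (Cmod a <= s)%R ->
  hol rho g -> (forall z, (Cmod z <= r)%R -> (Cmod (g z) <= M)%R) ->
  exists d, forall h, (Cmod h <= (r - s) / 2)%R ->
    (Cmod (g (a + h)%C - g a - h * d) <= 2 * r * M / (r - s) ^ 3 * (Cmod h * Cmod h))%R.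
Proof.
  intros Hr Hrho Hs Ha Hg HM.
  assert (Hc : forall t, ccont g (circ r t)).
  { intros t. apply (hol_cont rho); auto. unfold disc. rewrite Cmod_circ; lra. }
  destruct (Cauchy_int_taylor r s M g a Hr Hs Ha Hc) as [d Hd].
  { intros t _. apply HM. rewrite Cmod_circ; lra. }
  exists (d / (RtoC (2 * PI) * Ci)). intros h Hh. specialize (Hd h Hh).
  pose proof PI_RGT_0 as HPI.
  rewrite !(Cauchy_hol rho r) in Hd; auto; try lra.
  2:{ eapply Rle_lt_trans; [apply Cmod_triangle | lra]. }
  assert (N : RtoC (2 * PI) <> 0) by (intros Z; apply RtoC_inj in Z; lra).
  replace (g (a + h) - g a - h * (d / (RtoC (2 * PI) * Ci)))
    with ((RtoC (2 * PI) * Ci * g (a + h) - RtoC (2 * PI) * Ci * g a - h * d) / (RtoC (2 * PI) * Ci))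
    by (field; split; [apply Ci_nz | auto]).
  rewrite Cmod_div by apply two_pi_i_neq_0. rewrite Cmod_mult, Cmod_Ci, Cmod_R, Rabs_pos_eq, Rmult_1_r by lra.
  apply (Rmult_le_reg_r (2 * PI)); [lra |]. unfold Rdiv at 1. rewrite Rmult_assoc, Rinv_l by lra. lra.
Qed.

Lemma hol_pow (r : R) (g : C -> C) (n : nat) : hol r g -> hol r (fun z => g z ^ n).
Proof.
  intros H z Hz. destruct (H z Hz) as [d Hd]. induction n as [| n [e He]].
  - exists 0. exact (cd_const 1 z).
  - eexists. exact (cd_mult _ _ _ _ _ Hd He).
Qed.

(* Cauchy's formula for the powers of [g] bounds [|g a| / M] by the n-th root of a constant. *)
Lemma max_modulus (rho r M : R) (g : C -> C) (a : C) : (r < rho)%R -> (Cmod a < r)%R -> hol rho g ->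
  (forall z, Cmod z = r -> (Cmod (g z) <= M)%R) -> (Cmod (g a) <= M)%R.
Proof.
  intros Hr Ha Hg HM. pose proof (Cmod_ge_0 a) as Ha0. pose proof PI_RGT_0 as HPI.
  assert (HM0 : (0 <= M)%R).
  { eapply Rle_trans; [apply Cmod_ge_0 | apply (HM (RtoC r))]. rewrite Cmod_R. apply Rabs_pos_eq. lra. }
  assert (P : forall n, (Cmod (g a) ^ n <= M ^ n * (r / (r - Cmod a)))%R).
  { intros n. pose proof (hol_pow rho g n Hg) as Hn.
    assert (B := Cauchy_int_bound r (M ^ n) (fun z => g z ^ n) a Ha).
    rewrite (Cauchy_hol rho r _ a Hr Ha Hn), !Cmod_mult, Cmod_Ci, Cmod_R, Rabs_pos_eq, Cmod_pow in B by lra.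
    apply (Rmult_le_reg_l (2 * PI)); [lra |]. rewrite Rmult_1_r in B. apply B.
    - intros t. apply (hol_cont rho); auto. unfold disc. rewrite Cmod_circ; lra.
    - intros t _. rewrite Cmod_pow. apply pow_incr. split; [apply Cmod_ge_0 |]. apply HM, Cmod_circ. lra. }
  apply Rnot_lt_le. intros Hlt.
  set (x := Cmod (g a)) in *. set (K := (r / (r - Cmod a))%R) in *.
  set (m := ((M + x) / 2)%R). assert (Hm : (0 < m)%R) by (unfold m; lra).
  assert (Hx1 : (1 < x / m)%R).
  { apply (Rmult_lt_reg_r m); auto. unfold Rdiv. rewrite Rmult_assoc, Rinv_l by lra. unfold m. lra. }
  destruct (Pow_x_infinity (x / m) ltac:(rewrite Rabs_pos_eq; lra) (K + 1)%R) as [N HN].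
  specialize (HN N (Nat.le_refl N)). rewrite Rabs_pos_eq in HN by (apply pow_le; lra).
  specialize (P N).
  assert (HK : (0 < K)%R) by (unfold K; apply Rdiv_lt_0_compat; lra).
  assert (M ^ N <= m ^ N)%R by (apply pow_incr; unfold m; lra).
  assert (Hmn : (0 < m ^ N)%R) by now apply pow_lt.
  assert (E : (x ^ N = (x / m) ^ N * m ^ N)%R) by (rewrite <- Rpow_mult_distr; f_equal; field; lra).
  assert (M ^ N * K <= m ^ N * K)%R by (apply Rmult_le_compat_r; lra).
  assert ((K + 1) * m ^ N <= (x / m) ^ N * m ^ N)%R by (apply Rmult_le_compat_r; lra).
  nra.
Qed.

(** * Schwarz-Pick inequalities *)

(** The slope at [a] is differentiable off [a] and continuous at [a], so the singularity is
    removable. This is the division of [g - g a] by [w - a] among holomorphic functions. *)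
Lemma slope_hol (rho : R) (g : C -> C) (a : C) : hol rho g -> disc rho a ->
  exists s, hol rho s /\ forall w, g w = g a + (w - a) * s w.
Proof.
  intros Hg Ha. destruct (Hg a Ha) as [d Hd]. apply cd_slope in Hd. destruct Hd as (s & Hs & E).
  exists s. split; [| exact E].
  assert (K : forall z, disc rho z -> z <> a -> exists d, cd s z d).
  { intros z Hz Hza. destruct (Hg z Hz) as [e He]. eexists.
    apply (cd_ext_loc (fun w => (g w - g a) / (w - a))).
    - apply locally_C_iff. exists (Cmod (z - a)). split; [apply Cmod_gt_0, Cminus_eq_contra; auto |].
      intros w Hw. rewrite (E w). field. apply Cminus_eq_contra. intros ->.
      rewrite Cmod_minus_sym in Hw. lra.
    - apply cd_div; [apply cd_minus; [exact He | apply cd_const] | apply cd_minus; [apply cd_id | apply cd_const] |].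
      now apply Cminus_eq_contra. }
  unfold hol. apply (removable rho s a); auto. intros z Hz.
  destruct (Ceq_dec z a) as [-> | Hza]; [| destruct (K z Hz Hza) as [e He]; exact (cd_cont _ _ _ He)].
  (* The neighbourhoods in [ulim] contain [a] itself, so the limit of [s] at [a] is its value
     there. *)
  assert (Ea : s a = d).
  { apply Ceq_minus, Cmod_eq_0. apply Rle_antisym; [| apply Cmod_ge_0]. apply Rnot_lt_le. intros He.
    pose proof (locally_singleton a _ (Hs _ He)) as L. simpl in L. lra. }
  unfold ccont. now rewrite Ea.
Qed.

(** Schwarz's lemma: on the circle of radius [r] the quotient is at most [/ r], by the maximum
    principle also inside, and [r] may be taken arbitrarily close to 1. *)
Lemma schwarz_quotient (g : C -> C) : hol 1 g -> (forall z, disc 1 z -> (Cmod (g z) <= 1)%R) -> g 0 = 0 ->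
  exists om, hol 1 om /\ (forall z, g z = z * om z) /\ (forall z, disc 1 z -> (Cmod (om z) <= 1)%R).
Proof.
  intros Hg H1 H0. destruct (slope_hol 1 g 0 Hg) as (s & Hs & E).
  { unfold disc. rewrite Cmod_0. lra. }
  assert (E' : forall z, g z = z * s z) by (intros z; rewrite (E z), H0; ring).
  exists s. split; [exact Hs |]. split; [exact E' |].
  intros z Hz. unfold disc in Hz. pose proof (Cmod_ge_0 z).
  assert (K : forall r, (Cmod z < r < 1)%R -> (Cmod (s z) <= / r)%R).
  { intros r Hr. apply (max_modulus 1 r (/ r) s z); auto; try lra.
    intros w Hw. assert (Hw1 : disc 1 w) by (unfold disc; lra).
    specialize (H1 w Hw1). rewrite E', Cmod_mult, Hw in H1.
    apply (Rmult_le_reg_l r); [lra |]. rewrite Rinv_r by lra. exact H1. }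
  apply Rnot_lt_le. intros Hlt. set (x := Cmod (s z)) in *.
  set (r := Rmax ((1 + Cmod z) / 2) ((1 + / x) / 2)).
  assert (Hx : (/ x < 1)%R) by (rewrite <- Rinv_1; apply Rinv_lt_contravar; lra).
  assert (Hx0 : (0 < / x)%R) by (apply Rinv_0_lt_compat; lra).
  assert (Hr : (Cmod z < r < 1)%R).
  { split; [eapply Rlt_le_trans; [| apply Rmax_l]; lra |]. apply Rmax_lub_lt; lra. }
  assert (Hrx : (/ x < r)%R) by (eapply Rlt_le_trans; [| apply Rmax_r]; lra).
  specialize (K r Hr). fold x in K.
  assert (/ r < / / x)%R by (apply Rinv_lt_contravar; [apply Rmult_lt_0_compat; lra | exact Hrx]).
  rewrite Rinv_inv in H2. lra.
Qed.

Lemma pseudo_hyperbolic (a b : C) :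
  (Cmod (1 - Cconj b * a) * Cmod (1 - Cconj b * a) - Cmod (a - b) * Cmod (a - b)
   = (1 - Cmod a * Cmod a) * (1 - Cmod b * Cmod b))%R.
Proof. rewrite !Cmod_sqr. destruct a, b. simpl. ring. Qed.

Lemma Cmod_conj_mult_lt (a b : C) : (Cmod a <= 1)%R -> (Cmod b < 1)%R -> 1 - Cconj b * a <> 0.
Proof.
  intros Ha Hb. apply Cminus_neq_0_of_mod. rewrite Cmod_1, Cmod_mult, Cmod_conj.
  pose proof (Cmod_ge_0 a). pose proof (Cmod_ge_0 b). nra.
Qed.

Lemma mobius_disc (w z : C) : disc 1 w -> disc 1 z -> disc 1 ((z - w) / (1 - Cconj w * z)).
Proof.
  unfold disc. intros Hw Hz. assert (N := Cmod_conj_mult_lt z w (Rlt_le _ _ Hz) Hw).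
  rewrite Cmod_div by exact N. pose proof (pseudo_hyperbolic z w) as P.
  pose proof (Cmod_ge_0 (z - w)). pose proof (Cmod_ge_0 z). pose proof (Cmod_ge_0 w).
  assert (0 < Cmod (1 - Cconj w * z))%R by now apply Cmod_gt_0.
  apply (Rmult_lt_reg_r (Cmod (1 - Cconj w * z))); auto.
  unfold Rdiv. rewrite Rmult_assoc, Rinv_l by lra.
  assert (0 < (1 - Cmod z * Cmod z) * (1 - Cmod w * Cmod w))%R by (apply Rmult_lt_0_compat; nra).
  nra.
Qed.

(** Schwarz's lemma applied after moving [w] and [g w] to 0 by automorphisms of the disc, with
    denominators cleared. The strict bound keeps the denominators away from 0. *)
Lemma schwarz_pick_lt (g : C -> C) : hol 1 g -> (forall z, disc 1 z -> (Cmod (g z) < 1)%R) ->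
  forall z w, disc 1 z -> disc 1 w ->
  (Cmod (g z - g w) * Cmod (1 - Cconj w * z) <= Cmod (z - w) * Cmod (1 - Cconj (g w) * g z))%R.
Proof.
  intros Hg H1 z w Hz Hw.
  set (phi := fun u => (u - - w) / (1 - Cconj (- w) * u)).
  assert (Hw' : disc 1 (- w)) by (unfold disc; now rewrite Cmod_opp).
  assert (Hphi : forall u, disc 1 u -> disc 1 (phi u)) by (intros; now apply mobius_disc).
  set (k := fun u => (g (phi u) - g w) / (1 - Cconj (g w) * g (phi u))).
  destruct (schwarz_quotient k) as (om & _ & E & B).
  - intros u Hu. destruct (Hg (phi u) (Hphi u Hu)) as [d Hd].
    assert (Np : 1 - Cconj (- w) * u <> 0) by (apply Cmod_conj_mult_lt; [apply Rlt_le |]; auto).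
    assert (exists e, cd phi u e) as [e He].
    { eexists. apply cd_div; [apply cd_minus; [apply cd_id | apply cd_const] | | exact Np].
      apply cd_minus; [apply cd_const |]. apply cd_mult; [apply cd_const | apply cd_id]. }
    pose proof (cd_comp g phi u _ _ Hd He) as Hc.
    eexists. apply cd_div; [apply cd_minus; [exact Hc | apply cd_const] | |].
    + apply cd_minus; [apply cd_const |]. apply cd_mult; [apply cd_const | exact Hc].
    + apply Cmod_conj_mult_lt; [apply Rlt_le |]; auto.
  - intros u Hu. apply Rlt_le. apply (mobius_disc (g w) (g (phi u))); apply H1; auto.
  - unfold k, phi. replace ((0 - - w) / (1 - Cconj (- w) * 0)) with w.
    2:{ rewrite Cmult_0_r. field. }
    unfold Cdiv. replace (g w - g w) with (RtoC 0) by ring. ring.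
  - set (u := (z - w) / (1 - Cconj w * z)).
    assert (Nz : 1 - Cconj w * z <> 0) by (apply Cmod_conj_mult_lt; [apply Rlt_le |]; auto).
    assert (Nw : 1 - Cconj w * w <> 0) by (apply Cmod_conj_mult_lt; [apply Rlt_le |]; auto).
    assert (Hu : disc 1 u) by now apply mobius_disc.
    assert (Ep : phi u = z).
    { unfold phi, u. rewrite Copp_conj. field. split; auto.
      replace (1 - Cconj w * z - - Cconj w * (z - w)) with (1 - Cconj w * w) by ring. auto. }
    assert (K : (Cmod (k u) <= Cmod u)%R).
    { rewrite E, Cmod_mult. specialize (B u Hu). pose proof (Cmod_ge_0 u). nra. }
    unfold k in K. rewrite Ep in K. unfold u in K.
    assert (Ng : 1 - Cconj (g w) * g z <> 0) by (apply Cmod_conj_mult_lt; [apply Rlt_le |]; auto).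
    rewrite !Cmod_div in K by auto.
    apply Cmod_gt_0 in Nz. apply Cmod_gt_0 in Ng.
    apply (Rmult_le_compat_r (Cmod (1 - Cconj w * z) * Cmod (1 - Cconj (g w) * g z))) in K; [| nra].
    replace (Cmod (g z - g w) / Cmod (1 - Cconj (g w) * g z) * (Cmod (1 - Cconj w * z) * Cmod (1 - Cconj (g w) * g z)))%R
      with (Cmod (g z - g w) * Cmod (1 - Cconj w * z))%R in K by (field; lra).
    replace (Cmod (z - w) / Cmod (1 - Cconj w * z) * (Cmod (1 - Cconj w * z) * Cmod (1 - Cconj (g w) * g z)))%R
      with (Cmod (z - w) * Cmod (1 - Cconj (g w) * g z))%R in K by (field; lra).
    exact K.
Qed.

Lemma schwarz_pick (g : C -> C) : hol 1 g -> (forall z, disc 1 z -> (Cmod (g z) <= 1)%R) ->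
  forall z w, disc 1 z -> disc 1 w ->
  (Cmod (g z - g w) * Cmod (1 - Cconj w * z) <= Cmod (z - w) * Cmod (1 - Cconj (g w) * g z))%R.
Proof.
  intros Hg H1 z w Hz Hw.
  set (A := (Cmod (g z - g w) * Cmod (1 - Cconj w * z))%R).
  set (B := (Cmod (z - w) * Cmod (1 - Cconj (g w) * g z))%R).
  assert (HA : (0 <= A)%R) by (apply Rmult_le_pos; apply Cmod_ge_0).
  set (D := Cmod (z - w)). assert (HD : (0 <= D)%R) by apply Cmod_ge_0.
  assert (K : forall s, (0 < s < 1)%R -> (s * A <= B + D * (1 - s * s))%R).
  { intros s Hs. assert (S := schwarz_pick_lt (fun u => RtoC s * g u)). cbv beta in S.
    assert (S1 : hol 1 (fun u => RtoC s * g u)).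
    { intros u Hu. destruct (Hg u Hu) as [d Hd]. eexists. apply cd_mult; [apply cd_const | exact Hd]. }
    specialize (S S1). specialize (S ltac:(intros u Hu; specialize (H1 u Hu); pose proof (Cmod_ge_0 (g u));
      rewrite Cmod_mult, Cmod_R, Rabs_pos_eq by lra; nra) z w Hz Hw).
    replace (s * g z - s * g w) with (RtoC s * (g z - g w)) in S by ring.
    rewrite (Cmod_mult (RtoC s)), Cmod_R, Rabs_pos_eq in S by lra.
    apply Rle_trans with (D * Cmod (1 - Cconj (s * g w) * (s * g z)))%R.
    { unfold A, D. rewrite <- Rmult_assoc. exact S. }
    unfold B. fold D. rewrite <- Rmult_plus_distr_l. apply Rmult_le_compat_l; auto.
    replace (1 - Cconj (s * g w) * (s * g z))
      with ((1 - Cconj (g w) * g z) + RtoC (1 - s * s) * (Cconj (g w) * g z)).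
    2:{ rewrite Cmult_conj, RtoC_minus, RtoC_mult. replace (Cconj s) with (RtoC s).
        - ring.
        - apply C_ext; simpl; ring. }
    eapply Rle_trans; [apply Cmod_triangle |]. rewrite (Cmod_mult (RtoC (1 - s * s))), Cmod_R, Rabs_pos_eq by nra.
    assert (Cmod (Cconj (g w) * g z) <= 1)%R.
    { rewrite Cmod_mult, Cmod_conj. pose proof (H1 z Hz). pose proof (H1 w Hw).
      pose proof (Cmod_ge_0 (g z)). pose proof (Cmod_ge_0 (g w)). nra. }
    assert (0 <= 1 - s * s)%R by nra. apply Rplus_le_compat_l.
    rewrite <- (Rmult_1_r (1 - s * s)) at 2. apply Rmult_le_compat_l; auto. }
  apply Rnot_lt_le. intros Hlt.
  set (t := ((A - B) / (2 * (A + 2 * D + 1)))%R).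
  assert (HB : (0 <= B)%R) by (apply Rmult_le_pos; apply Cmod_ge_0).
  assert (Ht0 : (0 < t)%R) by (apply Rdiv_lt_0_compat; lra).
  assert (Et : (t * (2 * (A + 2 * D + 1)) = A - B)%R) by (unfold t; field; lra).
  assert (Ht1 : (t < 1)%R) by nra.
  specialize (K (1 - t)%R ltac:(lra)).
  assert (D * (1 - (1 - t) * (1 - t)) <= D * (2 * t))%R by (apply Rmult_le_compat_l; nra).
  nra.
Qed.

Lemma re_lt_neq (g : C) : (0 <= Re g)%R -> g + 1 <> 0.
Proof. intros H E. apply (f_equal Re) in E. rewrite re_plus, !re_RtoC in E. lra. Qed.

(** [schwarz_pick] for the Cayley transform [(g - 1) / (g + 1)]; the factor
    [2 / (|g z + 1| |g w + 1|)] is common to both sides. *)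
Lemma pick_half_plane (g : C -> C) : hol 1 g -> (forall z, disc 1 z -> (0 <= Re (g z))%R) ->
  forall z w, disc 1 z -> disc 1 w ->
  (Cmod (g z - g w) * Cmod (1 - Cconj w * z) <= Cmod (z - w) * Cmod (g z + Cconj (g w)))%R.
Proof.
  intros Hg H z w Hz Hw.
  assert (N : forall u, disc 1 u -> g u + 1 <> 0) by (intros; apply re_lt_neq; auto).
  assert (S := schwarz_pick (fun u => (g u - 1) / (g u + 1))). cbv beta in S.
  assert (S1 : hol 1 (fun u => (g u - 1) / (g u + 1))).
  { intros u Hu. destruct (Hg u Hu) as [d Hd]. eexists.
    apply cd_div; [apply cd_minus; [exact Hd | apply cd_const] | apply cd_plus; [exact Hd | apply cd_const] | auto]. }
  assert (S2 : forall u, disc 1 u -> (Cmod ((g u - 1) / (g u + 1)) <= 1)%R).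
  { intros u Hu. rewrite Cmod_div by auto. pose proof (proj1 (Cmod_gt_0 _) (N u Hu)).
    apply (Rmult_le_reg_r (Cmod (g u + 1))); auto. unfold Rdiv. rewrite Rmult_assoc, Rinv_l, Rmult_1_l, Rmult_1_r by lra.
    apply Cmod_le_sqr. rewrite !Cmod_sqr. specialize (H u Hu). destruct (g u). simpl in *. nra. }
  specialize (S S1 S2 z w Hz Hw).
  assert (Nz := N z Hz). assert (Nw := N w Hw).
  assert (Nc : Cconj (g w) + 1 <> 0).
  { apply re_lt_neq. rewrite re_conj. auto. }
  replace ((g z - 1) / (g z + 1) - (g w - 1) / (g w + 1))
    with (2 * (g z - g w) / ((g z + 1) * (g w + 1))) in S by (field; auto).
  replace (1 - Cconj ((g w - 1) / (g w + 1)) * ((g z - 1) / (g z + 1)))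
    with (2 * (g z + Cconj (g w)) / ((g z + 1) * (Cconj (g w) + 1))) in S.
  2:{ rewrite Cdiv_conj, Cminus_conj, Cplus_conj by auto.
      replace (Cconj 1) with (RtoC 1) by (apply C_ext; simpl; ring). field. auto. }
  rewrite !Cmod_div, !Cmod_mult in S by (try apply Cmult_neq_0; auto).
  replace (Cmod (Cconj (g w) + 1)) with (Cmod (g w + 1)) in S.
  2:{ rewrite <- Cmod_conj, Cplus_conj. do 2 f_equal. apply C_ext; simpl; ring. }
  apply Cmod_gt_0 in Nz. apply Cmod_gt_0 in Nw.
  rewrite Cmod_R, Rabs_pos_eq in S by lra.
  apply (Rmult_le_reg_l (2 / (Cmod (g z + 1) * Cmod (g w + 1)))).
  - apply Rdiv_lt_0_compat; nra.
  - match goal with |- (?a <= ?b)%R => match type of S with (?c <= ?d)%R =>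
      replace a with c by (field; lra); replace b with d by (field; lra) end end. exact S.
Qed.

(** The case [w = 0] of [pick_half_plane]. It will bound a function and its reciprocal on compact
    sets at once, since both have nonnegative real part. *)
Lemma harnack_bound (g : C -> C) (z : C) : hol 1 g -> (forall z, disc 1 z -> (0 <= Re (g z))%R) ->
  disc 1 z -> (Cmod (g z) * (1 - Cmod z) <= 2 * Cmod (g 0))%R.
Proof.
  intros Hg H Hz. assert (D0 : disc 1 0) by (unfold disc; rewrite Cmod_0; lra).
  pose proof (pick_half_plane g Hg H z 0 Hz D0) as P.
  replace (1 - Cconj 0 * z) with (RtoC 1) in P by (apply C_ext; simpl; ring).
  replace (z - 0) with z in P by ring. rewrite Cmod_1, Rmult_1_r in P.
  pose proof (Cmod_triangle (g z) (Cconj (g 0))) as T. rewrite Cmod_conj in T.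
  pose proof (Cmod_triangle_rev (g z) (g 0)). pose proof (Cmod_ge_0 z). unfold disc in Hz.
  pose proof (Cmod_ge_0 (g 0)).
  assert (Cmod z * Cmod (g z + Cconj (g 0)) <= Cmod z * (Cmod (g z) + Cmod (g 0)))%R by (apply Rmult_le_compat_l; auto).
  nra.
Qed.

Lemma harnack_lip (g : C -> C) (r : R) : (0 <= r < 1)%R -> hol 1 g -> (forall z, disc 1 z -> (0 <= Re (g z))%R) ->
  forall z w, (Cmod z <= r)%R -> (Cmod w <= r)%R ->
  (Cmod (g z - g w) <= 4 * Cmod (g 0) / ((1 - r) * (1 - r)) * Cmod (z - w))%R.
Proof.
  intros Hr Hg H z w Hz Hw.
  assert (Dz : disc 1 z) by (unfold disc; lra). assert (Dw : disc 1 w) by (unfold disc; lra).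
  pose proof (pick_half_plane g Hg H z w Dz Dw) as P.
  pose proof (harnack_bound g z Hg H Dz) as Bz. pose proof (harnack_bound g w Hg H Dw) as Bw.
  pose proof (Cmod_ge_0 (g z)). pose proof (Cmod_ge_0 (g w)). pose proof (Cmod_ge_0 (z - w)).
  pose proof (Cmod_ge_0 z). pose proof (Cmod_ge_0 w).
  pose proof (Cmod_triangle (g z) (Cconj (g w))) as T. rewrite Cmod_conj in T.
  assert (L : (1 - r <= Cmod (1 - Cconj w * z))%R).
  { pose proof (Cmod_triangle_rev 1 (Cconj w * z)) as Q. rewrite Cmod_1, Cmod_mult, Cmod_conj in Q. nra. }
  assert (S : ((Cmod (g z) + Cmod (g w)) * (1 - r) <= 4 * Cmod (g 0))%R) by nra.
  pose proof (Cmod_ge_0 (g z - g w)).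
  apply (Rmult_le_reg_r ((1 - r) * (1 - r))); [nra |].
  replace (4 * Cmod (g 0) / ((1 - r) * (1 - r)) * Cmod (z - w) * ((1 - r) * (1 - r)))%R
    with (Cmod (z - w) * (4 * Cmod (g 0)))%R by (field; lra).
  apply Rle_trans with (Cmod (z - w) * (Cmod (g z) + Cmod (g w)) * (1 - r))%R.
  - rewrite <- Rmult_assoc. apply Rmult_le_compat_r; [lra |].
    apply Rle_trans with (Cmod (g z - g w) * Cmod (1 - Cconj w * z))%R; [apply Rmult_le_compat_l; auto |].
    eapply Rle_trans; [exact P |]. apply Rmult_le_compat_l; auto.
  - rewrite Rmult_assoc. apply Rmult_le_compat_l; auto.
Qed.

(** * Infinitesimal generators *)

Lemma ulim_norm_le {T : Type} (Fl : (T -> Prop) -> Prop) {PF : ProperFilter Fl} (g : T -> C) (l : C) (M : R) :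
  ulim Fl g (fun _ => l) -> Fl (fun x => (Cmod (g x) <= M)%R) -> (Cmod l <= M)%R.
Proof.
  intros H K. apply Rnot_lt_le. intros Hlt.
  assert (He : (0 < Cmod l - M)%R) by lra.
  destruct (filter_ex _ (filter_and _ _ (H _ He) K)) as (x & H1 & H2).
  pose proof (Cmod_triangle_rev l (g x)). rewrite Cmod_minus_sym in H0. lra.
Qed.

(** Only pointwise convergence and a local bound are assumed. By the bound, difference quotients of
    step [h] approximate the derivatives up to [K * h] uniformly in [t]; for fixed [h] they
    converge. So the derivatives at [a] form a Cauchy filter, and the quadratic estimate passes to
    the limit. *)
Lemma hol_limit {T : Type} (Fl : (T -> Prop) -> Prop) {PF : ProperFilter Fl} (g : T -> C -> C) (f : C -> C) (rho : R) :
  (forall r, (0 < r < rho)%R -> exists M, Fl (fun t => hol rho (g t) /\ forall z, (Cmod z <= r)%R -> (Cmod (g t z) <= M)%R)) ->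
  (forall z, disc rho z -> ulim Fl (fun t => g t z) (fun _ => f z)) -> hol rho f.
Proof.
  intros HM Hlim a Ha. unfold disc in Ha. pose proof (Cmod_ge_0 a) as Ha0.
  set (s := Cmod a). set (r := ((s + rho) / 2)%R). assert (Hr : (s < r < rho)%R) by (unfold r, s; lra).
  destruct (HM r ltac:(unfold s in *; lra)) as [M HB].
  set (D := fun t => C_derive (g t) a).
  set (K := (2 * r * M / (r - s) ^ 3)%R). set (e := ((r - s) / 2)%R).
  assert (He : (0 < e)%R) by (unfold e; lra).
  assert (HT : Fl (fun t => forall h, (Cmod h <= e)%R ->
     (Cmod (g t (a + h)%C - g t a - h * D t) <= K * (Cmod h * Cmod h))%R)).
  { revert HB. apply filter_imp. intros t [Ht1 Ht2].
    destruct (hol_taylor rho r s M (g t) a) as [d Hd]; auto; try (unfold s in *; lra).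
    assert (E : D t = d).
    { apply is_C_derive_unique. apply (cd_quadratic (g t) a d e K); auto. }
    rewrite E. exact Hd. }
  assert (HK : (0 <= K)%R).
  { destruct (filter_ex _ HT) as [t Ht]. specialize (Ht (RtoC e)).
    rewrite Cmod_R, Rabs_pos_eq in Ht by lra. specialize (Ht (Rle_refl _)).
    pose proof (Cmod_ge_0 (g t (a + e) - g t a - e * D t)).
    apply (Rmult_le_reg_r (e * e)); [nra | lra]. }
  assert (Hd1 : forall h, (Cmod h <= e)%R -> disc rho (a + h)).
  { intros h Hh. unfold disc. eapply Rle_lt_trans; [apply Cmod_triangle |]. unfold e, s in *. lra. }
  destruct (proj1 (filterlim_locally_cauchy (U := C_R_CompleteNormedModule) (F := Fl) D)) as [d Hd].
  (* Two remainders of size [eps * h / 8] and four convergence errors below [eps * h / 8] stay under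
     [eps * h]. *)
  - intros eps. set (h := Rmin e (eps / (8 * (K + 1)))).
    assert (Heps := cond_pos eps).
    assert (Hh : (0 < h)%R) by (apply Rmin_glb_lt; auto; apply Rdiv_lt_0_compat; lra).
    assert (Hhe : (h <= e)%R) by apply Rmin_l.
    assert (Hh2 : (K * h <= eps / 8)%R).
    { assert (h <= eps / (8 * (K + 1)))%R by apply Rmin_r.
      apply Rle_trans with ((K + 1) * (eps / (8 * (K + 1))))%R; [apply Rmult_le_compat; lra |].
      right. field. lra. }
    assert (Hch : Cmod (RtoC h) = h) by (rewrite Cmod_R; apply Rabs_pos_eq; lra).
    assert (He8 : (0 < eps * h / 8)%R) by nra.
    assert (L1 := Hlim (a + RtoC h) (Hd1 (RtoC h) ltac:(lra)) _ He8).
    assert (L2 := Hlim a Ha _ He8).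
    eexists. split; [exact (filter_and _ _ HT (filter_and _ _ L1 L2)) |].
    intros u v (Tu & Lu1 & Lu2) (Tv & Lv1 & Lv2). apply C_NormedModule_mixin_compat1.
    change (Cmod (D v - D u) < eps)%R.
    specialize (Tu h ltac:(lra)). specialize (Tv h ltac:(lra)). rewrite Hch in Tu, Tv.
    apply (Rmult_lt_reg_l h); auto. rewrite <- Hch at 1. rewrite <- Cmod_mult.
    replace (RtoC h * (D v - D u)) with
      ((g u (a + h) - g u a - h * D u) - (g v (a + h) - g v a - h * D v)
       + ((g v (a + h) - f (a + h)) - (g u (a + h) - f (a + h))) - ((g v a - f a) - (g u a - f a))) by ring.
    eapply Rle_lt_trans; [apply Cmod_triangle_minus |].
    eapply Rle_lt_trans; [apply Rplus_le_compat; [apply Cmod_triangle | apply Cmod_triangle_minus] |].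
    eapply Rle_lt_trans; [apply Rplus_le_compat_r; apply Rplus_le_compat; apply Cmod_triangle_minus |].
    assert (K * (h * h) <= eps / 8 * h)%R by nra. lra.
  - exists d. apply (cd_quadratic f a d e K); auto. intros h Hh.
    apply (ulim_norm_le Fl (fun t => g t (a + h) - g t a - h * D t)).
    + assert (Q : ulim Fl D (fun _ => d)) by (apply (proj1 (C_cvg_ulim Fl D d)); exact Hd).
      pose proof (Hlim _ (Hd1 h Hh)). pose proof (Hlim a Ha). ulim_tac.
    + revert HT. apply filter_imp. auto.
Qed.

(* Dividing by [z] the map [(F - F 0) / (1 - conj (F 0) F)] gives a self-map of the closed disk;
   Schwarz-Pick between [z] and [1/2] shows that it stays close to 1 if it is close to 1 at [1/2]. *)
Lemma self_map_displacement (F : C -> C) (r : R) (z : C) : (r < 1)%R ->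
  hol 1 F -> (forall z, disc 1 z -> disc 1 (F z)) -> (Cmod (F 0) <= 1 / 2)%R -> (Cmod z <= r)%R ->
  (Cmod (z - F z) <= 80 * (Cmod (F 0) + Cmod (RtoC (1 / 2) - F (RtoC (1 / 2)))) / (1 - r))%R.
Proof.
  intros Hr HF H1 Hs Hz.
  assert (D0 : disc 1 0) by (unfold disc; rewrite Cmod_0; lra).
  set (w := RtoC (1 / 2)). assert (Ew : Cmod w = (1 / 2)%R) by (unfold w; rewrite Cmod_R; apply Rabs_pos_eq; lra).
  assert (Dw : disc 1 w) by (unfold disc; lra). assert (Dz : disc 1 z) by (unfold disc; lra).
  set (a := F 0) in *.
  assert (N : forall u, disc 1 u -> 1 - Cconj a * F u <> 0).
  { intros u Hu. apply Cmod_conj_mult_lt; [apply Rlt_le, H1; auto | lra]. }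
  destruct (schwarz_quotient (fun u => (F u - a) / (1 - Cconj a * F u))) as (om & Hom & Eom & Bom).
  - intros u Hu. destruct (HF u Hu) as [d Hd]. eexists.
    apply cd_div; [apply cd_minus; [exact Hd | apply cd_const] | | now apply N].
    apply cd_minus; [apply cd_const |]. apply cd_mult; [apply cd_const | exact Hd].
  - intros u Hu. apply Rlt_le. apply mobius_disc; [| now apply H1]. unfold disc. lra.
  - fold a. unfold Cdiv. replace (a - a) with (RtoC 0) by ring. ring.
  - assert (E : forall u, disc 1 u -> F u - a = u * om u * (1 - Cconj a * F u)).
    { intros u Hu. rewrite <- Eom. field. now apply N. }
    set (e0 := Cmod a) in *. set (e1 := Cmod (w - F w)).
    assert (He0 : (0 <= e0)%R) by apply Cmod_ge_0. assert (He1 : (0 <= e1)%R) by apply Cmod_ge_0.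
    assert (HFw := H1 w Dw). unfold disc in HFw. pose proof (Cmod_ge_0 (F w)) as HFw0.
    (* At [w = 1 / 2] the factor [1 - om w] is determined by [w - F w] and [a]: the numerator is at
       most [2 * (e1 + 3 / 2 * e0)] and the denominator at least [1 / 2]. *)
    assert (Hd : (Cmod (1 - om w) <= 4 * e1 + 6 * e0)%R).
    { assert (X : (1 - om w) * (1 - Cconj a * F w) = 2 * ((w - F w) + (a - w * (Cconj a * F w)))).
      { transitivity (1 - Cconj a * F w - 2 * (w * om w * (1 - Cconj a * F w))).
        - unfold w. rewrite RtoC_div by lra. field.
        - rewrite <- (E w Dw). unfold w. rewrite RtoC_div by lra. field. }
      apply (f_equal Cmod) in X. rewrite !Cmod_mult, Cmod_R, Rabs_pos_eq in X by lra.
      assert (L : (1 / 2 <= Cmod (1 - Cconj a * F w))%R).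
      { pose proof (Cmod_triangle_rev 1 (Cconj a * F w)) as Q. rewrite Cmod_1, Cmod_mult, Cmod_conj in Q.
        fold e0 in Q. nra. }
      assert (U : (Cmod (w - F w + (a - w * (Cconj a * F w))) <= e1 + 3 / 2 * e0)%R).
      { eapply Rle_trans; [apply Cmod_triangle |]. fold e1.
        eapply Rle_trans; [apply Rplus_le_compat_l, Cmod_triangle_minus |].
        rewrite !Cmod_mult, Cmod_conj, Ew. fold e0. nra. }
      pose proof (Cmod_ge_0 (1 - om w)). nra. }
    set (de := (4 * e1 + 6 * e0)%R) in *.
    set (x := Cmod (1 - om z)).
    (* Schwarz-Pick for [om] gives [(x - de) * u <= v * (x + de)], that is
       [x * (u - v) <= de * (u + v)]. The gap [u - v] is at least [(1 - r) / 4] because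
       [|z| <= r]. *)
    assert (Hx : (x * (1 - r) <= 12 * de)%R).
    { assert (P := schwarz_pick om Hom Bom z w Dz Dw).
      assert (Q1 : (Cmod (1 - Cconj (om w) * om z) <= x + de)%R).
      { replace (1 - Cconj (om w) * om z) with ((1 - om z) + Cconj (1 - om w) * om z).
        2:{ rewrite Cminus_conj. replace (Cconj 1) with (RtoC 1) by (apply C_ext; simpl; ring). ring. }
        eapply Rle_trans; [apply Cmod_triangle |]. fold x. rewrite Cmod_mult, Cmod_conj.
        pose proof (Bom z Dz). pose proof (Cmod_ge_0 (1 - om w)). pose proof (Cmod_ge_0 (om z)). nra. }
      assert (Q2 : (x - de <= Cmod (om z - om w))%R).
      { pose proof (Cmod_triangle_rev (1 - om z) (1 - om w)) as T.
        replace (1 - om z - (1 - om w)) with (- (om z - om w)) in T by ring. rewrite Cmod_opp in T. fold x in T. lra. }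
      pose proof (pseudo_hyperbolic z w) as PH. rewrite Ew in PH.
      set (u := Cmod (1 - Cconj w * z)) in *. set (v := Cmod (z - w)) in *.
      assert (Hu : (1 / 2 <= u <= 3 / 2)%R).
      { unfold u. split.
        - pose proof (Cmod_triangle_rev 1 (Cconj w * z)) as Q. rewrite Cmod_1, Cmod_mult, Cmod_conj, Ew in Q. lra.
        - pose proof (Cmod_triangle_minus 1 (Cconj w * z)) as Q. rewrite Cmod_1, Cmod_mult, Cmod_conj, Ew in Q. lra. }
      assert (Hv : (0 <= v)%R) by apply Cmod_ge_0. pose proof (Cmod_ge_0 z) as Hz0.
      assert (Hzz : (1 - r <= 1 - Cmod z * Cmod z)%R) by nra.
      assert (Huv : ((1 - r) / 4 <= u - v)%R).
      { assert ((u - v) * (u + v) = (1 - Cmod z * Cmod z) * (3 / 4))%R by nra.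
        assert (u + v <= 3)%R by nra.
        assert (0 < u - v)%R by nra. nra. }
      pose proof (Cmod_ge_0 (om z - om w)). assert (0 <= x)%R by apply Cmod_ge_0.
      assert (0 <= de)%R by (unfold de; lra).
      assert ((x - de) * u <= v * (x + de))%R.
      { apply Rle_trans with (Cmod (om z - om w) * u)%R; [apply Rmult_le_compat_r; lra |].
        eapply Rle_trans; [exact P |]. apply Rmult_le_compat_l; auto. }
      assert (x * (u - v) <= de * (u + v))%R by lra.
      assert (v <= u)%R by lra. assert (u + v <= 3)%R by lra.
      assert (de * (u + v) <= de * 3)%R by (apply Rmult_le_compat_l; auto).
      assert (x * ((1 - r) / 4) <= x * (u - v))%R by (apply Rmult_le_compat_l; auto). lra. }
    assert (Hfin : (Cmod (z - F z) <= x + 2 * e0)%R).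
    { replace (z - F z) with (z * (1 - om z) - (a - z * om z * (Cconj a * F z))).
      2:{ transitivity (z - a - z * om z * (1 - Cconj a * F z)); [ring |]. rewrite <- E by auto. ring. }
      eapply Rle_trans; [apply Cmod_triangle_minus |].
      eapply Rle_trans; [apply Rplus_le_compat_l, Cmod_triangle_minus |].
      rewrite !Cmod_mult, Cmod_conj. fold x e0.
      assert (HFz := H1 z Dz). unfold disc in HFz, Dz. assert (Bz := Bom z Dz).
      pose proof (Cmod_ge_0 (F z)). pose proof (Cmod_ge_0 z). pose proof (Cmod_ge_0 (om z)).
      assert (0 <= x)%R by apply Cmod_ge_0.
      assert (Cmod z * x <= 1 * x)%R by (apply Rmult_le_compat_r; lra).
      assert (Cmod z * Cmod (om z) <= 1)%R by nra.
      assert (e0 * Cmod (F z) <= e0)%R by nra.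
      assert (0 <= e0 * Cmod (F z))%R by nra.
      assert (Cmod z * Cmod (om z) * (e0 * Cmod (F z)) <= 1 * e0)%R by (apply Rmult_le_compat; nra). lra. }
    apply (Rmult_le_reg_r (1 - r)); [lra |].
    replace (80 * (e0 + e1) / (1 - r) * (1 - r))%R with (80 * (e0 + e1))%R by (field; lra).
    pose proof (Cmod_ge_0 z).
    apply Rle_trans with ((x + 2 * e0) * (1 - r))%R; [apply Rmult_le_compat_r; lra |]. unfold de in Hx. nra.
Qed.

Lemma at_right_pos : at_right 0%R (fun t => (0 < t)%R).
Proof. exists (mkposreal 1 Rlt_0_1). auto. Qed.

Lemma at_right_lt (d : R) : (0 < d)%R -> at_right 0%R (fun t => (t < d)%R).
Proof.
  intros Hd. exists (mkposreal d Hd). intros t Ht _. unfold ball in Ht. simpl in Ht.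
  unfold AbsRing_ball, abs, minus, plus, opp in Ht. simpl in Ht.
  pose proof (Rle_abs (t + - 0)). lra.
Qed.

Lemma generates_ulim (F : R -> C -> C) (f : C -> C) (z : C) : generates F f -> Delta z ->
  ulim (at_right 0%R) (fun t : R => (z - F t z) / RtoC t) (fun _ => f z).
Proof. intros H Hz. apply (proj1 (C_cvg_ulim (at_right 0%R) _ _)). now apply H. Qed.

(** A generator is defined by pointwise limits only. Convergence at the two points 0 and [1 / 2]
    already bounds the quotients [(z - F t z) / t] on compact sets, by [self_map_displacement], and
    [hol_limit] applies. *)
Lemma generator_hol (f : C -> C) : G f -> hol 1 f.
Proof.
  intros (F & HF & Hgen).
  assert (D0 : Delta 0) by (unfold Delta; rewrite Cmod_0; lra).
  set (w := RtoC (1 / 2)). assert (Dw : Delta w) by (unfold Delta, w; rewrite Cmod_R, Rabs_pos_eq; lra).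
  assert (HFh : forall t, (0 <= t)%R -> hol 1 (F t)).
  { intros t Ht z Hz. exact (semigroup_hol F HF t Ht z Hz). }
  apply (hol_limit (at_right 0%R) (fun t z => (z - F t z) / RtoC t)).
  2:{ intros z Hz. now apply generates_ulim. }
  intros r Hr.
  set (m0 := (Cmod (f 0) + 1)%R). set (m1 := (Cmod (f w) + 1)%R).
  assert (Hm0 : (0 < m0)%R) by (unfold m0; pose proof (Cmod_ge_0 (f 0)); lra).
  exists (80 * (m0 + m1) / (1 - r))%R.
  assert (Hd : (0 < 1 / (2 * m0))%R) by (apply Rdiv_lt_0_compat; lra).
  generalize (filter_and _ _ (filter_and _ _ at_right_pos (at_right_lt _ Hd))
    (filter_and _ _ (generates_ulim F f 0 Hgen D0 1%R Rlt_0_1) (generates_ulim F f w Hgen Dw 1%R Rlt_0_1))).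
  apply filter_imp. intros t [[Ht0 Ht1] [L0 Lw]].
  assert (Nt : RtoC t <> 0) by (intros Z; apply RtoC_inj in Z; lra).
  assert (B : forall z, (Cmod ((z - F t z) / t - f z) < 1)%R -> (Cmod (z - F t z) <= t * (Cmod (f z) + 1))%R).
  { intros z Hz. pose proof (Cmod_triangle_rev ((z - F t z) / t) (f z)) as T.
    rewrite Cmod_div, Cmod_R, Rabs_pos_eq in T by (auto; lra).
    replace (Cmod (z - F t z)) with (t * (Cmod (z - F t z) / t))%R by (field; lra).
    apply Rmult_le_compat_l; lra. }
  assert (B0 := B 0 L0). assert (Bw := B w Lw). fold m0 in B0. fold m1 in Bw.
  replace (0 - F t 0) with (- F t 0) in B0 by ring. rewrite Cmod_opp in B0.
  split.
  - intros z Hz. destruct (HFh t (Rlt_le _ _ Ht0) z Hz) as [d Hd']. eexists.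
    apply cd_div; [apply cd_minus; [apply cd_id | exact Hd'] | apply cd_const | exact Nt].
  - intros z Hz. rewrite Cmod_div, Cmod_R, Rabs_pos_eq by (auto; lra).
    assert (S := self_map_displacement (F t) r z ltac:(lra) (HFh t (Rlt_le _ _ Ht0))
      (fun u Hu => semigroup_self F HF t u (Rlt_le _ _ Ht0) Hu)). fold w in S.
    assert (Hsm : (Cmod (F t 0) <= 1 / 2)%R).
    { apply Rle_trans with (1 / (2 * m0) * m0)%R; [nra |]. right. field. lra. }
    specialize (S Hsm Hz).
    apply (Rmult_le_reg_r t); auto. unfold Rdiv at 1. rewrite Rmult_assoc, Rinv_l, Rmult_1_r by lra.
    eapply Rle_trans; [exact S |].
    replace (80 * (m0 + m1) / (1 - r) * t)%R with (80 * (t * m0 + t * m1) / (1 - r))%R by (field; lra).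
    apply Rmult_le_compat_r; [apply Rlt_le, Rinv_0_lt_compat; lra |]. lra.
Qed.

Lemma ulim_at_right_0 : ulim (at_right 0%R) RtoC (fun _ => RtoC 0).
Proof.
  apply (ulim_le _ (locally 0%R)); [| apply ulim_R_id]. intros P HP. unfold at_right, within.
  revert HP. apply filter_imp. auto.
Qed.

(* Derivative at [t = 0] of the Schwarz-Pick inequality between [F t z] and [F t w]. *)
Lemma generator_two_points (f : C -> C) (z w : C) : G f -> Delta z -> Delta w ->
  (0 <= Re (((z * Cconj (f z) + Cconj z * f z) * (1 - w * Cconj w)
             + (1 - z * Cconj z) * (w * Cconj (f w) + Cconj w * f w)) * ((1 - Cconj w * z) * (1 - w * Cconj z))
            - (1 - z * Cconj z) * (1 - w * Cconj w)
              * ((Cconj w * f z + Cconj (f w) * z) * (1 - w * Cconj z)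
                 + (1 - Cconj w * z) * (w * Cconj (f z) + f w * Cconj z))))%R.
Proof.
  intros (F & HF & Hgen) Hz Hw.
  set (g := fun t => (z - F t z) / RtoC t). set (k := fun t => (w - F t w) / RtoC t).
  assert (Hg : ulim (at_right 0%R) g (fun _ => f z)) by now apply generates_ulim.
  assert (Hk : ulim (at_right 0%R) k (fun _ => f w)) by now apply generates_ulim.
  assert (Hgc := ulim_conj _ _ Hg). assert (Hkc := ulim_conj _ _ Hk). cbv beta in Hgc, Hkc.
  assert (Ht := ulim_at_right_0).
  (* These are exact increments divided by [t]: with [a = F t z] and [b = F t w], one has
     [1 - |a|^2 = A0 + t * A1 t] and [1 - conj b * a = C0 + t * C1 t], similarly for [B1] and [D1].
     The terms of order 0 cancel in Schwarz-Pick, so [Q] is its defect divided by [t]. *)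
  set (A1 := fun t : R => z * Cconj (g t) + Cconj z * g t - RtoC t * (g t * Cconj (g t))).
  set (B1 := fun t : R => w * Cconj (k t) + Cconj w * k t - RtoC t * (k t * Cconj (k t))).
  set (C1 := fun t : R => Cconj w * g t + Cconj (k t) * z - RtoC t * (Cconj (k t) * g t)).
  set (D1 := fun t : R => w * Cconj (g t) + k t * Cconj z - RtoC t * (k t * Cconj (g t))).
  set (A0 := 1 - z * Cconj z). set (B0 := 1 - w * Cconj w).
  set (C0 := 1 - Cconj w * z). set (D0 := 1 - w * Cconj z).
  set (Q := fun t : R => (A1 t * B0 + A0 * B1 t + RtoC t * (A1 t * B1 t)) * (C0 * D0)
                         - A0 * B0 * (C1 t * D0 + C0 * D1 t + RtoC t * (C1 t * D1 t))).
  set (a1 := z * Cconj (f z) + Cconj z * f z - 0 * (f z * Cconj (f z))).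
  set (b1 := w * Cconj (f w) + Cconj w * f w - 0 * (f w * Cconj (f w))).
  set (c1 := Cconj w * f z + Cconj (f w) * z - 0 * (Cconj (f w) * f z)).
  set (d1 := w * Cconj (f z) + f w * Cconj z - 0 * (f w * Cconj (f z))).
  assert (HA : ulim (at_right 0%R) A1 (fun _ => a1)) by (unfold A1; ulim_tac).
  assert (HB : ulim (at_right 0%R) B1 (fun _ => b1)) by (unfold B1; ulim_tac).
  assert (HC : ulim (at_right 0%R) C1 (fun _ => c1)) by (unfold C1; ulim_tac).
  assert (HD : ulim (at_right 0%R) D1 (fun _ => d1)) by (unfold D1; ulim_tac).
  assert (HQ : ulim (at_right 0%R) Q (fun _ => (a1 * B0 + A0 * b1 + 0 * (a1 * b1)) * (C0 * D0)
                                      - A0 * B0 * (c1 * D0 + C0 * d1 + 0 * (c1 * d1)))).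
  { unfold Q. ulim_tac. }
  match goal with |- (0 <= Re ?e)%R => set (L := e) end.
  apply (ulim_re_le (F := at_right 0%R) Q L).
  - eapply ulim_ext; [| | exact HQ].
    + apply filter_forall. reflexivity.
    + apply filter_forall. intros _. unfold L, a1, b1, c1, d1, A0, B0, C0, D0. ring.
  - generalize at_right_pos. apply filter_imp. intros t Htp.
    assert (Nt : RtoC t <> 0) by (intros Z; apply RtoC_inj in Z; lra).
    set (a := F t z). set (b := F t w).
    assert (Ea : z = a + RtoC t * g t) by (unfold a, g; field; auto).
    assert (Eb : w = b + RtoC t * k t) by (unfold b, k; field; auto).
    assert (Eac : Cconj z = Cconj a + RtoC t * Cconj (g t)).
    { rewrite Ea at 1. rewrite Cplus_conj, Cmult_conj. do 2 f_equal. apply C_ext; simpl; ring. }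
    assert (Ebc : Cconj w = Cconj b + RtoC t * Cconj (k t)).
    { rewrite Eb at 1. rewrite Cplus_conj, Cmult_conj. do 2 f_equal. apply C_ext; simpl; ring. }
    assert (EQ : RtoC t * Q t = (1 - a * Cconj a) * (1 - b * Cconj b) * (C0 * D0)
                               - A0 * B0 * ((1 - Cconj b * a) * (1 - b * Cconj a))).
    { unfold Q, A1, B1, C1, D1, A0, B0, C0, D0. rewrite Eac, Ebc.
      generalize (Cconj a) (Cconj b) (Cconj (g t)) (Cconj (k t)). intros ac bc gc kc.
      rewrite Ea, Eb. generalize (g t) (k t). intros. ring. }
    assert (P := schwarz_pick_lt (F t) (semigroup_hol F HF t (Rlt_le _ _ Htp))
      (fun u Hu => semigroup_self F HF t u (Rlt_le _ _ Htp) Hu) z w Hz Hw).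
    fold a b in P.
    apply (Rmult_le_reg_l t); auto. rewrite Rmult_0_r, <- re_scal_l, EQ.
    assert (M : forall u : C, u * Cconj u = RtoC (Cmod u * Cmod u)).
    { intros [x y]. rewrite Cmod_sqr. apply C_ext; simpl; ring. }
    unfold A0, B0, C0, D0. rewrite !M.
    assert (M2 : forall u v : C, (1 - Cconj v * u) * (1 - v * Cconj u) = RtoC (Cmod (1 - Cconj v * u) * Cmod (1 - Cconj v * u))).
    { intros u v. rewrite <- M. f_equal. rewrite Cminus_conj, Cmult_conj, Cconj_conj. f_equal. apply C_ext; simpl; ring. }
    rewrite !M2, <- !RtoC_minus, <- !RtoC_mult, <- RtoC_minus, re_RtoC.
    (* The two products become [(Y^2 - u^2) X^2] and [(X^2 - v^2) Y^2], whose difference is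
       [v^2 Y^2 - u^2 X^2]. *)
    rewrite <- !pseudo_hyperbolic.
    set (X := Cmod (1 - Cconj w * z)) in *. set (Y := Cmod (1 - Cconj b * a)) in *.
    set (u := Cmod (a - b)) in *. set (v := Cmod (z - w)) in *.
    assert (0 <= X)%R by apply Cmod_ge_0. assert (0 <= u)%R by apply Cmod_ge_0.
    assert (u * X * (u * X) <= v * Y * (v * Y))%R by (apply Rmult_le_compat; auto; nra). nra.
Qed.

(** * Julia's inequality at the boundary fixed point *)

Lemma radial_filterlim :
  filterlim RtoC (at_left 1%R) (within (Stolz 2) (locally (T := C_UniformSpace) (RtoC 1))).
Proof.
  intros P HP. unfold within in HP. apply locally_C_iff in HP. destruct HP as (d & Hd & HP).
  assert (Hm : (0 < Rmin d 1)%R) by (apply Rmin_glb_lt; lra).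
  exists (mkposreal _ Hm). intros t Ht Ht1. change (Rabs (t - 1) < Rmin d 1)%R in Ht.
  pose proof (Rmin_l d 1). pose proof (Rmin_r d 1).
  rewrite Rabs_left in Ht by lra. apply HP.
  - rewrite <- RtoC_minus, Cmod_R, Rabs_left; lra.
  - unfold Stolz, Delta. rewrite <- RtoC_minus, !Cmod_R, !Rabs_pos_eq by lra. lra.
Qed.

(** For real [w = r] every term of [generator_two_points] carries a factor [1 - r], by
    [1 - r^2 = (1 - r)(1 + r)] and [f r = phi r * (r - 1)]. Dividing and letting [r] tend to 1
    leaves this inequality, whose right side is [2 * |1 - z|^4] times the real part of the [q] in
    [Gplus1_decomposition]. *)
Lemma Gplus1_re (f : C -> C) (beta : R) (z : C) : Gplus1 f beta -> Delta z ->
  (0 <= Re (- (2 * f z * ((1 - Cconj z) * (1 - Cconj z)))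
            - beta * (1 - z * Cconj z) * ((1 - z) * (1 - Cconj z))))%R.
Proof.
  intros [HG H0 H1 Hb] Hz.
  assert (U0 : ulim (at_left 1%R) (fun r : R => f (RtoC r)) (fun _ => RtoC 0)).
  { apply (ulim_comp _ _ RtoC f (fun _ => RtoC 0) radial_filterlim).
    apply (proj1 (C_cvg_ulim _ _ _)). apply H0. lra. }
  assert (U1 : ulim (at_left 1%R) (fun r : R => f (RtoC r) / (RtoC r - 1)) (fun _ => RtoC beta)).
  { apply (ulim_comp _ _ RtoC (fun z => f z / (z - 1)) (fun _ => RtoC beta) radial_filterlim).
    apply (proj1 (C_cvg_ulim _ _ _)). apply H1. lra. }
  assert (Ur : ulim (at_left 1%R) RtoC (fun _ => RtoC 1)).
  { apply (ulim_le _ (locally 1%R)); [| apply ulim_R_id]. intros P HP. unfold at_left, within.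
    revert HP. apply filter_imp. auto. }
  assert (Hl : at_left 1%R (fun r => (0 < r < 1)%R)).
  { exists (mkposreal 1 Rlt_0_1). intros t Ht Ht1. change (Rabs (t - 1) < 1)%R in Ht.
    rewrite Rabs_left in Ht; lra. }
  set (phi := fun r : R => f (RtoC r) / (RtoC r - 1)) in *.
  assert (U0c := ulim_conj _ _ U0). assert (U1c := ulim_conj _ _ U1). cbv beta in U0c, U1c.
  set (zb := Cconj z). set (A0 := 1 - z * zb). set (fb := Cconj (f z)).
  set (A1 := z * fb + zb * f z).
  set (B1 := fun r : R => - (RtoC r * (Cconj (phi r) + phi r))).
  set (C1 := fun r : R => RtoC r * f z + Cconj (f (RtoC r)) * z).
  set (D1 := fun r : R => RtoC r * fb + f (RtoC r) * zb).
  set (C0 := fun r : R => 1 - RtoC r * z). set (D0 := fun r : R => 1 - RtoC r * zb).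
  set (Q := fun r : R => (A1 * (1 + RtoC r) + A0 * B1 r) * (C0 r * D0 r)
             - A0 * (1 + RtoC r) * (C1 r * D0 r + C0 r * D1 r)).
  assert (HQ : ulim (at_left 1%R) Q (fun _ =>
     (A1 * (1 + 1) + A0 * - (1 * (Cconj beta + beta))) * ((1 - 1 * z) * (1 - 1 * zb))
       - A0 * (1 + 1) * ((1 * f z + Cconj 0 * z) * (1 - 1 * zb) + (1 - 1 * z) * (1 * fb + 0 * zb)))).
  { unfold Q, B1, C1, D1, C0, D0. ulim_tac. }
  match type of HQ with ulim _ _ (fun _ => ?e) => set (L := e) in HQ end.
  assert (HL : (0 <= Re L)%R).
  { apply (ulim_re_le (F := at_left 1%R) Q L HQ). revert Hl. apply filter_imp. intros r Hr.
    assert (Dr : Delta (RtoC r)) by (unfold Delta; rewrite Cmod_R, Rabs_pos_eq; lra).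
    pose proof (generator_two_points f z (RtoC r) HG Hz Dr) as P.
    apply (Rmult_le_reg_l (1 - r)); [lra |]. rewrite Rmult_0_r, <- re_scal_l.
    assert (Nr : RtoC r - 1 <> 0).
    { rewrite <- RtoC_minus. intros Z. apply RtoC_inj in Z. lra. }
    assert (Er : Cconj r = RtoC r) by (apply C_ext; simpl; ring).
    assert (Ef : f (RtoC r) = phi r * (RtoC r - 1)) by (unfold phi; field; auto).
    assert (Efc : Cconj (f (RtoC r)) = Cconj (phi r) * (RtoC r - 1)).
    { rewrite Ef at 1. rewrite Cmult_conj, Cminus_conj, Er. do 2 f_equal. apply C_ext; simpl; ring. }
    rewrite Er in P.
    match type of P with (0 <= Re ?e)%R => replace (RtoC (1 - r) * Q r) with e; [exact P |] end.
    unfold Q, B1, C1, D1, C0, D0, A1, A0. fold zb fb. rewrite Efc, Ef, RtoC_minus.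
    generalize (Cconj (phi r)) (phi r). intros. ring. }
  match goal with |- (0 <= ?e)%R => replace e with (Re L / 2)%R; [lra |] end.
  unfold L, A1, A0, zb, fb. destruct (f z) as [u v]. destruct z as [x y]. simpl. field.
Qed.

Definition cayley (z : C) : C := (1 + z) / (1 - z).

Lemma Delta_neq_1 (z : C) : Delta z -> 1 - z <> 0.
Proof. intros Hz. apply Cminus_neq_0_of_mod. rewrite Cmod_1. exact Hz. Qed.

(** The right side is the Poisson kernel of the disc at the boundary point 1. *)
Lemma cayley_re (z : C) : 1 - z <> 0 ->
  Re (cayley z) = ((1 - Cmod z * Cmod z) / (Cmod (1 - z) * Cmod (1 - z)))%R.
Proof.
  intros N. assert (0 < Cmod (1 - z))%R by now apply Cmod_gt_0.
  assert (E : cayley z = (1 + z) * Cconj (1 - z) * RtoC (/ (Cmod (1 - z) * Cmod (1 - z)))).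
  { unfold cayley. rewrite RtoC_inv by nra.
    assert (E2 : RtoC (Cmod (1 - z) * Cmod (1 - z)) = (1 - z) * Cconj (1 - z)).
    { rewrite Cmod_sqr. destruct z. apply C_ext; simpl; ring. }
    rewrite E2. field. split; auto. intros Z. apply (f_equal Cmod) in Z. rewrite Cmod_conj, Cmod_0 in Z. lra. }
  rewrite E, re_scal_r. unfold Rdiv. f_equal. rewrite Cmod_sqr. destruct z. simpl. ring.
Qed.

(* Berkson-Porta form of [f], with the part of [f] responsible for [f'(1) = beta] split off
   as in Julia's lemma. *)
Lemma Gplus1_decomposition (f : C -> C) (beta : R) : Gplus1 f beta ->
  exists q, hol 1 q /\ (forall z, Delta z -> (0 <= Re (q z))%R) /\
    forall z, Delta z -> f z = - ((1 - z) * (1 - z)) * (RtoC (beta / 2) * cayley z + q z).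
Proof.
  intros Hf. assert (Hfh := generator_hol f (Gplus1_G f beta Hf)).
  exists (fun z => - f z / ((1 - z) * (1 - z)) - RtoC (beta / 2) * cayley z). repeat split.
  - intros z Hz. destruct (Hfh z Hz) as [d Hd]. pose proof (Delta_neq_1 z Hz) as N.
    assert (A : cd (fun z => 1 - z) z (0 - 1)) by (apply cd_minus; [apply cd_const | apply cd_id]).
    eexists. apply cd_minus.
    + apply cd_div; [apply cd_opp; exact Hd | apply cd_mult; exact A | now apply Cmult_neq_0].
    + apply cd_mult; [apply cd_const |]. unfold cayley.
      apply cd_div; [apply cd_plus; [apply cd_const | apply cd_id] | exact A | exact N].
  - intros z Hz. pose proof (Delta_neq_1 z Hz) as N. pose proof (Gplus1_re f beta z Hf Hz) as P.
    assert (Hm : (0 < Cmod (1 - z))%R) by now apply Cmod_gt_0.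
    unfold Cminus at 1. rewrite re_plus, re_opp, re_scal_l, cayley_re by auto.
    set (m := (Cmod (1 - z) * Cmod (1 - z))%R) in *. assert (Hm0 : (0 < m)%R) by (unfold m; nra).
    assert (Em : RtoC m = (1 - z) * Cconj (1 - z)).
    { unfold m. rewrite Cmod_sqr. destruct z. apply C_ext; simpl; ring. }
    assert (Ec : Cconj (1 - z) = 1 - Cconj z) by (destruct z; apply C_ext; simpl; ring).
    assert (Nc : Cconj (1 - z) <> 0).
    { intros Z. apply (f_equal Cmod) in Z. rewrite Cmod_conj, Cmod_0 in Z. lra. }
    assert (E : - f z / ((1 - z) * (1 - z)) = - (f z * ((1 - Cconj z) * (1 - Cconj z))) * RtoC (/ (m * m))).
    { rewrite RtoC_inv by nra. rewrite RtoC_mult, Em, <- Ec. field. auto. }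
    rewrite E, re_scal_r.
    assert (E2 : Re (- (2 * f z * ((1 - Cconj z) * (1 - Cconj z))) - beta * (1 - z * Cconj z) * ((1 - z) * (1 - Cconj z)))
      = (2 * Re (- (f z * ((1 - Cconj z) * (1 - Cconj z)))) - beta * (1 - Cmod z * Cmod z) * m)%R).
    { rewrite <- Ec, <- Em. rewrite Cmod_sqr. destruct (f z). destruct z. simpl. ring. }
    rewrite E2 in P.
    apply (Rmult_le_reg_r (m * m)); [nra |]. rewrite Rmult_0_l.
    match goal with |- (0 <= ?e)%R => replace e with
      ((2 * Re (- (f z * ((1 - Cconj z) * (1 - Cconj z)))) - beta * (1 - Cmod z * Cmod z) * m) / 2)%R; [lra |] end.
    field. lra.
  - intros z Hz. pose proof (Delta_neq_1 z Hz) as N. field. auto.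
Qed.

(** * Local surjectivity and spirallike functions *)

Lemma ball_segment (a u v : C) (r t : R) : (Cmod (u - a) <= r)%R -> (Cmod (v - a) <= r)%R -> (0 <= t <= 1)%R ->
  (Cmod (u + RtoC t * (v - u) - a) <= r)%R.
Proof.
  intros Hu Hv Ht.
  replace (u + t * (v - u) - a) with (RtoC (1 - t) * (u - a) + RtoC t * (v - a)) by (rewrite RtoC_minus; ring).
  eapply Rle_trans; [apply Cmod_triangle |]. rewrite !Cmod_mult, !Cmod_R, !Rabs_pos_eq by lra.
  assert ((1 - t) * Cmod (u - a) <= (1 - t) * r)%R by (apply Rmult_le_compat_l; lra).
  assert (t * Cmod (v - a) <= t * r)%R by (apply Rmult_le_compat_l; lra). lra.
Qed.

(* Newton's iteration with the constant slope [c] is a contraction of ratio 1/2. *)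
Lemma local_surj (g g' : C -> C) (a c y : C) (r : R) : c <> 0 ->
  (forall w, (Cmod (w - a) <= r)%R -> cd g w (g' w)) ->
  (forall w, (Cmod (w - a) <= r)%R -> (Cmod (g' w - c) <= Cmod c / 2)%R) ->
  (Cmod (y - g a) <= Cmod c * r / 4)%R -> exists v, (Cmod (v - a) <= r)%R /\ g v = y.
Proof.
  intros Hc Hd Hg' Hy. assert (Hc0 : (0 < Cmod c)%R) by now apply Cmod_gt_0.
  assert (Hr : (0 <= r)%R) by (pose proof (Cmod_ge_0 (y - g a)); nra).
  set (T := fun v => v - (g v - y) / c).
  assert (HT : forall w, (Cmod (w - a) <= r)%R -> cd T w (1 - g' w / c)).
  { intros w Hw. unfold T. apply cd_minus; [apply cd_id |].
    eapply cd_eq; [apply cd_mult; [apply cd_minus; [now apply Hd | apply cd_const] | apply cd_const] |].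
    cbv beta. unfold Cdiv. ring. }
  assert (HL : forall u v, (Cmod (u - a) <= r)%R -> (Cmod (v - a) <= r)%R -> (Cmod (T v - T u) <= 1 / 2 * Cmod (v - u))%R).
  { intros u v Hu Hv. apply (segment_lip T (fun w => 1 - g' w / c)).
    - intros t Ht. apply HT. now apply ball_segment.
    - intros t Ht. pose proof (Hg' _ (ball_segment a u v r t Hu Hv Ht)) as B.
      set (w := u + t * (v - u)) in *.
      replace (1 - g' w / c) with (- (g' w - c) / c) by (field; auto).
      rewrite Cmod_div, Cmod_opp by auto. apply (Rmult_le_reg_r (Cmod c)); auto.
      unfold Rdiv at 1. rewrite Rmult_assoc, Rinv_l by lra. lra. }
  assert (Ha : (Cmod (a - a) <= r)%R) by (replace (a - a) with (RtoC 0) by ring; rewrite Cmod_0; lra).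
  assert (H1 : (Cmod (T a - a) <= r / 4)%R).
  { unfold T. replace (a - (g a - y) / c - a) with ((y - g a) / c) by (field; auto).
    rewrite Cmod_div by auto. apply (Rmult_le_reg_r (Cmod c)); auto.
    unfold Rdiv at 1. rewrite Rmult_assoc, Rinv_l by lra. lra. }
  set (u := fun n => Nat.iter n T a).
  (* The first bound keeps the iterates in the disc where [T] contracts; the initial displacement
     [r / 4] sums to [r / 2] along the geometric series. *)
  assert (Hu : forall n, (Cmod (u n - a) <= r / 2 * (1 - (1 / 2) ^ n))%R /\ (Cmod (u (S n) - u n) <= r / 4 * (1 / 2) ^ n)%R).
  { induction n as [| n [I1 I2]].
    - split; simpl; [| lra]. replace (a - a) with (RtoC 0) by ring. rewrite Cmod_0. lra.
    - assert (B : (0 <= (1 / 2) ^ n)%R) by (apply pow_le; lra).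
      assert (J : (Cmod (u (S n) - a) <= r / 2 * (1 - (1 / 2) ^ S n))%R).
      { replace (u (S n) - a) with ((u (S n) - u n) + (u n - a)) by ring.
        eapply Rle_trans; [apply Cmod_triangle |]. simpl pow. lra. }
      split; [exact J |].
      assert (B1 : (0 <= (1 / 2) ^ S n)%R) by (apply pow_le; lra).
      change (u (S (S n))) with (T (u (S n))). change (u (S n)) with (T (u n)) at 2.
      eapply Rle_trans; [apply HL; nra |]. simpl pow. lra. }
  destruct (geometric_cvg u (r / 4)) as [l Hl]; [intros n; apply Hu |].
  assert (Hla : (Cmod (l - a) <= r)%R).
  { specialize (Hl 0%nat). simpl in Hl. rewrite Cmod_minus_sym. lra. }
  exists l. split; auto.
  assert (E : T l = l).
  { apply Ceq_minus, Cmod_eq_0, Rle_antisym; [| apply Cmod_ge_0]. apply Rnot_lt_le. intros He.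
    set (e := Cmod (T l - l)) in *.
    assert (He2 : (0 < e / (2 * r + 1))%R) by (apply Rdiv_lt_0_compat; lra).
    destruct (pow_lt_1_zero (1 / 2) ltac:(rewrite Rabs_pos_eq; lra) _ He2) as [N HN].
    specialize (HN N (Nat.le_refl N)). rewrite Rabs_pos_eq in HN by (apply pow_le; lra).
    assert (B : (0 <= (1 / 2) ^ N)%R) by (apply pow_le; lra).
    pose proof (Hl N) as L1. pose proof (Hl (S N)) as L2. simpl pow in L2.
    destruct (Hu N) as [U1 _].
    assert (UN : (Cmod (u N - a) <= r)%R) by nra.
    pose proof (HL _ _ UN Hla) as L3. change (T (u N)) with (u (S N)) in L3.
    rewrite (Cmod_minus_sym l (u N)) in L3.
    pose proof (Cmod_triangle (T l - u (S N)) (u (S N) - l)) as L4.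
    replace (T l - u (S N) + (u (S N) - l)) with (T l - l) in L4 by ring. fold e in L4.
    assert (e <= r * (1 / 2) ^ N)%R by lra.
    apply (Rmult_lt_compat_l (2 * r + 1)) in HN; [| lra].
    replace ((2 * r + 1) * (e / (2 * r + 1)))%R with e in HN by (field; lra). nra. }
  unfold T in E. apply Ceq_minus.
  transitivity (c * (l - (l - (g l - y) / c))); [field; auto | rewrite E; ring].
Qed.

(** Kept with its sign rather than as mere injectivity: [flow_step] reads off from it that the real
    part decreases along the flow. *)
Lemma noshiro_warschawski (g g' : C -> C) (a b : C) : a <> b ->
  (forall t, (0 <= t <= 1)%R -> cd g (a + RtoC t * (b - a)) (g' (a + RtoC t * (b - a)))) ->
  (forall t, (0 <= t <= 1)%R -> (0 < Re (g' (a + RtoC t * (b - a))%C))%R) ->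
  (0 < Re (Cconj (b - a) * (g b - g a)))%R.
Proof.
  intros Hab H K. destruct (segment_mvt g g' a b (Cconj (b - a)) H) as (t & Ht & E). rewrite E.
  assert (N : (0 < Cmod (b - a))%R) by (apply Cmod_gt_0, Cminus_eq_contra; auto).
  set (w := g' (a + t * (b - a))).
  replace (Cconj (b - a) * (w * (b - a))) with (w * RtoC (Cmod (b - a) * Cmod (b - a))).
  - rewrite re_scal_r. apply Rmult_lt_0_compat; [now apply K | nra].
  - rewrite Cmod_sqr. destruct (b - a). destruct w. apply C_ext; simpl; ring.
Qed.

Lemma re_inv_pos (z : C) : (0 < Re z)%R -> (0 < Re (/ z))%R.
Proof.
  intros H. destruct z as [x y]. simpl in *. apply Rdiv_lt_0_compat; nra.
Qed.

Lemma re_pos_neq_0 (z : C) : (0 < Re z)%R -> z <> 0.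
Proof. intros H E. rewrite E in H. simpl in H. lra. Qed.

Lemma Cmod_Cexp_lt_1 (u : C) : disc 1 (Cexp u) <-> (Re u < 0)%R.
Proof.
  unfold disc. rewrite Cmod_Cexp. split; intros H.
  - apply exp_lt_inv. now rewrite exp_0.
  - rewrite <- exp_0. now apply exp_increasing.
Qed.

Lemma segment_re_neg (u v : C) (t : R) : (Re u < 0)%R -> (Re v < 0)%R -> (0 <= t <= 1)%R ->
  (Re (u + RtoC t * (v - u)) < 0)%R.
Proof.
  intros Hu Hv Ht. unfold Cminus. rewrite re_plus, re_scal_l, re_plus, re_opp.
  destruct (Req_dec t 0) as [-> | N]; [lra |]. nra.
Qed.

(** * Spirallike functions of generators [z * P z], with attracting point 0 *)

Section SpiralModel.

Variable P : C -> C.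
Hypothesis P_hol : hol 1 P.
Hypothesis P_re : forall z, disc 1 z -> (0 < Re (P z))%R.

Let mu := P 0.

Lemma zero_in_disc : disc 1 0.
Proof. unfold disc. rewrite Cmod_0. lra. Qed.

Let mu_neq_0 : mu <> 0.
Proof. apply re_pos_neq_0, P_re, zero_in_disc. Qed.

Let P_neq_0 (z : C) : disc 1 z -> P z <> 0.
Proof. intros Hz. now apply re_pos_neq_0, P_re. Qed.

Let Pinv_hol : hol 1 (fun z => / P z).
Proof.
  intros z Hz. destruct (P_hol z Hz) as [d Hd]. eexists. apply cd_inv; [exact Hd | auto].
Qed.

(* In the variable [u = log z] on the left half-plane, [z * exp (Psi z)] becomes [exp (mu * Phi u)]
   with [Phi' = 1 / P], of positive real part. *)
Lemma spiral_model_exists : exists Psi, hol 1 Psi /\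
  forall z, disc 1 z -> cd (fun z => z * Cexp (Psi z)) z (mu * Cexp (Psi z) / P z).
Proof.
  (* Since [mu / P 0 = 1], one has [mu / P z = 1 + z * s z]. With [Psi' = s] the derivative of
     [z * exp (Psi z)] is [exp (Psi z) * (1 + z * s z)], as required. *)
  destruct (slope_hol 1 (fun z => mu * / P z) 0) as (s & Hs & E).
  - intros z Hz. destruct (Pinv_hol z Hz) as [d Hd]. eexists. apply cd_mult; [apply cd_const | exact Hd].
  - apply zero_in_disc.
  - destruct (primitive_disc 1 s 0 0) as (Psi & _ & HPsi); [lra | | |].
    + intros z Hz. now apply (hol_cont 1).
    + intros z Hz _ _. now apply Hs.
    + exists Psi. split; [intros z Hz; exists (s z); auto |].
      intros z Hz. eapply cd_eq; [apply cd_mult; [apply cd_id | apply cd_Cexp_comp; apply HPsi; auto] |].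
      specialize (E z). fold mu in E. cbv beta.
      transitivity (Cexp (Psi z) * (mu * / mu + (z - 0) * s z)); [field; auto |].
      rewrite <- E. field. auto.
Qed.

Variable Psi : C -> C.
Hypothesis Psi_hol : hol 1 Psi.
Hypothesis Psi_der : forall z, disc 1 z -> cd (fun z => z * Cexp (Psi z)) z (mu * Cexp (Psi z) / P z).

Let H (z : C) : C := z * Cexp (Psi z).
Let Phi (u : C) : C := (u + Psi (Cexp u)) / mu.

Let H_Phi (u : C) : H (Cexp u) = Cexp (mu * Phi u).
Proof. unfold H, Phi. rewrite <- Cexp_plus. f_equal. field. auto. Qed.

Let Phi_der (u : C) : (Re u < 0)%R -> cd Phi u (/ P (Cexp u)).
Proof.
  intros Hu. assert (Du : disc 1 (Cexp u)) by now apply Cmod_Cexp_lt_1.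
  destruct (Psi_hol _ Du) as [d Hd].
  assert (K : cd (fun z => z * Cexp (Psi z)) (Cexp u) (1 * Cexp (Psi (Cexp u)) + Cexp u * (Cexp (Psi (Cexp u)) * d))).
  { exact (cd_mult (fun z => z) (fun z => Cexp (Psi z)) _ _ _ (cd_id _) (cd_Cexp_comp Psi _ _ Hd)). }
  pose proof (cd_unique _ _ _ _ K (Psi_der _ Du)) as E.
  assert (E2 : 1 + Cexp u * d = mu / P (Cexp u)).
  { replace (1 + Cexp u * d) with ((1 * Cexp (Psi (Cexp u)) + Cexp u * (Cexp (Psi (Cexp u)) * d)) / Cexp (Psi (Cexp u)))
      by (field; apply Cexp_neq_0).
    rewrite E. field. split; [apply P_neq_0; auto | apply Cexp_neq_0]. }
  unfold Phi, Cdiv. eapply cd_eq.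
  - apply cd_mult; [| apply cd_const]. apply cd_plus; [apply cd_id |].
    exact (cd_comp Psi Cexp u _ _ Hd (cd_Cexp u)).
  - cbv beta. transitivity ((1 + Cexp u * d) * / mu); [ring |]. rewrite E2. field. split; auto.
Qed.

Let Phi_nw (u v : C) : (Re u < 0)%R -> (Re v < 0)%R -> u <> v -> (0 < Re (Cconj (v - u) * (Phi v - Phi u)))%R.
Proof.
  intros Hu Hv N. apply (noshiro_warschawski Phi (fun u => / P (Cexp u))); auto.
  - intros t Ht. apply Phi_der. now apply segment_re_neg.
  - intros t Ht. apply re_inv_pos, P_re, Cmod_Cexp_lt_1. now apply segment_re_neg.
Qed.

Lemma spiral_model_injective (z w : C) : disc 1 z -> disc 1 w -> H z = H w -> z = w.
Proof.
  intros Hz Hw E.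
  assert (Z : forall a b, H a = H b -> a = 0 -> b = 0).
  { intros a b E1 Ea. unfold H in E1. rewrite Ea, Cmult_0_l in E1.
    replace b with (b * Cexp (Psi b) / Cexp (Psi b)) by (field; apply Cexp_neq_0).
    rewrite <- E1. field. apply Cexp_neq_0. }
  destruct (Ceq_dec z 0) as [Ez | Nz]; [rewrite Ez; symmetry; now apply (Z z w) |].
  destruct (Ceq_dec w 0) as [Ew | Nw]; [rewrite Ew; now apply (Z w z) |].
  destruct (Cexp_surj z Nz) as [u Eu]. destruct (Cexp_surj w Nw) as [v Ev].
  rewrite <- Eu, <- Ev in *. apply Cmod_Cexp_lt_1 in Hz, Hw.
  rewrite !H_Phi in E. apply Cexp_eq in E. destruct E as [n E].
  (* [mu * Phi] increases by [Cturn] when its argument does. Hence the ambiguity of the logarithm is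
     absorbed by moving [v] to another logarithm [v'] of the same point, where [Phi u = Phi v']. *)
  set (v' := v + IZR n * Cturn).
  assert (Ev' : Cexp v' = Cexp v) by (unfold v'; rewrite Cexp_plus, Cexp_Zturn; ring).
  assert (Hv' : (Re v' < 0)%R).
  { unfold v', Cturn. rewrite re_plus, re_scal_l. simpl. lra. }
  assert (EP : Phi u = Phi v').
  { replace (Phi u) with (mu * Phi u / mu) by (field; auto). rewrite E.
    unfold Phi. rewrite Ev'. unfold v'. field. auto. }
  destruct (Ceq_dec u v') as [-> | N]; [exact Ev' |]. exfalso.
  pose proof (Phi_nw u v' Hz Hv' N) as K. rewrite EP in K.
  replace (Phi v' - Phi v') with (RtoC 0) in K by ring. rewrite Cmult_0_r in K. simpl in K. lra.
Qed.

(** The step [t0] is uniform on [Re u <= - de]: discs of radius at most [de / 2] stay in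
    [Re <= - de / 2], where [/ P] composed with [Cexp] is bounded below by [m] and Lipschitz by
    Harnack, so [local_surj] applies with constants that depend only on [de]. As the real part does
    not increase, the same step can be repeated up to any time. *)
Let flow_step (de : R) : (0 < de)%R -> exists t0, (0 < t0)%R /\ forall u t, (Re u <= - de)%R -> (0 <= t <= t0)%R ->
  exists v, (Re v <= Re u)%R /\ Phi v = Phi u - RtoC t.
Proof.
  intros Hde. set (rho := exp (- (de / 2))).
  assert (Hrho : (0 < rho < 1)%R).
  { unfold rho. split; [apply exp_pos |]. rewrite <- exp_0. apply exp_increasing. lra. }
  set (L := (4 * Cmod (/ P 0) / ((1 - rho) * (1 - rho)))%R).
  assert (HL0 : (0 <= L)%R).
  { unfold L. apply Rdiv_le_0_compat; [pose proof (Cmod_ge_0 (/ P 0)); lra | nra]. }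
  assert (HL := harnack_lip (fun z => / P z) rho ltac:(lra) Pinv_hol
    (fun z Hz => Rlt_le _ _ (re_inv_pos _ (P_re z Hz)))).
  cbv beta in HL. fold L in HL.
  assert (Hmu : (0 < Cmod mu)%R) by now apply Cmod_gt_0.
  set (m := ((1 - rho) / (2 * Cmod mu))%R). assert (Hm : (0 < m)%R) by (apply Rdiv_lt_0_compat; lra).
  assert (Hlow : forall z, (Cmod z <= rho)%R -> (m <= Cmod (/ P z))%R).
  { intros z Hz. assert (Dz : disc 1 z) by (unfold disc; lra).
    pose proof (harnack_bound P z P_hol (fun z Hz => Rlt_le _ _ (P_re z Hz)) Dz) as B. fold mu in B.
    assert (Np : (0 < Cmod (P z))%R) by (apply Cmod_gt_0; auto).
    rewrite Cmod_inv by auto. unfold m. apply (Rmult_le_reg_r (2 * Cmod mu * Cmod (P z))); [nra |].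
    replace ((1 - rho) / (2 * Cmod mu) * (2 * Cmod mu * Cmod (P z)))%R with ((1 - rho) * Cmod (P z))%R by (field; lra).
    replace (/ Cmod (P z) * (2 * Cmod mu * Cmod (P z)))%R with (2 * Cmod mu)%R by (field; lra).
    nra. }
  set (r := Rmin (de / 2) (m / (2 * (L + 1)))).
  assert (Hr : (0 < r)%R) by (apply Rmin_glb_lt; [lra | apply Rdiv_lt_0_compat; lra]).
  assert (Hr1 : (r <= de / 2)%R) by apply Rmin_l.
  assert (Hr2 : (L * r <= m / 2)%R).
  { assert (r <= m / (2 * (L + 1)))%R by apply Rmin_r.
    apply Rle_trans with ((L + 1) * (m / (2 * (L + 1))))%R; [apply Rmult_le_compat; lra |]. right. field. lra. }
  exists (m * r / 4)%R. split; [nra |]. intros u t Hu Ht.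
  assert (Hb : forall w, (Cmod (w - u) <= r)%R -> (Re w <= - (de / 2))%R).
  { intros w Hw. pose proof (re_le_Cmod (w - u)) as K. unfold Cminus in K at 1. rewrite re_plus, re_opp in K.
    pose proof (Rle_abs (Re w + - Re u)). lra. }
  assert (He : forall w, (Re w <= - (de / 2))%R -> (Cmod (Cexp w) <= rho)%R).
  { intros w Hw. rewrite Cmod_Cexp. unfold rho. destruct (Req_dec (Re w) (- (de / 2))) as [-> | N]; [lra |].
    apply Rlt_le, exp_increasing. lra. }
  assert (Huu : (Cmod (u - u) <= r)%R) by (replace (u - u) with (RtoC 0) by ring; rewrite Cmod_0; lra).
  assert (Hlu := Hlow _ (He u (Hb u Huu))).
  destruct (local_surj Phi (fun w => / P (Cexp w)) u (/ P (Cexp u)) (Phi u - RtoC t) r) as (v & Hv & Ev).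
  - intros Z. rewrite Z, Cmod_0 in Hlu. lra.
  - intros w Hw. apply Phi_der. specialize (Hb w Hw). lra.
  - intros w Hw. eapply Rle_trans; [apply HL; apply He; apply Hb; auto |].
    assert (K : (Cmod (Cexp w - Cexp u) <= 1 * Cmod (w - u))%R).
    { apply (segment_lip Cexp Cexp).
      - intros s _. apply cd_Cexp.
      - intros s Hs. assert (B := He _ (Hb _ (ball_segment u u w r s Huu Hw Hs))). lra. }
    apply Rle_trans with (L * r)%R; [apply Rmult_le_compat_l; lra | lra].
  - replace (Phi u - t - Phi u) with (- RtoC t) by ring. rewrite Cmod_opp, Cmod_R, Rabs_pos_eq by lra.
    apply Rle_trans with (m * r / 4)%R; [lra |].
    assert (m * r <= Cmod (/ P (Cexp u)) * r)%R by (apply Rmult_le_compat_r; lra). lra.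
  - exists v. split; auto.
    destruct (Ceq_dec u v) as [-> | N]; [lra |].
    pose proof (Phi_nw u v ltac:(lra) ltac:(specialize (Hb v Hv); lra) N) as K.
    rewrite Ev in K. replace (Phi u - t - Phi u) with (RtoC (- t)) in K by (rewrite RtoC_opp; ring).
    rewrite re_scal_r, re_conj in K. unfold Cminus in K. rewrite re_plus, re_opp in K. nra.
Qed.

Let flow (u : C) (t : R) : (Re u < 0)%R -> (0 <= t)%R -> exists v, (Re v < 0)%R /\ Phi v = Phi u - RtoC t.
Proof.
  intros Hu Ht. destruct (flow_step (- Re u) ltac:(lra)) as (t0 & Ht0 & K).
  destruct (nfloor_ex (t / t0)) as [n Hn]; [apply Rdiv_le_0_compat; lra |].
  set (s := (t / INR (S n))%R). assert (HS : (0 < INR (S n))%R) by (apply lt_0_INR; lia).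
  assert (Hs : (0 <= s <= t0)%R).
  { unfold s. split; [apply Rdiv_le_0_compat; lra |]. apply (Rmult_le_reg_r (INR (S n))); auto.
    unfold Rdiv. rewrite Rmult_assoc, Rinv_l, Rmult_1_r by lra. rewrite S_INR.
    destruct Hn as [_ Hn]. apply Rlt_le in Hn. apply (Rmult_le_compat_r t0) in Hn; [| lra].
    unfold Rdiv in Hn. rewrite Rmult_assoc, Rinv_l in Hn by lra. lra. }
  assert (Q : forall k : nat, exists v, (Re v <= Re u)%R /\ Phi v = Phi u - RtoC (INR k * s)).
  { induction k as [| k (v & Hv & Ev)].
    - exists u. split; [lra |]. simpl. rewrite Rmult_0_l. ring.
    - destruct (K v s ltac:(lra) Hs) as (v' & Hv' & Ev'). exists v'. split; [lra |].
      rewrite Ev', Ev, S_INR, Rmult_plus_distr_r, Rmult_1_l, RtoC_plus. ring. }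
  destruct (Q (S n)) as (v & Hv & Ev). exists v. split; [lra |]. rewrite Ev. do 3 f_equal.
  unfold s. field. lra.
Qed.

Lemma spiral_model_invariant (z : C) (t : R) : disc 1 z -> (0 <= t)%R ->
  exists w, disc 1 w /\ H w = Cexp (- (RtoC t * mu)) * H z.
Proof.
  intros Hz Ht. destruct (Ceq_dec z 0) as [-> | Nz].
  - exists 0. split; [apply zero_in_disc |]. unfold H. ring.
  - destruct (Cexp_surj z Nz) as [u Eu]. rewrite <- Eu in *. apply Cmod_Cexp_lt_1 in Hz.
    destruct (flow u t Hz Ht) as (v & Hv & Ev). exists (Cexp v). split; [now apply Cmod_Cexp_lt_1 |].
    rewrite !H_Phi, <- Cexp_plus, Ev. f_equal. ring.
Qed.

End SpiralModel.

(** * Approximation by spirallike functions *)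

Lemma mult_conj (u : C) : u * Cconj u = RtoC (Cmod u * Cmod u).
Proof. rewrite Cmod_sqr. destruct u. apply C_ext; simpl; ring. Qed.

Lemma mobius_inverse (tau z : C) : disc 1 tau -> disc 1 z ->
  ((z - tau) / (1 - Cconj tau * z) - - tau) / (1 - Cconj (- tau) * ((z - tau) / (1 - Cconj tau * z))) = z.
Proof.
  intros Ht Hz. rewrite Copp_conj.
  assert (N1 := Cmod_conj_mult_lt z tau (Rlt_le _ _ Hz) Ht).
  assert (N2 := Cmod_conj_mult_lt tau tau (Rlt_le _ _ Ht) Ht).
  field. split; auto.
  replace (1 - Cconj tau * z - - Cconj tau * (z - tau)) with (1 - Cconj tau * tau) by ring. auto.
Qed.

Lemma cd_mobius (tau z : C) : disc 1 tau -> disc 1 z ->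
  cd (fun z => (z - tau) / (1 - Cconj tau * z)) z
     ((1 - tau * Cconj tau) / ((1 - Cconj tau * z) * (1 - Cconj tau * z))).
Proof.
  intros Ht Hz. assert (N1 := Cmod_conj_mult_lt z tau (Rlt_le _ _ Hz) Ht).
  eapply cd_eq.
  - apply cd_div; [apply cd_minus; [apply cd_id | apply cd_const] | | exact N1].
    apply cd_minus; [apply cd_const |]. apply cd_mult; [apply cd_const | apply cd_id].
  - cbv beta. field. auto.
Qed.

(* The spirallike function associated with the generator [(z - tau) (1 - conj tau z) p z]. *)
Lemma spirallike_of_generator (tau : C) (p : C -> C) : disc 1 tau -> tau <> 0 -> hol 1 p ->
  (forall z, disc 1 z -> (0 < Re (p z))%R) ->
  exists h E : C -> C, Sp tau h /\ hol 1 E /\ h 0 = 1 /\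
    forall z, disc 1 z -> E z <> 0 /\ h z = (z - tau) * E z /\
      cd h z ((1 - tau * Cconj tau) * p tau * E z / ((1 - Cconj tau * z) * p z)).
Proof.
  intros Ht Nt Hp Hre.
  assert (Hmt : disc 1 (- tau)) by (unfold disc; now rewrite Cmod_opp).
  set (m := fun z => (z - tau) / (1 - Cconj tau * z)).
  set (mi := fun z => (z - - tau) / (1 - Cconj (- tau) * z)).
  assert (Hm : forall z, disc 1 z -> disc 1 (m z)) by (intros; now apply mobius_disc).
  assert (Hmi : forall z, disc 1 z -> disc 1 (mi z)) by (intros; now apply mobius_disc).
  assert (E1 : forall z, disc 1 z -> mi (m z) = z) by (intros; now apply mobius_inverse).
  assert (E2 : forall z, disc 1 z -> m (mi z) = z).
  { intros z Hz. pose proof (mobius_inverse (- tau) z Hmt Hz) as K. rewrite Copp_conj, !Copp_conj in K.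
    replace (- - Cconj tau) with (Cconj tau) in K by ring. replace (- - tau) with tau in K by ring.
    unfold m, mi. rewrite Copp_conj. exact K. }
  assert (Heta : (0 < 1 - Cmod tau * Cmod tau)%R) by (unfold disc in Ht; pose proof (Cmod_ge_0 tau); nra).
  assert (Eeta : 1 - tau * Cconj tau = RtoC (1 - Cmod tau * Cmod tau)) by (rewrite mult_conj, RtoC_minus; reflexivity).
  (* The automorphism [m] takes [(z - tau) (1 - conj tau z) p z] to [(1 - |tau|^2)] times
     [m z * p z], a generator with attracting point 0. The multiplier is therefore
     [P 0 = (1 - |tau|^2) p tau]. *)
  set (P := fun z => RtoC (1 - Cmod tau * Cmod tau) * p (mi z)).
  assert (HP : hol 1 P).
  { intros z Hz. destruct (Hp (mi z) (Hmi z Hz)) as [d Hd]. eexists.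
    apply cd_mult; [apply cd_const |]. apply (cd_comp p mi); [exact Hd |].
    apply (cd_mobius (- tau) z Hmt Hz). }
  assert (HPre : forall z, disc 1 z -> (0 < Re (P z))%R).
  { intros z Hz. unfold P. rewrite re_scal_l. apply Rmult_lt_0_compat; auto. }
  assert (EP : forall z, disc 1 z -> P (m z) = RtoC (1 - Cmod tau * Cmod tau) * p z) by (intros z Hz; unfold P; now rewrite E1).
  assert (m0 : m 0 = - tau).
  { unfold m. rewrite Cmult_0_r. field. }
  assert (mtau : m tau = 0) by (unfold m, Cdiv; replace (tau - tau) with (RtoC 0) by ring; ring).
  assert (EP0 : P 0 = RtoC (1 - Cmod tau * Cmod tau) * p tau) by (rewrite <- mtau; now apply EP).
  destruct (spiral_model_exists P HP HPre) as (Psi & HPsi & Hder).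
  set (H := fun z => z * Cexp (Psi z)).
  assert (H0 : H (- tau) <> 0).
  { unfold H. apply Cmult_neq_0; [| apply Cexp_neq_0]. intros Z. apply Nt.
    replace tau with (- - tau) by ring. rewrite Z. ring. }
  assert (D0 := zero_in_disc).
  assert (ND : forall z, disc 1 z -> 1 - Cconj tau * z <> 0) by (intros z Hz; apply Cmod_conj_mult_lt; auto; now apply Rlt_le).
  (* As [m 0 = - tau], the division by [H (- tau)] gives the value 1 at 0. The second function is
     the zero-free cofactor of [z - tau], which makes the zero at [tau] simple. *)
  exists (fun z => H (m z) / H (- tau)), (fun z => Cexp (Psi (m z)) / ((1 - Cconj tau * z) * H (- tau))).
  assert (Hcd : forall z, disc 1 z -> cd (fun z => H (m z) / H (- tau)) z
    ((1 - tau * Cconj tau) * p tau * (Cexp (Psi (m z)) / ((1 - Cconj tau * z) * H (- tau))) / ((1 - Cconj tau * z) * p z))).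
  { intros z Hz. assert (Np : p z <> 0) by now apply re_pos_neq_0, Hre.
    assert (Nn : RtoC (1 - Cmod tau * Cmod tau) <> 0) by (intros Z; apply RtoC_inj in Z; lra).
    eapply cd_eq.
    - unfold Cdiv. apply cd_mult; [| apply cd_const].
      apply (cd_comp H m); [apply Hder, Hm, Hz | apply (cd_mobius tau z Ht Hz)].
    - cbv beta. rewrite EP, EP0, Eeta by auto. field. repeat split; auto. }
  assert (Hhol : hol 1 (fun z => H (m z) / H (- tau))) by (intros z Hz; eexists; now apply Hcd).
  split; [split; [split; [split |] |] |
    split; [| split; [| intros z Hz; split; [| split; [| now apply Hcd]]]]].
  - exact Hhol.
  - intros z w Hz Hw E. assert (EH : H (m z) = H (m w)).
    { replace (H (m z)) with (H (m z) / H (- tau) * H (- tau)) by (field; auto). rewrite E. field. auto. }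
    rewrite <- (E1 z Hz), <- (E1 w Hw). f_equal.
    apply (spiral_model_injective P HPre Psi HPsi Hder); auto.
  - exists (P 0). split; [now apply HPre |]. intros z t Hz Htt.
    destruct (spiral_model_invariant P HP HPre Psi HPsi Hder (m z) t (Hm z Hz) Htt) as (v & Hv & Ev).
    exists (mi v). split; [now apply Hmi |]. rewrite E2 by auto. unfold H. rewrite Ev. unfold Cdiv. ring.
  - unfold H. rewrite mtau. unfold Cdiv. ring.
  - intros z Hz. destruct (HPsi (m z) (Hm z Hz)) as [d Hd]. eexists.
    apply cd_div.
    + apply cd_Cexp_comp. exact (cd_comp Psi m z _ _ Hd (cd_mobius tau z Ht Hz)).
    + apply cd_mult; [| apply cd_const]. apply cd_minus; [apply cd_const |].
      apply cd_mult; [apply cd_const | apply cd_id].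
    + apply Cmult_neq_0; auto.
  - rewrite m0. field. auto.
  - unfold Cdiv. apply Cmult_neq_0; [apply Cexp_neq_0 |]. intros Z.
    assert (K : ((1 - Cconj tau * z) * H (- tau)) * / ((1 - Cconj tau * z) * H (- tau)) = 1) by (apply Cinv_r, Cmult_neq_0; auto).
    rewrite Z, Cmult_0_r in K. apply RtoC_inj in K. lra.
  - unfold H at 1, m at 1. field. split; auto.
Qed.

(** Supplies a member of the family for those [tau] that the construction does not reach; the limit
    does not see them. *)
Lemma Sp_affine (tau : C) : disc 1 tau -> Sp tau (fun z => z - tau).
Proof.
  intros Ht. split; [split |]; [split | | ring].
  - intros z _. eexists. apply cd_minus; [apply cd_id | apply cd_const].
  - intros z w _ _ E. replace z with (z - tau + tau) by ring. rewrite E. ring.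
  - exists 1. split; [simpl; lra |]. intros z t Hz Htt.
    assert (Ee : Cexp (- (RtoC t * 1)) = RtoC (exp (- t))).
    { rewrite Cmult_1_r. unfold Cexp. simpl. rewrite Ropp_0, cos_0, sin_0. apply C_ext; simpl; ring. }
    exists (tau + RtoC (exp (- t)) * (z - tau)). split.
    + apply (disc_seg 1 tau z); auto. exists (exp (- t)). split; auto.
      split; [apply Rlt_le, exp_pos |]. rewrite <- exp_0. destruct (Req_dec t 0) as [-> | N].
      * rewrite Ropp_0. lra.
      * apply Rlt_le, exp_increasing. lra.
    + rewrite Ee. ring.
Qed.

Definition to_one : (C -> Prop) -> Prop := within Delta (locally (T := C_UniformSpace) (RtoC 1)).

Instance to_one_filter : Filter to_one.
Proof. apply within_filter, locally_C_filter. Qed.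

Lemma to_one_iff (Q : C -> Prop) : to_one Q <->
  exists d, (0 < d)%R /\ forall tau, Delta tau -> (Cmod (1 - tau) < d)%R -> Q tau.
Proof.
  unfold to_one, within. rewrite locally_C_iff.
  split; intros (d & Hd & K); exists d; (split; [exact Hd |]).
  - intros tau Ht Hd'. apply K; auto. now rewrite Cmod_minus_sym.
  - intros tau Hd' Ht. apply K; auto. now rewrite Cmod_minus_sym.
Qed.

Instance to_one_proper : ProperFilter to_one.
Proof.
  split; [| apply to_one_filter].
  intros Q HQ. apply to_one_iff in HQ. destruct HQ as (d & Hd & K).
  assert (Hm : (0 < Rmin d 1 / 2)%R) by (pose proof (Rmin_glb_lt d 1 0 Hd Rlt_0_1); lra).
  pose proof (Rmin_l d 1). pose proof (Rmin_r d 1).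
  exists (RtoC (1 - Rmin d 1 / 2)). apply K.
  - unfold Delta. rewrite Cmod_R, Rabs_pos_eq; lra.
  - rewrite <- RtoC_minus, Cmod_R, Rabs_pos_eq; lra.
Qed.

(* A filter on pairs [(tau, z)], so that the lemmas on [ulim] apply to the convergence as [tau]
   tends to 1, uniformly on [|z| <= rho]. *)
Definition unif (rho : R) (Q : C * C -> Prop) : Prop :=
  to_one (fun tau => forall z, (Cmod z <= rho)%R -> Q (tau, z)).

Instance unif_filter (rho : R) : Filter (unif rho).
Proof.
  split.
  - unfold unif. apply filter_forall. auto.
  - unfold unif. intros Q Q' H H'. generalize (filter_and _ _ H H'). apply filter_imp. intros tau [K K'] z Hz. auto.
  - unfold unif. intros Q Q' HQ H. revert H. apply filter_imp. auto.
Qed.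

Lemma unif_fst (rho : R) (g l : C -> C) : ulim to_one g l -> ulim (unif rho) (fun x => g (fst x)) (fun x => l (fst x)).
Proof. intros H eps He. unfold unif. generalize (H eps He). apply filter_imp. auto. Qed.

Lemma unif_bdd (rho M : R) (l : C -> C) : (forall z, (Cmod z <= rho)%R -> (Cmod (l z) <= M)%R) ->
  ubdd (unif rho) (fun x => l (snd x)).
Proof. intros H. exists M. unfold unif. apply filter_forall. simpl. auto. Qed.

Lemma unif_snd (rho : R) (Q : C -> Prop) : (forall z, (Cmod z <= rho)%R -> Q z) -> unif rho (fun x => Q (snd x)).
Proof. intros H. unfold unif. apply filter_forall. simpl. auto. Qed.

(** For [q <> 0] the quotient is the inverse of [/ q + e], a point of the half-plane [Re >= e]; its
    modulus is thus at most [1 / e], and its real part stays nonnegative. *)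
Lemma re_bounded_quotient (q : C) (e : R) : (0 <= Re q)%R -> (0 <= e)%R ->
  1 + RtoC e * q <> 0 /\ (0 <= Re (q / (1 + RtoC e * q)))%R /\ (e * Cmod (q / (1 + RtoC e * q)) <= 1)%R.
Proof.
  intros Hq He.
  assert (Hre : (1 <= Re (1 + RtoC e * q))%R) by (rewrite re_plus, re_scal_l, re_RtoC; nra).
  assert (N : 1 + RtoC e * q <> 0) by (apply re_pos_neq_0; lra).
  assert (Np : (0 < Cmod (1 + RtoC e * q))%R) by now apply Cmod_gt_0.
  split; [exact N |]. split.
  - destruct q as [x y]. simpl in *. rewrite !Rmult_0_l, Rplus_0_l, Rminus_0_r in *.
    apply Rle_trans with ((x * (1 + e * x) + e * (y * y)) / ((1 + e * x) * (1 + e * x) + (e * y) * (e * y)))%R.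
    + apply Rdiv_le_0_compat; nra.
    + right. field. nra.
  - rewrite Cmod_div by auto. apply (Rmult_le_reg_r (Cmod (1 + RtoC e * q))); auto.
    unfold Rdiv. rewrite !Rmult_assoc, Rinv_l, Rmult_1_r, Rmult_1_l by lra.
    rewrite <- (Rabs_pos_eq e He) at 1. rewrite <- Cmod_R, <- Cmod_mult. apply Cmod_le_sqr. rewrite !Cmod_sqr.
    destruct q as [x y]. simpl in *. nra.
Qed.

Lemma re_real_div (b : R) (z : C) : z <> 0 -> Re (RtoC b / z) = (b * Re z / (Cmod z * Cmod z))%R.
Proof.
  intros Nz. assert (Np : (0 < Cmod z)%R) by now apply Cmod_gt_0.
  assert (Q : (0 < Re z * Re z + Im z * Im z)%R) by (rewrite <- Cmod_sqr; nra).
  rewrite Cmod_sqr. destruct z as [x y]. simpl in *. field. nra.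
Qed.

Lemma Cmod_Cexp_minus_1 (w : C) : (Cmod w <= 1)%R -> (Cmod (Cexp w - 1) <= 3 * Cmod w)%R.
Proof.
  intros Hw. rewrite <- Cexp_0. replace (Cmod w) with (Cmod (w - 0)) by (f_equal; ring).
  apply (segment_lip Cexp Cexp).
  - intros t _. apply cd_Cexp.
  - intros t Ht. rewrite Cmod_Cexp. eapply Rle_trans; [| apply exp_le_3].
    replace (0 + t * (w - 0)) with (RtoC t * w) by ring. rewrite re_scal_l.
    pose proof (re_le_Cmod w). pose proof (Rle_abs (Re w)).
    destruct (Req_dec (t * Re w) 1) as [-> | N]; [lra |]. apply Rlt_le, exp_increasing. nra.
Qed.

Section Approximation.

Variables (beta : R) (mu : C) (q f : C -> C).
Hypothesis beta_pos : (0 < beta)%R.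
Hypothesis mu_Omega : Omega_plus beta mu.
Hypothesis q_hol : hol 1 q.
Hypothesis q_re : forall z, disc 1 z -> (0 <= Re (q z))%R.
Hypothesis f_hol : hol 1 f.
Hypothesis f_dec : forall z, disc 1 z -> f z = - ((1 - z) * (1 - z)) * (RtoC (beta / 2) * cayley z + q z).

Let s0 : C := RtoC beta / mu.
(** A bound for [|s tau|^2] as soon as [eta tau * N <= 1], since then [|s tau| <= |s0| + 1]. *)
Let N : R := ((Cmod s0 + 1) * (Cmod s0 + 1))%R.
Let eta (tau : C) : C := 1 - tau * Cconj tau.
Let s (tau : C) : C := s0 + eta tau * RtoC N.
(* Chosen so that [eta tau * cayley (sig tau * tau)] tends to [2 / s0]; the term [eta * N] in [s]
   keeps [|sig tau| <= 1] also when [mu] lies on the circle [|mu - beta| = beta]. *)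
Let sig (tau : C) : C := (1 - eta tau * s tau) / tau.
(** The square root balances two demands: [ep] tends to 0, so that the cut-off disappears on compact
    sets, and [eta] is at most [2 * ep^2], so that [eta] times a function bounded by [1 / ep] still
    tends to 0. *)
Let ep (tau : C) : R := sqrt (Cmod (1 - tau)).

Let p (z : C) : C := RtoC (beta / 2) * cayley z + q z.
Let pt (tau z : C) : C := RtoC (beta / 2) * cayley (sig tau * z) + q z / (1 + RtoC (ep tau) * q z).

Let mu_neq_0 : mu <> 0.
Proof. apply mu_Omega. Qed.

(** [|mu - beta| <= beta] reads [|mu|^2 <= 2 * beta * Re mu]: inversion maps the disc [Omega_plus]
    onto this half-plane. *)
Let s0_re : (1 / 2 <= Re s0)%R.
Proof.
  destruct mu_Omega as [Hm _]. assert (Nm : (0 < Cmod mu)%R) by now apply Cmod_gt_0.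
  assert (E := re_real_div beta mu mu_neq_0). fold s0 in E.
  rewrite E. apply (Rmult_le_reg_r (Cmod mu * Cmod mu)); [nra |].
  unfold Rdiv. rewrite Rmult_assoc, (Rmult_assoc (beta * Re mu)), Rinv_l by nra.
  assert (K : (Cmod (mu - beta) * Cmod (mu - beta) <= beta * beta)%R).
  { apply Rmult_le_compat; auto using Cmod_ge_0. }
  rewrite (Cmod_sqr mu). rewrite Cmod_sqr in K. unfold Cminus in K. rewrite re_plus, re_opp, im_plus, im_opp, re_RtoC, im_RtoC in K.
  nra.
Qed.

Let eta_R (tau : C) : eta tau = RtoC (1 - Cmod tau * Cmod tau).
Proof. unfold eta. rewrite mult_conj, RtoC_minus. reflexivity. Qed.

Let good (tau : C) : Prop := disc 1 tau /\ tau <> 0 /\ ((1 - Cmod tau * Cmod tau) * N <= 1)%R.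

Let s_re (tau : C) : disc 1 tau -> (1 / 2 <= Re (s tau))%R.
Proof.
  intros Ht. unfold s. rewrite eta_R, <- RtoC_mult, re_plus, re_RtoC. unfold disc in Ht.
  pose proof (Cmod_ge_0 tau). assert (0 <= N)%R by (unfold N; pose proof (Cmod_ge_0 s0); nra).
  assert (0 <= 1 - Cmod tau * Cmod tau)%R by nra. nra.
Qed.

(** With [e = 1 - |tau|^2] the claim is [|1 - e s|^2 <= 1 - e], that is [1 + e |s|^2 <= 2 Re s] when
    [e > 0]. The correction [e * N] in [s] gives [2 Re s >= 1 + 2 e N], and [|s|^2 <= N]. *)
Let sig_le_1 (tau : C) : good tau -> (Cmod (sig tau) <= 1)%R.
Proof.
  intros (Ht & Nt & Hn). unfold sig. rewrite Cmod_div by auto.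
  assert (Np : (0 < Cmod tau)%R) by now apply Cmod_gt_0.
  apply (Rmult_le_reg_r (Cmod tau)); auto. unfold Rdiv. rewrite Rmult_assoc, Rinv_l, Rmult_1_r, Rmult_1_l by lra.
  apply Cmod_le_sqr. rewrite eta_R. unfold disc in Ht.
  set (e := (1 - Cmod tau * Cmod tau)%R) in *.
  assert (He : (0 <= e)%R) by (unfold e; nra).
  assert (HN : (0 <= N)%R) by (unfold N; pose proof (Cmod_ge_0 s0); nra).
  assert (Hs : (Cmod (s tau) * Cmod (s tau) <= N)%R).
  { assert (Cmod (s tau) <= Cmod s0 + 1)%R.
    { unfold s. rewrite eta_R. fold e. eapply Rle_trans; [apply Cmod_triangle |].
      rewrite Cmod_mult, !Cmod_R, !Rabs_pos_eq by auto. lra. }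
    unfold N. apply Rmult_le_compat; auto using Cmod_ge_0. }
  assert (Hr : (1 + 2 * (e * N) <= 2 * Re (s tau))%R).
  { unfold s. rewrite eta_R. fold e. rewrite <- RtoC_mult, re_plus, re_RtoC. lra. }
  replace (Cmod tau * Cmod tau)%R with (1 - e)%R by (unfold e; ring).
  assert (EE : (Cmod (1 - e * s tau) * Cmod (1 - e * s tau) = 1 - 2 * e * Re (s tau) + e * e * (Cmod (s tau) * Cmod (s tau)))%R).
  { rewrite !Cmod_sqr. destruct (s tau). simpl. ring. }
  rewrite EE.
  assert (e * (Cmod (s tau) * Cmod (s tau)) <= e * N)%R by (apply Rmult_le_compat_l; auto).
  assert (e * (1 + e * (Cmod (s tau) * Cmod (s tau))) <= e * (2 * Re (s tau)))%R by (apply Rmult_le_compat_l; auto; nra).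
  nra.
Qed.

Let cayley_re_pos (z : C) : disc 1 z -> (0 < Re (cayley z))%R.
Proof.
  intros Hz. pose proof (Delta_neq_1 z Hz) as Nz. rewrite cayley_re by auto.
  assert (0 < Cmod (1 - z))%R by now apply Cmod_gt_0. unfold disc in Hz. pose proof (Cmod_ge_0 z).
  apply Rdiv_lt_0_compat; nra.
Qed.

Let cayley_hol (z : C) : disc 1 z -> exists d, cd cayley z d.
Proof.
  intros Hz. eexists. unfold cayley. apply cd_div; [apply cd_plus; [apply cd_const | apply cd_id] | | now apply Delta_neq_1].
  apply cd_minus; [apply cd_const | apply cd_id].
Qed.

Let p_hol : hol 1 p.
Proof.
  intros z Hz. destruct (cayley_hol z Hz) as [d Hd]. destruct (q_hol z Hz) as [e He].
  eexists. unfold p. apply cd_plus; [| exact He]. apply cd_mult; [apply cd_const | exact Hd].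
Qed.

Let p_re (z : C) : disc 1 z -> (0 < Re (p z))%R.
Proof.
  intros Hz. unfold p. rewrite re_plus, re_scal_l. pose proof (cayley_re_pos z Hz). pose proof (q_re z Hz). nra.
Qed.

Let sig_disc (tau z : C) : good tau -> disc 1 z -> disc 1 (sig tau * z).
Proof.
  intros Ht Hz. pose proof (sig_le_1 tau Ht). unfold disc in *. rewrite Cmod_mult.
  pose proof (Cmod_ge_0 z). pose proof (Cmod_ge_0 (sig tau)). nra.
Qed.

Let pt_hol (tau : C) : good tau -> hol 1 (pt tau).
Proof.
  intros Ht z Hz. destruct (cayley_hol (sig tau * z) (sig_disc tau z Ht Hz)) as [d Hd].
  destruct (q_hol z Hz) as [e He].
  destruct (re_bounded_quotient (q z) (ep tau) (q_re z Hz) (sqrt_pos _)) as (Nq & _).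
  eexists. unfold pt. apply cd_plus.
  - apply cd_mult; [apply cd_const |]. apply (cd_comp cayley (fun z => sig tau * z)); [exact Hd |].
    apply cd_mult; [apply cd_const | apply cd_id].
  - apply cd_div; [exact He | | exact Nq]. apply cd_plus; [apply cd_const |].
    apply cd_mult; [apply cd_const | exact He].
Qed.

Let pt_re (tau z : C) : good tau -> disc 1 z -> (0 < Re (pt tau z))%R.
Proof.
  intros Ht Hz. unfold pt. rewrite re_plus, re_scal_l.
  pose proof (cayley_re_pos _ (sig_disc tau z Ht Hz)).
  destruct (re_bounded_quotient (q z) (ep tau) (q_re z Hz) (sqrt_pos _)) as (_ & Hq & _). nra.
Qed.

Let lim_tau : ulim to_one (fun tau => tau) (fun _ => RtoC 1).
Proof. intros eps He. apply to_one_iff. exists eps. split; auto. intros tau _ H. now rewrite Cmod_minus_sym. Qed.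

Let lim_conj : ulim to_one Cconj (fun _ => RtoC 1).
Proof.
  eapply ulim_ext; [| | exact (ulim_conj _ _ lim_tau)]; apply filter_forall; auto.
  intros _. apply C_ext; simpl; ring.
Qed.

Let lim_eta : ulim to_one eta (fun _ => RtoC 0).
Proof.
  apply (ulim_ext (fun tau => 1 - tau * Cconj tau) _ (fun _ => 1 - 1 * 1)).
  - now apply filter_forall.
  - apply filter_forall. intros. ring.
  - pose proof lim_tau. pose proof lim_conj. ulim_tac.
Qed.

Let lim_s : ulim to_one s (fun _ => s0).
Proof.
  apply (ulim_ext (fun tau => s0 + eta tau * RtoC N) _ (fun _ => s0 + 0 * RtoC N)).
  - now apply filter_forall.
  - apply filter_forall. intros. ring.
  - pose proof lim_eta. ulim_tac.
Qed.

Let lim_sig : ulim to_one sig (fun _ => RtoC 1).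
Proof.
  apply (ulim_ext (fun tau => (1 - eta tau * s tau) / tau) _ (fun _ => (1 - 0 * s0) / 1)).
  - now apply filter_forall.
  - apply filter_forall. intros. field.
  - pose proof lim_eta. pose proof lim_s. apply ulim_div; [ulim_tac | apply lim_tau | apply ubdd_const | apply ubdd_const |].
    apply filter_forall. intros _ Z. apply RtoC_inj in Z. lra.
Qed.

Let lim_ep : ulim to_one (fun tau => RtoC (ep tau)) (fun _ => RtoC 0).
Proof.
  intros eps He. apply to_one_iff. exists (eps * eps)%R. split; [nra |]. intros tau _ H.
  replace (ep tau - 0) with (RtoC (ep tau)) by ring. rewrite Cmod_R. unfold ep. rewrite Rabs_pos_eq by apply sqrt_pos.
  rewrite <- (sqrt_Rsqr eps) by lra. apply sqrt_lt_1_alt. unfold Rsqr. split; [apply Cmod_ge_0 | exact H].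
Qed.

Let good_ev : to_one good.
Proof.
  assert (HN : (1 <= N)%R) by (unfold N; pose proof (Cmod_ge_0 s0); nra).
  assert (He : (0 < / N)%R) by (apply Rinv_0_lt_compat; lra).
  generalize (lim_eta _ He). unfold to_one, within. apply filter_imp. intros tau H Ht. specialize (H Ht).
  rewrite eta_R in H. replace ((1 - Cmod tau * Cmod tau)%R - 0) with (RtoC (1 - Cmod tau * Cmod tau)) in H by ring.
  rewrite Cmod_R in H. unfold Delta in Ht. pose proof (Cmod_ge_0 tau).
  rewrite Rabs_pos_eq in H by nra.
  assert (Hn : ((1 - Cmod tau * Cmod tau) * N < 1)%R).
  { apply (Rmult_lt_compat_r N) in H; [| lra]. rewrite Rinv_l in H by lra. exact H. }
  repeat split; [exact Ht | | lra].
  intros Z. rewrite Z, Cmod_0 in Hn. lra.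
Qed.

Let mut (tau : C) : C := eta tau * pt tau tau.

(** Because [sig tau * tau = 1 - eta * s], the factor [eta * cayley (sig tau * tau)] equals
    [(2 - eta * s) / s] exactly; it tends to [2 / s0], and [beta / s0 = mu]. The part of [q] is at
    most [2 * ep]. *)
Let lim_mut : ulim to_one mut (fun _ => mu).
Proof.
  assert (Ns0 : s0 <> 0) by (apply re_pos_neq_0; lra).
  assert (A : ulim to_one (fun tau => RtoC (beta / 2) * ((2 - eta tau * s tau) / s tau)) (fun _ => RtoC (beta / 2) * ((2 - 0 * s0) / s0))).
  { pose proof lim_eta. pose proof lim_s. apply ulim_mult; [apply ulim_refl | | apply ubdd_const | apply ubdd_const].
    apply ulim_div; [ulim_tac | auto | apply ubdd_const | apply ubdd_const | now apply filter_forall]. }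
  assert (B : ulim to_one (fun tau => eta tau * (q tau / (1 + RtoC (ep tau) * q tau))) (fun _ => RtoC 0)).
  { intros eps He. generalize (lim_ep (eps / 2)%R ltac:(lra)). unfold to_one, within. apply filter_imp.
    intros tau H Ht. specialize (H Ht).
    replace (ep tau - 0) with (RtoC (ep tau)) in H by ring. rewrite Cmod_R, Rabs_pos_eq in H by apply sqrt_pos.
    destruct (re_bounded_quotient (q tau) (ep tau) (q_re tau Ht) (sqrt_pos _)) as (_ & _ & Hq).
    replace (eta tau * (q tau / (1 + ep tau * q tau)) - 0) with (eta tau * (q tau / (1 + ep tau * q tau))) by ring.
    rewrite Cmod_mult. set (X := Cmod (q tau / (1 + ep tau * q tau))) in *.
    assert (HX : (0 <= X)%R) by apply Cmod_ge_0.
    assert (Hep : (ep tau * ep tau = Cmod (1 - tau))%R) by (apply sqrt_sqrt, Cmod_ge_0).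
    unfold Delta in Ht. pose proof (Cmod_ge_0 tau).
    assert (Heta : (Cmod (eta tau) <= 2 * (ep tau * ep tau))%R).
    { rewrite eta_R, Cmod_R, Rabs_pos_eq, Hep by nra.
      pose proof (Cmod_triangle_rev 1 tau) as T. rewrite Cmod_1 in T. nra. }
    assert (0 <= ep tau)%R by apply sqrt_pos.
    apply Rle_lt_trans with (2 * (ep tau * ep tau) * X)%R; [apply Rmult_le_compat_r; auto |]. nra. }
  eapply ulim_ext; [| | exact (ulim_plus _ _ _ _ A B)].
  - generalize good_ev. apply filter_imp. intros tau (Ht & Nt & _).
    assert (Ns : s tau <> 0) by (apply re_pos_neq_0; pose proof (s_re tau Ht); lra).
    assert (Ne : eta tau <> 0).
    { rewrite eta_R. intros Z. apply RtoC_inj in Z. unfold disc in Ht. pose proof (Cmod_ge_0 tau). nra. }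
    unfold mut, pt, cayley. replace (sig tau * tau) with (1 - eta tau * s tau) by (unfold sig; field; auto).
    replace (1 - (1 - eta tau * s tau)) with (eta tau * s tau) by ring.
    replace (1 + (1 - eta tau * s tau)) with (2 - eta tau * s tau) by ring.
    generalize (q tau / (1 + ep tau * q tau)). intros X. field. auto.
  - apply filter_forall. intros _. unfold s0. rewrite RtoC_div by lra.
    assert (RtoC beta <> 0) by (intros Z; apply RtoC_inj in Z; lra). field. auto.
Qed.

Let ft (tau z : C) : C := (z - tau) * (1 - Cconj tau * z) * pt tau z.

Let f_neq_0 (z : C) : disc 1 z -> f z <> 0.
Proof.
  intros Hz. rewrite f_dec by auto. pose proof (Delta_neq_1 z Hz).
  replace (- ((1 - z) * (1 - z))) with (- (1) * ((1 - z) * (1 - z))) by ring.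
  apply Cmult_neq_0; [| now apply re_pos_neq_0, p_re]. apply Cmult_neq_0; [| now apply Cmult_neq_0].
  intros Z. apply (f_equal Re) in Z. simpl in Z. lra.
Qed.

Let f_inv (z : C) : disc 1 z -> / f z = - (/ (1 - z) * / (1 - z)) * / p z.
Proof.
  intros Hz. rewrite f_dec by auto. fold (p z). field. split; [now apply re_pos_neq_0, p_re | now apply Delta_neq_1].
Qed.

Section Disc.
Variable rho : R.
Hypothesis Hrho : (0 <= rho < 1)%R.

Let in_disc (z : C) : (Cmod z <= rho)%R -> disc 1 z.
Proof. unfold disc. lra. Qed.

Let bdd_z : ubdd (unif rho) (fun x => snd x).
Proof. exact (unif_bdd rho rho (fun z => z) (fun z Hz => Hz)). Qed.

Let bdd_inv_1z : ubdd (unif rho) (fun x => / (1 - snd x)).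
Proof.
  apply (unif_bdd rho (/ (1 - rho)) (fun z => / (1 - z))). intros z Hz.
  rewrite Cmod_inv by now apply Delta_neq_1, in_disc. apply Rinv_le_contravar; [lra |].
  pose proof (Cmod_triangle_rev 1 z) as T. rewrite Cmod_1 in T. lra.
Qed.

Let bdd_harnack (g : C -> C) : hol 1 g -> (forall z, disc 1 z -> (0 <= Re (g z))%R) -> ubdd (unif rho) (fun x => g (snd x)).
Proof.
  intros Hg Hre. apply (unif_bdd rho (2 * Cmod (g 0) / (1 - rho)) g). intros z Hz.
  pose proof (harnack_bound g z Hg Hre (in_disc z Hz)) as B. pose proof (Cmod_ge_0 (g z)).
  apply (Rmult_le_reg_r (1 - rho)); [lra |]. unfold Rdiv. rewrite Rmult_assoc, Rinv_l, Rmult_1_r by lra. nra.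
Qed.

Let bdd_p : ubdd (unif rho) (fun x => p (snd x)).
Proof. apply bdd_harnack; [exact p_hol |]. intros z Hz. now apply Rlt_le, p_re. Qed.

Let bdd_pinv : ubdd (unif rho) (fun x => / p (snd x)).
Proof.
  apply (bdd_harnack (fun z => / p z)).
  - intros z Hz. destruct (p_hol z Hz) as [d Hd]. eexists. apply cd_inv; [exact Hd |]. now apply re_pos_neq_0, p_re.
  - intros z Hz. now apply Rlt_le, re_inv_pos, p_re.
Qed.

Let lim_pt : ulim (unif rho) (fun x => pt (fst x) (snd x)) (fun x => p (snd x)).
Proof.
  assert (Us := unif_fst rho _ _ lim_sig). assert (Ue := unif_fst rho _ _ lim_ep). cbv beta in Us, Ue.
  assert (bdd_q := bdd_harnack q q_hol q_re).
  assert (A : ulim (unif rho) (fun x => sig (fst x) * snd x) (fun x => 1 * snd x)) by ulim_tac.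
  assert (B : ulim (unif rho) (fun x => cayley (sig (fst x) * snd x)) (fun x => (1 + 1 * snd x) / (1 - 1 * snd x))).
  { unfold cayley. apply ulim_div; [ulim_tac | ulim_tac | ulim_tac | |].
    - destruct bdd_inv_1z as [M HM]. exists M. revert HM. apply filter_imp. intros x. now rewrite Cmult_1_l.
    - apply (unif_snd rho (fun z => 1 - 1 * z <> 0)). intros z Hz. rewrite Cmult_1_l. now apply Delta_neq_1, in_disc. }
  assert (D : ulim (unif rho) (fun x => q (snd x) / (1 + RtoC (ep (fst x)) * q (snd x)))
                              (fun x => q (snd x) / (1 + 0 * q (snd x)))).
  { apply ulim_div; [apply ulim_refl | ulim_tac | exact bdd_q | |].
    - exists 1%R. unfold unif. apply filter_forall. intros tau z _. rewrite Cmult_0_l, Cplus_0_r, Cmod_inv by apply C1_nz.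
      rewrite Cmod_1, Rinv_1. lra.
    - apply filter_forall. intros x. rewrite Cmult_0_l, Cplus_0_r. apply C1_nz. }
  assert (E : ulim (unif rho)
     (fun x => RtoC (beta / 2) * cayley (sig (fst x) * snd x) + q (snd x) / (1 + RtoC (ep (fst x)) * q (snd x)))
     (fun x => RtoC (beta / 2) * ((1 + 1 * snd x) / (1 - 1 * snd x)) + q (snd x) / (1 + 0 * q (snd x)))).
  { apply ulim_plus; [| exact D]. apply ulim_mult; [apply ulim_refl | exact B | apply ubdd_const |].
    unfold Cdiv. apply ubdd_mult; [ulim_tac |].
    destruct bdd_inv_1z as [M HM]. exists M. revert HM. apply filter_imp. intros x. now rewrite Cmult_1_l. }
  eapply ulim_ext; [| | exact E].
  - apply filter_forall. reflexivity.
  - apply filter_forall. intros x. unfold p, cayley. rewrite !Cmult_1_l, Cmult_0_l, Cplus_0_r.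
    f_equal. field.
Qed.

Lemma bdd_finv : ubdd (unif rho) (fun x => / f (snd x)).
Proof.
  assert (K : ubdd (unif rho) (fun x => - (/ (1 - snd x) * / (1 - snd x)) * / p (snd x))).
  { apply ubdd_mult; [| exact bdd_pinv]. apply ubdd_opp. now apply ubdd_mult. }
  destruct K as [M HM]. exists M. unfold unif in *. revert HM. apply filter_imp. intros tau H z Hz.
  simpl in *. rewrite f_inv by now apply in_disc. now apply H.
Qed.

(** The two sides are the logarithmic derivatives of the approximant and of its limit; the limit of
    [ft] is [- (1 - z)^2 * p z], which is [f]. *)
Lemma lim_log_derivative : ulim (unif rho) (fun x => mut (fst x) / ft (fst x) (snd x)) (fun x => mu / f (snd x)).
Proof.
  apply ulim_div; [exact (unif_fst rho _ _ lim_mut) | | apply ubdd_const | apply bdd_finv |].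
  - assert (Ut := unif_fst rho _ _ lim_tau). assert (Uc := unif_fst rho _ _ lim_conj). cbv beta in Ut, Uc.
    pose proof lim_pt. pose proof bdd_p.
    eapply ulim_ext; [apply filter_forall; reflexivity | |].
    2:{ unfold ft. apply ulim_mult; [apply ulim_mult | apply lim_pt | | exact bdd_p].
        - apply ulim_minus; [apply ulim_refl | exact Ut].
        - apply ulim_minus; [apply ulim_refl | apply ulim_mult; [exact Uc | apply ulim_refl | apply ubdd_const | exact bdd_z]].
        - apply ubdd_plus; [exact bdd_z | apply ubdd_opp, ubdd_const].
        - apply ubdd_plus; [apply ubdd_const | apply ubdd_opp, ubdd_mult; [apply ubdd_const | exact bdd_z]].
        - apply ubdd_mult; [apply ubdd_plus; [exact bdd_z | apply ubdd_opp, ubdd_const] |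
            apply ubdd_plus; [apply ubdd_const | apply ubdd_opp, ubdd_mult; [apply ubdd_const | exact bdd_z]]]. }
    apply (unif_snd rho (fun z => (z - 1) * (1 - 1 * z) * p z = f z)). intros z Hz.
    rewrite f_dec by now apply in_disc. fold (p z). ring.
  - apply (unif_snd rho (fun z => f z <> 0)). intros z Hz. now apply f_neq_0, in_disc.
Qed.

End Disc.

Variable L : C -> C.
Hypothesis L_0 : L 0 = 0.
Hypothesis L_der : forall z, disc 1 z -> cd L z (mu / f z).

Let ft_neq_0 (tau z : C) : good tau -> disc 1 z -> z <> tau -> ft tau z <> 0.
Proof.
  intros Ht Hz N1. unfold ft. apply Cmult_neq_0; [apply Cmult_neq_0 |].
  - now apply Cminus_eq_contra.
  - apply Cmod_conj_mult_lt; [now apply Rlt_le | apply Ht].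
  - now apply re_pos_neq_0, pt_re.
Qed.

(* The quotient of [h] by [exp L] has logarithmic derivative [mut / ft - mu / f]. *)
Let quotient_close (tau : C) (h : C -> C) (r e : R) : good tau -> (0 < r < 1)%R -> (r < Cmod tau)%R -> (e <= 1)%R ->
  h 0 = 1 -> (forall z, disc r z -> cd h z (mut tau / ft tau z * h z)) ->
  (forall z, (Cmod z <= r)%R -> (Cmod (mut tau / ft tau z - mu / f z) <= e)%R) ->
  forall z, disc r z -> (Cmod (h z / Cexp (L z) - 1) <= 3 * e)%R.
Proof.
  intros Ht Hr Htau He h0 Hh HD z Hz.
  assert (D1 : forall w, disc r w -> disc 1 w) by (unfold disc; intros; lra).
  assert (Nt : forall w, disc r w -> w <> tau) by (unfold disc; intros w Hw ->; lra).
  assert (K : forall w, disc r w -> exists d, cd (fun z => mut tau / ft tau z - mu / f z) w d).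
  { intros w Hw. destruct (pt_hol tau Ht w (D1 w Hw)) as [d Hd]. destruct (f_hol w (D1 w Hw)) as [d' Hd'].
    assert (Hft : exists e0, cd (ft tau) w e0).
    { eexists. apply (cd_mult (fun z => (z - tau) * (1 - Cconj tau * z)) (pt tau)); [| exact Hd].
      apply (cd_mult (fun z => z - tau) (fun z => 1 - Cconj tau * z)).
      - apply cd_minus; [apply cd_id | apply cd_const].
      - apply cd_minus; [apply cd_const | apply cd_mult; [apply cd_const | apply cd_id]]. }
    destruct Hft as [e0 He0]. eexists. apply (cd_minus (fun z => mut tau / ft tau z) (fun z => mu / f z)).
    - apply (cd_div (fun _ => mut tau) (ft tau)); [apply cd_const | exact He0 |].
      apply ft_neq_0; auto.
    - apply (cd_div (fun _ => mu) f); [apply cd_const | exact Hd' |]. auto. }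
  destruct (primitive_disc r (fun z => mut tau / ft tau z - mu / f z) 0 0) as (A & A0 & HA).
  { lra. }
  { intros w Hw. destruct (K w Hw) as [d Hd]. exact (cd_cont _ _ _ Hd). }
  { intros w Hw _ _. exact (K w Hw). }
  assert (D0 : disc r 0) by (unfold disc; rewrite Cmod_0; lra).
  assert (Hseg : forall t, (0 <= t <= 1)%R -> disc r (0 + RtoC t * (z - 0))).
  { intros t Ht1. apply (disc_seg r 0 z); auto. exists t. auto. }
  assert (E : h z / Cexp (L z) = Cexp (A z)).
  { assert (C0 : h z * Cexp (- (L z + A z)) = h 0 * Cexp (- (L 0 + A 0))).
    { apply (segment_const (fun w => h w * Cexp (- (L w + A w))) 0 z). intros t Ht1.
      set (w := 0 + RtoC t * (z - 0)). specialize (Hseg t Ht1). fold w in Hseg.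
      eapply cd_eq.
      - apply cd_mult; [apply Hh; exact Hseg |]. apply cd_Cexp_comp, cd_opp, cd_plus; [apply L_der; auto | apply HA; auto].
      - cbv beta. ring. }
    rewrite h0, L_0, A0 in C0. replace (- (0 + 0)) with (RtoC 0) in C0 by ring.
    rewrite Cexp_0, Cexp_opp, Cexp_plus in C0.
    pose proof (Cexp_neq_0 (L z)). pose proof (Cexp_neq_0 (A z)).
    transitivity (h z * / (Cexp (L z) * Cexp (A z)) * Cexp (A z)); [field; auto | rewrite C0; field]. }
  rewrite E.
  assert (HAz : (Cmod (A z) <= e)%R).
  { replace (A z) with (A z - A 0) by (rewrite A0; ring).
    apply Rle_trans with (e * Cmod (z - 0))%R.
    - apply (segment_lip A (fun z => mut tau / ft tau z - mu / f z)).
      + intros t Ht1. apply HA, Hseg, Ht1.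
      + intros t Ht1. apply HD. now apply Rlt_le, Hseg.
    - replace (z - 0) with z by ring. unfold disc in Hz. pose proof (Cmod_ge_0 z).
      assert (0 <= e)%R by (eapply Rle_trans; [apply Cmod_ge_0 | apply (HD 0)]; rewrite Cmod_0; lra). nra. }
  pose proof (Cmod_Cexp_minus_1 (A z) ltac:(lra)). lra.
Qed.

(** The three limits have separate uses: the functions themselves for the spirallike approximation,
    their inverses for the meromorphic one, and the derivatives for the Hurwitz argument. *)
Lemma spirallike_approximation : exists H E : C -> C -> C,
  (forall tau, disc 1 tau -> Sp tau (H tau) /\ hol 1 (E tau) /\
     forall z, disc 1 z -> E tau z <> 0 /\ H tau z = (z - tau) * E tau z) /\
  forall rho, (0 <= rho < 1)%R ->
    ulim (unif rho) (fun x => H (fst x) (snd x)) (fun x => Cexp (L (snd x))) /\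
    ulim (unif rho) (fun x => / H (fst x) (snd x)) (fun x => / Cexp (L (snd x))) /\
    ulim (unif rho) (fun x => C_derive (H (fst x)) (snd x)) (fun x => mu / f (snd x) * Cexp (L (snd x))).
Proof.
  (* The approximants are given by an existence statement for each [tau]; choice assembles them into
     a family. For [tau] that is not [good] the affine function is used. *)
  destruct (functional_choice (fun (tau : C) (hE : (C -> C) * (C -> C)) =>
    disc 1 tau -> (Sp tau (fst hE) /\ hol 1 (snd hE) /\
     (forall z, disc 1 z -> snd hE z <> 0 /\ fst hE z = (z - tau) * snd hE z)) /\
     (good tau -> fst hE 0 = 1 /\ forall z, disc 1 z ->
        cd (fst hE) z (mut tau * snd hE z / ((1 - Cconj tau * z) * pt tau z))))) as [hE Hspec].
  { intros tau. destruct (classic (good tau)) as [Hg | Hg].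
    - destruct (spirallike_of_generator tau (pt tau)) as (h & E & H1 & H2 & H3 & H4).
      + apply Hg.
      + apply Hg.
      + now apply pt_hol.
      + intros z Hz. now apply pt_re.
      + exists (h, E). intros _. simpl. split; [split; [exact H1 | split; [exact H2 |]] | intros _; split; [exact H3 |]].
        * intros z Hz. destruct (H4 z Hz) as (K1 & K2 & _). auto.
        * intros z Hz. apply H4, Hz.
    - exists ((fun z : C => z - tau), (fun _ : C => RtoC 1)). intros Ht. simpl. split; [| tauto].
      split; [now apply Sp_affine | split].
      + intros z _. exists 0. apply cd_const.
      + intros z _. split; [apply C1_nz | ring]. }
  exists (fun tau => fst (hE tau)), (fun tau => snd (hE tau)). split.
  { intros tau Ht. apply (Hspec tau Ht). }
  (* A radius strictly between [rho] and 1: the comparison is made on the open disc of radius [r],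
     which contains the closed disc of radius [rho], and [tau] must lie outside it. *)
  intros rho Hrho. set (r := ((1 + rho) / 2)%R). assert (Hr : (rho < r < 1)%R) by (unfold r; lra).
  assert (Hfar : to_one (fun tau => (r < Cmod tau)%R)).
  { assert (H1r : (0 < 1 - r)%R) by lra. generalize (lim_tau _ H1r). apply filter_imp. intros tau H.
    pose proof (Cmod_triangle_rev 1 tau) as T. rewrite Cmod_1, Cmod_minus_sym in T. lra. }
  assert (Hder : forall tau, good tau -> (r < Cmod tau)%R -> forall z, disc r z ->
      cd (fst (hE tau)) z (mut tau / ft tau z * fst (hE tau) z)).
  { intros tau Ht Hf z Hz. destruct (Hspec tau (proj1 Ht)) as ((_ & _ & K1) & K2).
    assert (Dz : disc 1 z) by (unfold disc in *; lra).
    destruct (K1 z Dz) as [_ ->]. eapply cd_eq; [apply (K2 Ht); auto |].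
    unfold ft. field. repeat split.
    - now apply re_pos_neq_0, pt_re.
    - apply Cmod_conj_mult_lt; [now apply Rlt_le | apply Ht].
    - apply Cminus_eq_contra. intros ->. unfold disc in Hz. lra. }
  assert (HB : exists B, forall z, (Cmod z <= rho)%R -> (Cmod (L z) <= B)%R).
  { destruct (bdd_finv rho Hrho) as [M HM]. unfold unif in HM. destruct (filter_ex _ HM) as [tau0 HM0]. simpl in HM0.
    exists (Cmod mu * M)%R. intros z Hz. replace (L z) with (L z - L 0) by (rewrite L_0; ring).
    assert (Hs : forall t, (0 <= t <= 1)%R -> (Cmod (0 + RtoC t * (z - 0)) <= rho)%R).
    { intros t Ht1. replace (0 + t * (z - 0)) with (RtoC t * z) by ring. rewrite Cmod_mult, Cmod_R, Rabs_pos_eq by lra.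
      pose proof (Cmod_ge_0 z). nra. }
    apply Rle_trans with (Cmod mu * M * Cmod (z - 0))%R.
    - apply (segment_lip L (fun z => mu / f z)).
      + intros t Ht1. apply L_der. unfold disc. specialize (Hs t Ht1). lra.
      + intros t Ht1. unfold Cdiv. rewrite Cmod_mult. apply Rmult_le_compat_l; [apply Cmod_ge_0 |]. apply HM0, Hs, Ht1.
    - replace (z - 0) with z by ring. pose proof (Cmod_ge_0 z).
      assert (0 <= M)%R by (eapply Rle_trans; [apply Cmod_ge_0 | apply (HM0 z Hz)]).
      pose proof (Cmod_ge_0 mu). assert (0 <= Cmod mu * M)%R by nra. nra. }
  destruct HB as [B HB].
  assert (Hexp : forall w, (Cmod w <= B)%R -> (Cmod (Cexp w) <= exp B)%R).
  { intros w Hw. rewrite Cmod_Cexp. pose proof (re_le_Cmod w). pose proof (Rle_abs (Re w)).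
    destruct (Req_dec (Re w) B) as [-> | N1]; [lra |]. apply Rlt_le, exp_increasing. lra. }
  assert (bL : ubdd (unif rho) (fun x => Cexp (L (snd x)))).
  { apply (unif_bdd rho (exp B) (fun z => Cexp (L z))). auto. }
  assert (bLi : ubdd (unif rho) (fun x => / Cexp (L (snd x)))).
  { apply (unif_bdd rho (exp B) (fun z => / Cexp (L z))). intros z Hz. rewrite <- Cexp_opp.
    apply Hexp. rewrite Cmod_opp. auto. }
  assert (Lk : ulim (unif rho) (fun x => fst (hE (fst x)) (snd x) / Cexp (L (snd x))) (fun _ => RtoC 1)).
  (* [quotient_close] turns an error [e <= 1] of the logarithmic derivatives into an error [3 * e]
     of the quotient. *)
  { intros eps He. set (e := Rmin (eps / 4) 1).
    assert (He0 : (0 < e)%R) by (apply Rmin_glb_lt; lra).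
    assert (He1 : (e <= eps / 4)%R) by apply Rmin_l. assert (He2 : (e <= 1)%R) by apply Rmin_r.
    unfold unif. generalize (filter_and _ _ (filter_and _ _ good_ev Hfar) (lim_log_derivative r ltac:(lra) e He0)).
    apply filter_imp. intros tau [[Hg Hf] HD] z Hz. simpl in *.
    destruct (Hspec tau (proj1 Hg)) as (_ & K2).
    apply Rle_lt_trans with (3 * e)%R; [| lra].
    apply (quotient_close tau (fst (hE tau)) r e); auto; try lra.
    - apply (K2 Hg).
    - intros w Hw. now apply Rlt_le, HD.
    - unfold disc. lra. }
  assert (LH : ulim (unif rho) (fun x => fst (hE (fst x)) (snd x)) (fun x => Cexp (L (snd x)))).
  { eapply ulim_ext; [| | exact (ulim_mult _ _ _ _ Lk (ulim_refl (fun x => Cexp (L (snd x)))) (ubdd_const _) bL)].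
    - apply filter_forall. intros x. cbv beta. field. apply Cexp_neq_0.
    - apply filter_forall. intros x. cbv beta. ring. }
  split; [exact LH |]. split.
  { apply ulim_inv; auto. apply filter_forall. intros x. apply Cexp_neq_0. }
  assert (bD : ubdd (unif rho) (fun x => mu / f (snd x))).
  { unfold Cdiv. apply ubdd_mult; [apply ubdd_const | now apply bdd_finv]. }
  eapply ulim_ext; [| | exact (ulim_mult _ _ _ _ (lim_log_derivative rho Hrho) LH bD bL)].
  - unfold unif. generalize (filter_and _ _ good_ev Hfar). apply filter_imp. intros tau [Hg Hf] z Hz. simpl in *.
    symmetry. apply is_C_derive_unique. apply Hder; auto. unfold disc. lra.
  - apply filter_forall. reflexivity.
Qed.

End Approximation.

(** * Univalence of the solutions *)

Section Solutions.

Variables (f : C -> C) (beta : R) (q : C -> C) (Phi : C -> C).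
Hypothesis f_Gplus1 : Gplus1 f beta.
Hypothesis q_hol : hol 1 q.
Hypothesis q_re : forall z, disc 1 z -> (0 <= Re (q z))%R.
Hypothesis f_dec : forall z, disc 1 z -> f z = - ((1 - z) * (1 - z)) * (RtoC (beta / 2) * cayley z + q z).
Hypothesis f_neq_0 : forall z, disc 1 z -> f z <> 0.
Hypothesis Phi_0 : Phi 0 = 0.
Hypothesis Phi_der : forall z, disc 1 z -> cd Phi z (/ f z).

Let beta_pos : (0 < beta)%R := Gplus1_pos f beta f_Gplus1.

Let f_hol : hol 1 f.
Proof. exact (generator_hol f (Gplus1_G f beta f_Gplus1)). Qed.

Let L_der (mu z : C) : disc 1 z -> cd (fun z => mu * Phi z) z (mu / f z).
Proof.
  intros Hz. eapply cd_eq; [apply cd_mult; [apply cd_const | apply Phi_der, Hz] |]. unfold Cdiv. ring.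
Qed.

Let L_0 (mu : C) : mu * Phi 0 = 0.
Proof. rewrite Phi_0. ring. Qed.

Lemma approximants (mu : C) : Omega_plus beta mu -> exists H E : C -> C -> C,
  (forall tau, disc 1 tau -> Sp tau (H tau) /\ hol 1 (E tau) /\
     forall z, disc 1 z -> E tau z <> 0 /\ H tau z = (z - tau) * E tau z) /\
  forall rho, (0 <= rho < 1)%R ->
    ulim (unif rho) (fun x => H (fst x) (snd x)) (fun x => Cexp (mu * Phi (snd x))) /\
    ulim (unif rho) (fun x => / H (fst x) (snd x)) (fun x => / Cexp (mu * Phi (snd x))) /\
    ulim (unif rho) (fun x => C_derive (H (fst x)) (snd x)) (fun x => mu / f (snd x) * Cexp (mu * Phi (snd x))).
Proof.
  intros Hmu. apply (spirallike_approximation beta mu q f beta_pos Hmu q_hol q_re f_hol f_dec (fun z => mu * Phi z)); auto.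
Qed.

(* Hurwitz's theorem for the approximants; as the derivative of the limit does not vanish,
   the quantitative local surjectivity of the approximants suffices. *)
Lemma solution_injective (mu z1 z2 : C) : Omega_plus beta mu -> disc 1 z1 -> disc 1 z2 ->
  Cexp (mu * Phi z1) = Cexp (mu * Phi z2) -> z1 = z2.
Proof.
  intros Hmu H1 H2 E. destruct (Ceq_dec z1 z2) as [|Nz]; auto. exfalso.
  destruct (approximants mu Hmu) as (H & E0 & HSp & Hlim).
  set (m := Rmax (Cmod z1) (Cmod z2)).
  assert (Hm1 : (Cmod z1 <= m)%R) by apply Rmax_l. assert (Hm2 : (Cmod z2 <= m)%R) by apply Rmax_r.
  assert (Hm : (m < 1)%R) by (apply Rmax_lub_lt; auto). pose proof (Cmod_ge_0 z1) as Hz10.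
  set (rho := ((1 + m) / 2)%R). assert (Hrho : (0 <= rho < 1)%R) by (unfold rho; lra).
  destruct (Hlim rho Hrho) as (LH & _ & LD).
  set (d1 := fun z => mu / f z * Cexp (mu * Phi z)). set (c := d1 z1).
  assert (Hc : c <> 0).
  { unfold c, d1, Cdiv. apply Cmult_neq_0; [| apply Cexp_neq_0]. apply Cmult_neq_0; [apply Hmu |].
    intros Z. assert (K : f z1 * / f z1 = 1) by (apply Cinv_r; auto). rewrite Z, Cmult_0_r in K. apply RtoC_inj in K. lra. }
  assert (Hc0 : (0 < Cmod c)%R) by now apply Cmod_gt_0.
  assert (Hcont : ccont d1 z1).
  { destruct (f_hol z1 H1) as [d Hd]. eapply cd_cont. unfold d1.
    apply cd_mult; [apply cd_div; [apply cd_const | exact Hd | auto] | apply cd_Cexp_comp, L_der, H1]. }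
  destruct (proj1 (ccont_iff d1 z1) Hcont (Cmod c / 4)%R ltac:(lra)) as (dl & Hdl & Hd1).
  assert (Nzp : (0 < Cmod (z1 - z2))%R) by now apply Cmod_gt_0, Cminus_eq_contra.
  (* The three bounds keep the derivative of the limit close to [c], the disc around [z1] inside
     [|z| <= rho], and [z2] outside that disc. *)
  set (r := Rmin (dl / 2) (Rmin ((1 - m) / 2) (Cmod (z1 - z2) / 2))).
  assert (Hr : (0 < r)%R) by (repeat apply Rmin_glb_lt; lra).
  assert (Hr1 : (r <= dl / 2)%R) by apply Rmin_l.
  assert (Hr2 : (r <= (1 - m) / 2)%R) by (eapply Rle_trans; [apply Rmin_r | apply Rmin_l]).
  assert (Hr3 : (r <= Cmod (z1 - z2) / 2)%R) by (eapply Rle_trans; [apply Rmin_r | apply Rmin_r]).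
  assert (Hball : forall w, (Cmod (w - z1) <= r)%R -> (Cmod w <= rho)%R).
  { intros w Hw. pose proof (Cmod_triangle_rev w z1). unfold rho. lra. }
  assert (e1 : (0 < Cmod c / 4)%R) by lra. assert (e2 : (0 < Cmod c * r / 8)%R) by nra.
  pose proof (LD _ e1) as KD. pose proof (LH _ e2) as KH. unfold unif in KD, KH.
  assert (HDelta : to_one Delta) by (apply to_one_iff; exists 1%R; split; [lra | auto]).
  destruct (filter_ex _ (filter_and _ _ HDelta (filter_and _ _ KD KH))) as (tau & Htau & HD & HH).
  destruct (HSp tau Htau) as ([[[Hhol Hinj] _] _] & _). simpl in HD, HH.
  (* The approximant takes the value [H tau z2] also at a point [v] near [z1]. Univalence gives
     [v = z2], which is too far away. *)
  destruct (local_surj (H tau) (C_derive (H tau)) z1 c (H tau z2) r) as (v & Hv & Ev); auto.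
  - intros w Hw. apply C_derive_cd, Hhol. unfold Delta. specialize (Hball w Hw). lra.
  - intros w Hw. specialize (HD w (Hball w Hw)). fold (d1 w) in HD. specialize (Hd1 w ltac:(lra)). fold c in Hd1.
    replace (C_derive (H tau) w - c) with ((C_derive (H tau) w - d1 w) + (d1 w - c)) by ring.
    eapply Rle_trans; [apply Cmod_triangle |]. lra.
  - assert (K1 := HH z1 ltac:(unfold rho; lra)). assert (K2 := HH z2 ltac:(unfold rho; lra)). rewrite E in K1.
    replace (H tau z2 - H tau z1) with ((H tau z2 - Cexp (mu * Phi z2)) - (H tau z1 - Cexp (mu * Phi z2))) by ring.
    eapply Rle_trans; [apply Cmod_triangle_minus |]. lra.
  - assert (Dv : Delta v) by (unfold Delta; specialize (Hball v Hv); lra).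
    rewrite (Hinj v z2 Dv H2 Ev), Cmod_minus_sym in Hv. lra.
Qed.

(** * Necessity of the condition on [lambda] *)

(** The inverse of [cayley], from the right half-plane to the disc. *)
Let half_plane_map (w : C) : C := (w - 1) / (w + 1).

Let w1_neq_0 (w : C) : (0 < Re w)%R -> w + 1 <> 0.
Proof. intros H. apply re_lt_neq. lra. Qed.

(* In the variable [s = log ((1 + z) / (1 - z)) - log r], [Phi] becomes asymptotically affine of slope
   [- 1 / beta] on the compact subsets of the strip [|Im s| < PI / 2] as [r] tends to infinity. *)
Lemma Phi_asymptotic (th X e : R) : (0 <= th < PI / 2)%R -> (0 < e)%R ->
  exists (r : R) (dA : C -> C), (0 < r)%R /\ forall s, (Rabs (Im s) <= th)%R -> (Rabs (Re s) <= X)%R ->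
    disc 1 (half_plane_map (RtoC r * Cexp s)) /\
    cd (fun s => Phi (half_plane_map (RtoC r * Cexp s))) s (dA s) /\
    (Cmod (dA s + RtoC (/ beta)) <= e)%R.
Proof.
  intros Hth He. assert (Hb := beta_pos).
  set (c0 := cos th). assert (Hc0 : (0 < c0 <= 1)%R).
  { split; [apply cos_gt_0; lra | apply COS_bound]. }
  (* The strip [|Im s| <= th] corresponds to the sector [Re w >= c0 |w|]. There
     [|w + 1| <= 2 |w| <= (2 / c0) Re w], and [|w + 1| < k Re w] places the image in the Stolz angle
     of constant [k]. *)
  set (k := (2 / c0 + 1)%R).
  assert (Hk : (1 < k)%R) by (unfold k; assert (0 < 2 / c0)%R by (apply Rdiv_lt_0_compat; lra); lra).
  (* The deviation of the slope is [(beta / (w + 1) + (g - beta)) / (beta * g)] with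
     [g = f z / (z - 1)]. If [1 / |w + 1|] and [|g - beta|] are at most [e1], then [|g| >= beta / 2]
     and the deviation is at most [2 * (beta + 1) * e1 / beta^2]. *)
  set (e1 := Rmin (beta / 2) (e * (beta * beta) / (2 * (beta + 1)))).
  assert (Heb : (0 < e * (beta * beta))%R) by (apply Rmult_lt_0_compat; nra).
  assert (He1 : (0 < e1)%R) by (apply Rmin_glb_lt; [lra | apply Rdiv_lt_0_compat; lra]).
  assert (He2 : (e1 <= beta / 2)%R) by apply Rmin_l.
  assert (He3 : (2 * (beta + 1) * e1 <= e * (beta * beta))%R).
  { assert (K : (e1 <= e * (beta * beta) / (2 * (beta + 1)))%R) by apply Rmin_r.
    apply (Rmult_le_compat_l (2 * (beta + 1))) in K; [| lra].
    replace (2 * (beta + 1) * (e * (beta * beta) / (2 * (beta + 1))))%R with (e * (beta * beta))%R in K by (field; lra). exact K. }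
  pose proof (proj1 (C_cvg_ulim _ _ _) (Gplus1_deriv f beta f_Gplus1 k Hk) e1 He1) as Q.
  unfold within in Q. apply locally_C_iff in Q. destruct Q as (dl & Hdl & Q).
  (* A lower bound for [|w|]: the summands give [|w| >= 1], [1 / |w + 1| <= e1], and
     [|1 - z| = 2 / |w + 1| < dl]. The factor [exp X] in [r] compensates for [Re s >= - X]. *)
  set (W := (1 + / e1 + 4 / dl)%R).
  assert (HW0 : (0 < / e1)%R) by now apply Rinv_0_lt_compat.
  assert (HW1 : (0 < 4 / dl)%R) by (apply Rdiv_lt_0_compat; lra).
  set (r := (W * exp X)%R). assert (Hr : (0 < r)%R) by (apply Rmult_lt_0_compat; [unfold W; lra | apply exp_pos]).
  exists r, (fun s => let w := RtoC r * Cexp s in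
     / f (half_plane_map w) * (2 / ((w + 1) * (w + 1)) * w)). split; [exact Hr |].
  intros s Hs1 Hs2. set (w := RtoC r * Cexp s). cbv zeta. fold w.
  assert (Ew : Cmod w = (r * exp (Re s))%R) by (unfold w; rewrite Cmod_mult, Cmod_R, Cmod_Cexp, Rabs_pos_eq; lra).
  assert (HwW : (W <= Cmod w)%R).
  { rewrite Ew. unfold r. rewrite Rmult_assoc, <- exp_plus. rewrite <- (Rmult_1_r W) at 1.
    apply Rmult_le_compat_l; [unfold W; lra |]. rewrite <- exp_0.
    pose proof (Rle_abs (- Re s)) as K. rewrite Rabs_Ropp in K.
    destruct (Req_dec (X + Re s) 0) as [-> | N]; [lra |]. apply Rlt_le, exp_increasing. lra. }
  assert (HwRe : (c0 * Cmod w <= Re w)%R).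
  { unfold w at 2. rewrite re_scal_l. unfold Cexp. simpl. rewrite Ew.
    assert (Hcos : (c0 <= cos (Im s))%R).
    { unfold c0. rewrite <- (Rabs_pos_eq th) by lra.
      assert (Ec : forall x, cos x = cos (Rabs x)).
      { intros x. unfold Rabs. destruct (Rcase_abs x); auto. now rewrite cos_neg. }
      rewrite (Ec (Im s)), (Rabs_pos_eq th) by lra.
      apply cos_decr_1; try lra; pose proof (Rabs_pos (Im s)); pose proof PI_RGT_0; lra. }
    pose proof (exp_pos (Re s)). assert (0 < r * exp (Re s))%R by nra. nra. }
  assert (Hw1 : (1 <= Cmod w)%R) by (unfold W in HwW; lra).
  assert (HRe : (0 < Re w)%R) by nra.
  assert (N1 : w + 1 <> 0) by now apply w1_neq_0.
  assert (Hwp : (Cmod w <= Cmod (w + 1))%R).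
  { apply Cmod_le_sqr. rewrite !Cmod_sqr, re_plus, im_plus, re_RtoC, im_RtoC. nra. }
  assert (Hwp2 : (Cmod (w + 1) <= 2 * Cmod w)%R).
  { eapply Rle_trans; [apply Cmod_triangle |]. rewrite Cmod_1. lra. }
  set (z := half_plane_map w).
  assert (Ez : 1 - z = 2 / (w + 1)) by (unfold z, half_plane_map; field; auto).
  assert (Emz : Cmod (1 - z) = (2 / Cmod (w + 1))%R).
  { rewrite Ez, Cmod_div, Cmod_R, Rabs_pos_eq by (auto; lra). reflexivity. }
  assert (Ezz : (1 - Cmod z * Cmod z = 4 * Re w / (Cmod (w + 1) * Cmod (w + 1)))%R).
  { unfold z, half_plane_map. rewrite Cmod_div by auto.
    assert (A1 : (Cmod (w - 1) * Cmod (w - 1) = Cmod (w + 1) * Cmod (w + 1) - 4 * Re w)%R).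
    { rewrite !Cmod_sqr. unfold Cminus. rewrite !re_plus, !im_plus, re_opp, im_opp, !re_RtoC, !im_RtoC. ring. }
    transitivity (1 - Cmod (w - 1) * Cmod (w - 1) / (Cmod (w + 1) * Cmod (w + 1)))%R; [field; lra |].
    rewrite A1. field. lra. }
  assert (Dz : disc 1 z).
  { unfold disc. assert (0 < 1 - Cmod z * Cmod z)%R by (rewrite Ezz; apply Rdiv_lt_0_compat; nra).
    pose proof (Cmod_ge_0 z). nra. }
  split; [exact Dz |]. split.
  - assert (Kw : cd (fun s => RtoC r * Cexp s) s w).
    { eapply cd_eq; [apply cd_mult; [apply cd_const | apply cd_Cexp] | unfold w; cbv beta; ring]. }
    assert (Kh : cd half_plane_map w (2 / ((w + 1) * (w + 1)))).
    { unfold half_plane_map. eapply cd_eq.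
      - apply cd_div; [apply cd_minus; [apply cd_id | apply cd_const] | apply cd_plus; [apply cd_id | apply cd_const] | exact N1].
      - cbv beta. field. auto. }
    apply (cd_comp Phi (fun s => half_plane_map (RtoC r * Cexp s))); [now apply Phi_der |].
    exact (cd_comp half_plane_map (fun s => RtoC r * Cexp s) s _ _ Kh Kw).
  - assert (Nz1 : z - 1 <> 0).
    { apply Cmod_neq_0. rewrite Cmod_minus_sym, Emz. apply Rdiv_lt_0_compat; lra. }
    set (g := f z / (z - 1)).
    assert (Hg : (Cmod (g - beta) < e1)%R).
    { apply (Q z).
      - rewrite Cmod_minus_sym, Emz. apply (Rmult_lt_reg_r (Cmod (w + 1))); [lra |].
        unfold Rdiv. rewrite Rmult_assoc, Rinv_l, Rmult_1_r by lra.
        apply Rlt_le_trans with (dl * W)%R; [| apply Rmult_le_compat_l; lra].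
        unfold W. replace (dl * (1 + / e1 + 4 / dl))%R with (dl + dl * / e1 + 4)%R by (field; lra). nra.
      - split; [exact Dz |]. pose proof (Cmod_ge_0 z) as Hz0. unfold disc in Dz.
        assert (A2 : ((1 - Cmod z * Cmod z) / 2 <= 1 - Cmod z)%R) by nra.
        apply Rlt_le_trans with (k * ((1 - Cmod z * Cmod z) / 2))%R; [| apply Rmult_le_compat_l; lra].
        rewrite Emz, Ezz.
        apply (Rmult_lt_reg_r (Cmod (w + 1) * Cmod (w + 1))); [nra |].
        replace (2 / Cmod (w + 1) * (Cmod (w + 1) * Cmod (w + 1)))%R with (2 * Cmod (w + 1))%R by (field; lra).
        replace (k * (4 * Re w / (Cmod (w + 1) * Cmod (w + 1)) / 2) * (Cmod (w + 1) * Cmod (w + 1)))%R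
          with (2 * (k * Re w))%R by (field; lra).
        assert (k * (c0 * Cmod w) <= k * Re w)%R by (apply Rmult_le_compat_l; lra).
        replace (k * (c0 * Cmod w))%R with (2 * Cmod w + c0 * Cmod w)%R in H by (unfold k; field; lra). nra. }
    assert (Hgm : (beta / 2 <= Cmod g)%R).
    { pose proof (Cmod_triangle_rev beta g) as T. rewrite Cmod_minus_sym, Cmod_R, Rabs_pos_eq in T by lra. lra. }
    assert (Ng : g <> 0) by (apply Cmod_neq_0; lra).
    assert (Nb : RtoC beta <> 0) by (intros Z; apply RtoC_inj in Z; lra).
    assert (Ef : f z = - (2 / (w + 1)) * g).
    { unfold g. rewrite <- Ez. field. exact Nz1. }
    rewrite Ef.
    replace (/ (- (2 / (w + 1)) * g) * (2 / ((w + 1) * (w + 1)) * w) + (/ beta)%R)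
      with ((beta * (1 / (w + 1)) + (g - beta)) / (beta * g)).
    2:{ rewrite RtoC_inv by lra. field. repeat split; auto. }
    rewrite Cmod_div by now apply Cmult_neq_0. rewrite Cmod_mult, Cmod_R, Rabs_pos_eq by lra.
    apply (Rmult_le_reg_r (beta * Cmod g)); [nra |].
    unfold Rdiv. rewrite Rmult_assoc, Rinv_l, Rmult_1_r by nra.
    eapply Rle_trans; [apply Cmod_triangle |].
    rewrite Cmod_mult, Cmod_div, Cmod_1, Cmod_R, Rabs_pos_eq by (auto; lra).
    assert (Hinv : (1 / Cmod (w + 1) <= e1)%R).
    { unfold Rdiv. rewrite Rmult_1_l. rewrite <- (Rinv_inv e1). apply Rinv_le_contravar; [exact HW0 | unfold W in HwW; lra]. }
    assert (beta * (1 / Cmod (w + 1)) <= beta * e1)%R by (apply Rmult_le_compat_l; lra).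
    assert (e * (beta * (beta / 2)) <= e * (beta * Cmod g))%R.
    { apply Rmult_le_compat_l; [lra |]. apply Rmult_le_compat_l; lra. }
    lra.
Qed.

(** Lying outside both discs means [2 * beta * |Re lambda| < |lambda|^2]. Two points of the strip
    symmetric about 0 then have values of [Phi] differing by nearly a period of
    [exp (lambda * Phi)], and [local_surj] makes the difference exact. *)
Lemma Omega_of_injective (lambda : C) : lambda <> 0 ->
  (forall z1 z2, disc 1 z1 -> disc 1 z2 -> Cexp (lambda * Phi z1) = Cexp (lambda * Phi z2) -> z1 = z2) ->
  Omega beta lambda.
Proof.
  intros Nl Hinj. apply NNPP. intros HO. assert (Hb := beta_pos).
  assert (Hp : (beta < Cmod (lambda - beta))%R).
  { apply Rnot_le_lt. intros K. apply HO. left. split; auto. }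
  assert (Hm : (beta < Cmod (lambda + beta))%R).
  { apply Rnot_le_lt. intros K. apply HO. right. split; auto. }
  assert (Hlm : (0 < Cmod lambda)%R) by now apply Cmod_gt_0.
  set (l2 := (Cmod lambda * Cmod lambda)%R). assert (Hl2 : (0 < l2)%R) by (unfold l2; nra).
  assert (Hre : (2 * beta * Rabs (Re lambda) < l2)%R).
  { assert (K1 : (beta * beta < Cmod (lambda - beta) * Cmod (lambda - beta))%R) by (apply Rmult_le_0_lt_compat; lra).
    assert (K2 : (beta * beta < Cmod (lambda + beta) * Cmod (lambda + beta))%R) by (apply Rmult_le_0_lt_compat; lra).
    unfold l2. rewrite Cmod_sqr in *. unfold Cminus in K1.
    rewrite re_plus, im_plus, ?re_opp, ?im_opp, re_RtoC, im_RtoC in *.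
    unfold Rabs. destruct (Rcase_abs (Re lambda)); nra. }
  set (ka := Cturn / lambda).
  assert (Nka : ka <> 0).
  { unfold ka, Cdiv, Cturn. intros Z. apply (f_equal (fun u => u * lambda)) in Z.
    rewrite <- Cmult_assoc, Cinv_l, Cmult_1_r, Cmult_0_l in Z by auto. apply (f_equal Im) in Z. simpl in Z.
    pose proof PI_RGT_0. lra. }
  (* An affine function of slope [- 1 / beta] increases by exactly [ka = 2 PI i / lambda] from
     [- s0] to [s0]. As [Im s0 = - beta * PI * Re (1 / lambda)], both points lie in the open
     strip. *)
  set (s0 := - (RtoC beta * ka / 2)).
  assert (Eim : (Im s0 = - (beta * PI * Re lambda / l2))%R).
  { unfold s0, ka, Cturn, l2. rewrite Cmod_sqr. destruct lambda as [x y].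
    assert (0 < x * x + y * y)%R by (unfold l2 in Hl2; rewrite Cmod_sqr in Hl2; exact Hl2).
    simpl. field. nra. }
  assert (Him : (Rabs (Im s0) < PI / 2)%R).
  { rewrite Eim, Rabs_Ropp. unfold Rdiv. rewrite !Rabs_mult, (Rabs_pos_eq beta), (Rabs_pos_eq PI), (Rabs_pos_eq (/ l2)).
    - apply (Rmult_lt_reg_r l2); auto. rewrite Rmult_assoc, Rinv_l by lra. pose proof PI_RGT_0. nra.
    - apply Rlt_le, Rinv_0_lt_compat, Hl2.
    - apply Rlt_le, PI_RGT_0.
    - lra. }
  set (th := ((Rabs (Im s0) + PI / 2) / 2)%R). pose proof (Rabs_pos (Im s0)) as Him0.
  set (r1 := Rmin 1 (th - Rabs (Im s0))).
  assert (Hr1 : (0 < r1)%R) by (apply Rmin_glb_lt; unfold th; lra).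
  assert (Hr2 : (r1 <= 1)%R) by apply Rmin_l. assert (Hr3 : (r1 <= th - Rabs (Im s0))%R) by apply Rmin_r.
  set (X := (Rabs (Re s0) + 1)%R). pose proof (Rabs_pos (Re s0)) as Hre0. pose proof (Cmod_ge_0 s0) as Hs00.
  (* These are the two hypotheses of [local_surj] with slope [- 1 / beta]: derivatives within half
     its modulus, and a defect [2 * e * |s0|] of at most [r1 / (4 * beta)]. *)
  set (e := Rmin (/ (2 * beta)) (r1 / (8 * beta * (Cmod s0 + 1)))).
  assert (He : (0 < e)%R).
  { apply Rmin_glb_lt; [apply Rinv_0_lt_compat; lra | apply Rdiv_lt_0_compat; nra]. }
  destruct (Phi_asymptotic th X e) as (r & dA & Hr & HA); [unfold th; lra | exact He |].
  set (A := fun s => Phi (half_plane_map (RtoC r * Cexp s))) in *.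
  assert (Nb : RtoC beta <> 0) by (intros Z; apply RtoC_inj in Z; lra).
  assert (Nrb : RtoC (/ beta) <> 0).
  { intros Z. apply RtoC_inj in Z. pose proof (Rinv_0_lt_compat beta Hb). lra. }
  assert (Cb : Cmod (- RtoC (/ beta)) = (/ beta)%R).
  { rewrite Cmod_opp, Cmod_R. apply Rabs_pos_eq. apply Rlt_le, Rinv_0_lt_compat, Hb. }
  assert (Hball : forall w, (Cmod (w - s0) <= r1)%R -> (Rabs (Im w) <= th)%R /\ (Rabs (Re w) <= X)%R).
  { intros w Hw. pose proof (re_le_Cmod (w - s0)) as K1. pose proof (im_le_Cmod (w - s0)) as K2.
    unfold Cminus in K1 at 1. unfold Cminus in K2 at 1. rewrite re_plus, re_opp in K1. rewrite im_plus, im_opp in K2.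
    pose proof (Rabs_triang (Re w + - Re s0) (Re s0)) as T1. pose proof (Rabs_triang (Im w + - Im s0) (Im s0)) as T2.
    replace (Re w + - Re s0 + Re s0)%R with (Re w) in T1 by ring.
    replace (Im w + - Im s0 + Im s0)%R with (Im w) in T2 by ring. unfold X. split; lra. }
  assert (Hseg : forall t, (0 <= t <= 1)%R -> (Rabs (Im (- s0 + RtoC t * (s0 - - s0))) <= th)%R /\
                                              (Rabs (Re (- s0 + RtoC t * (s0 - - s0))) <= X)%R).
  { intros t Ht. replace (- s0 + t * (s0 - - s0)) with (RtoC (2 * t - 1) * s0) by (rewrite RtoC_minus, RtoC_mult; ring).
    rewrite re_scal_l, im_scal_l, !Rabs_mult.
    assert (Rabs (2 * t - 1) <= 1)%R by (apply Rabs_le; lra). pose proof (Rabs_pos (2 * t - 1)).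
    unfold X, th. split; nra. }
  assert (HAs : (Cmod (A s0 - A (- s0)%C - ka) <= e * (2 * Cmod s0))%R).
  { replace (A s0 - A (- s0) - ka) with ((A s0 + s0 * RtoC (/ beta)) - (A (- s0) + - s0 * RtoC (/ beta))).
    2:{ assert (Es : s0 * RtoC (/ beta) = - (ka / 2)) by (unfold s0; rewrite RtoC_inv by lra; field; auto).
        replace (- s0 * (/ beta)%R) with (- (s0 * (/ beta)%R)) by ring. rewrite Es. field. }
    replace (2 * Cmod s0)%R with (Cmod (s0 - - s0)).
    2:{ replace (s0 - - s0) with (RtoC 2 * s0) by ring. rewrite Cmod_mult, Cmod_R, Rabs_pos_eq; lra. }
    apply (segment_lip (fun s => A s + s * RtoC (/ beta)) (fun s => dA s + RtoC (/ beta))).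
    - intros t Ht. destruct (Hseg t Ht) as [S1 S2]. destruct (HA _ S1 S2) as (_ & K & _).
      eapply cd_eq; [apply cd_plus; [exact K | apply cd_mult; [apply cd_id | apply cd_const]] |]. cbv beta. ring.
    - intros t Ht. destruct (Hseg t Ht) as [S1 S2]. apply (HA _ S1 S2). }
  (* Moving [s0] slightly to [v] makes the difference [A v - A (- s0)] equal to [ka], hence the two
     exponentials equal. *)
  destruct (local_surj A dA s0 (- RtoC (/ beta)) (A (- s0) + ka) r1) as (v & Hv & Ev).
  - intros Z. rewrite Z, Cmod_0 in Cb. pose proof (Rinv_0_lt_compat beta Hb). lra.
  - intros w Hw. destruct (Hball w Hw) as [S1 S2]. apply (HA w S1 S2).
  - intros w Hw. destruct (Hball w Hw) as [S1 S2]. destruct (HA w S1 S2) as (_ & _ & K).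
    rewrite Cb. replace (dA w - - (/ beta)%R) with (dA w + RtoC (/ beta)) by ring.
    eapply Rle_trans; [exact K |]. replace (/ beta / 2)%R with (/ (2 * beta))%R by (field; lra). apply Rmin_l.
  - rewrite Cb. replace (A (- s0) + ka - A s0) with (- ((A s0 - A (- s0)) - ka)) by ring. rewrite Cmod_opp.
    eapply Rle_trans; [exact HAs |].
    assert (K : (e <= r1 / (8 * beta * (Cmod s0 + 1)))%R) by apply Rmin_r.
    apply Rle_trans with (r1 / (8 * beta * (Cmod s0 + 1)) * (2 * (Cmod s0 + 1)))%R.
    + apply Rmult_le_compat; lra.
    + right. field. lra.
  - destruct (Hball v Hv) as [S1 S2]. destruct (HA v S1 S2) as (D1 & _).
    destruct (Hseg 0%R ltac:(lra)) as [S3 S4].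
    replace (- s0 + 0 * (s0 - - s0)) with (- s0) in S3, S4 by ring.
    destruct (HA (- s0) S3 S4) as (D2 & _).
    assert (E : half_plane_map (r * Cexp v) = half_plane_map (r * Cexp (- s0))).
    { apply Hinj; auto. fold (A v) (A (- s0)). rewrite Ev.
      replace (lambda * (A (- s0) + ka)) with (lambda * A (- s0) + Cturn) by (unfold ka; field; auto).
      rewrite Cexp_plus, Cexp_turn. ring. }
    apply Nka. assert (EA : A v = A (- s0)) by (unfold A; now rewrite E).
    rewrite Ev in EA. replace ka with (A (- s0) + ka - A (- s0)) by ring. rewrite EA. ring.
Qed.

Lemma exponential_solution (lambda : C) : IVP_solution f lambda (fun z => Cexp (lambda * Phi z)).
Proof.
  assert (K : forall z, disc 1 z -> cd (fun z => Cexp (lambda * Phi z)) z (Cexp (lambda * Phi z) * (lambda / f z))).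
  { intros z Hz. exact (cd_Cexp_comp (fun z => lambda * Phi z) z _ (L_der lambda z Hz)). }
  split; [| split].
  - intros z Hz. eexists. now apply K.
  - intros z Hz. rewrite (is_C_derive_unique _ _ _ (K z Hz)). field. auto.
  - rewrite L_0. apply Cexp_0.
Qed.

(** The product of a solution with [exp (- lambda * Phi)] has derivative 0 along radii, so it keeps
    its value 1 at the origin. *)
Lemma solution_unique (lambda : C) (g : C -> C) : IVP_solution f lambda g ->
  forall z, disc 1 z -> g z = Cexp (lambda * Phi z).
Proof.
  intros (Hg & Hode & H0) z Hz.
  assert (E : g z * Cexp (- (lambda * Phi z)) = g 0 * Cexp (- (lambda * Phi 0))).
  { apply (segment_const (fun w => g w * Cexp (- (lambda * Phi w))) 0 z). intros t Ht.
    set (w := 0 + RtoC t * (z - 0)).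
    assert (Dw : disc 1 w) by (apply (disc_seg 1 0 z); [apply zero_in_disc | exact Hz | exists t; auto]).
    eapply cd_eq.
    - apply cd_mult; [apply C_derive_cd, Hg, Dw | exact (cd_Cexp_comp _ w _ (cd_opp _ w _ (L_der lambda w Dw)))].
    - cbv beta. transitivity (Cexp (- (lambda * Phi w)) / f w * (C_derive g w * f w - lambda * g w)); [field; auto |].
      rewrite (Hode w Dw). ring. }
  rewrite L_0, H0, Cexp_opp, Cexp_opp, Cexp_0 in E. pose proof (Cexp_neq_0 (lambda * Phi z)).
  transitivity (g z * / Cexp (lambda * Phi z) * Cexp (lambda * Phi z)); [field; auto | rewrite E; field].
Qed.

Lemma univalent_solution_iff (lambda : C) : lambda <> 0 ->
  (exists h : C -> C, univalent h /\ IVP_solution f lambda h) <-> Omega beta lambda.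
Proof.
  intros Nl. split.
  - intros (h & [_ Hinj] & Hh). apply Omega_of_injective; auto.
    intros z1 z2 H1 H2 E. apply Hinj; auto. rewrite !(solution_unique lambda h Hh) by auto. exact E.
  - intros HO. exists (fun z => Cexp (lambda * Phi z)). split; [split | apply exponential_solution].
    + apply exponential_solution.
    (* For [Omega_minus] the reciprocal [exp (- lambda * Phi)] is injective, since [- lambda] lies
       in [Omega_plus]. *)
    + intros z1 z2 H1 H2 E. destruct HO as [HO | [HO _]]; [now apply (solution_injective lambda) |].
      apply (solution_injective (- lambda)); auto.
      * split; [| intros Z; apply Nl; replace lambda with (- - lambda) by ring; rewrite Z; ring].
        replace (- lambda - beta) with (- (lambda + beta)) by ring. now rewrite Cmod_opp.
      * replace (- lambda * Phi z1) with (- (lambda * Phi z1)) by ring.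
        replace (- lambda * Phi z2) with (- (lambda * Phi z2)) by ring. rewrite !Cexp_opp. now rewrite E.
Qed.

End Solutions.

(** * Compact subsets of the disc, poles, and the conclusion *)

(** The cover by all open sets that lie in some disc of radius less than 1 has a finite subcover,
    and the largest radius works. It lets compact convergence be deduced from convergence on closed
    discs. *)
Lemma compact_in_disc (K : C -> Prop) : C_compact K -> (forall z, K z -> Delta z) ->
  exists rho, (0 <= rho < 1)%R /\ forall z, K z -> (Cmod z <= rho)%R.
Proof.
  intros HK Hsub.
  set (small := fun U : C -> Prop => exists rho, (0 <= rho < 1)%R /\ forall z, U z -> (Cmod z <= rho)%R).
  destruct (HK (fun U => open (T := C_UniformSpace) U /\ small U)) as (l & Hl & Hcov).
  - tauto.
  - intros z Hz. pose proof (Hsub z Hz) as Dz. unfold Delta in Dz. pose proof (Cmod_ge_0 z).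
    exists (fun w => (Cmod w < (1 + Cmod z) / 2)%R). split; [split |]; [| | lra].
    + intros w Hw. apply locally_C_iff. exists ((1 + Cmod z) / 2 - Cmod w)%R. split; [lra |].
      intros v Hv. pose proof (Cmod_triangle_rev v w). lra.
    + exists ((1 + Cmod z) / 2)%R. split; [lra |]. intros w Hw. lra.
  - assert (Hm : exists rho, (0 <= rho < 1)%R /\ forall U, In U l -> forall z, U z -> (Cmod z <= rho)%R).
    { clear Hcov. induction l as [| U l IH].
      - exists 0%R. split; [lra |]. intros U [].
      - destruct IH as (r1 & Hr1 & H1); [intros V HV; apply Hl; now right |].
        destruct (Hl U (or_introl eq_refl)) as (_ & r2 & Hr2 & H2).
        exists (Rmax r1 r2). split.
        + split; [eapply Rle_trans; [apply Hr1 | apply Rmax_l] | apply Rmax_lub_lt; lra].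
        + intros V [<- | HV] z Hz.
          * eapply Rle_trans; [now apply H2 | apply Rmax_r].
          * eapply Rle_trans; [now apply (H1 V) | apply Rmax_l]. }
    destruct Hm as (rho & Hrho & Hm). exists rho. split; auto. intros z Hz.
    destruct (Hcov z Hz) as (U & HU & HUz). now apply (Hm U).
Qed.

Lemma cvg_compacts_of_unif (H : C -> C -> C) (g : C -> C) :
  (forall rho, (0 <= rho < 1)%R -> ulim (unif rho) (fun x => H (fst x) (snd x)) (fun x => g (snd x))) ->
  cvg_compacts_tau_to_1 H g.
Proof.
  intros Hlim K HK Hsub eps He. destruct (compact_in_disc K HK Hsub) as (rho & Hrho & Hin).
  generalize (Hlim rho Hrho eps He). unfold unif. apply filter_imp. intros tau Q z Hz. apply (Q z), Hin, Hz.
Qed.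

(** The zero of [h] at [tau] is simple and its only one, because the cofactor [E] has no zeros;
    [/ E] is the regular factor at the pole. *)
Lemma inverse_simple_pole (tau : C) (h E : C -> C) : disc 1 tau -> hol 1 h -> hol 1 E ->
  (forall z, disc 1 z -> E z <> 0 /\ h z = (z - tau) * E z) ->
  meromorphic_unique_simple_pole tau (fun z => / h z).
Proof.
  intros Ht Hh HE H. split.
  - intros z [Hz Hzt]. destruct (Hh z Hz) as [d Hd]. eexists. apply cd_inv; [exact Hd |].
    destruct (H z Hz) as [NE ->]. apply Cmult_neq_0; auto. now apply Cminus_eq_contra.
  - assert (Hloc : locally (T := C_UniformSpace) tau (disc 1)).
    { apply locally_C_iff. exists (1 - Cmod tau)%R. unfold disc in *. split; [lra |].
      intros w Hw. pose proof (Cmod_triangle_rev w tau). lra. }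
    exists (fun z => / E z). split; [| split].
    + revert Hloc. apply filter_imp. intros z Hz. destruct (HE z Hz) as [d Hd]. eexists.
      apply cd_inv; [exact Hd | now apply H].
    + intros Z. destruct (H tau Ht) as [NE _]. assert (K : E tau * / E tau = 1) by now apply Cinv_r.
      rewrite Z, Cmult_0_r in K. apply RtoC_inj in K. lra.
    + unfold locally', within. revert Hloc. apply filter_imp. intros z Hz Hzt.
      destruct (H z Hz) as [NE ->]. field. split; auto. now apply Cminus_eq_contra.
Qed.

Theorem theorem3p4 (f : C -> C) (beta : R) (hf : Gplus1 f beta)
    (lambda : C) (hlambda : lambda <> 0) :
  ((exists h : C -> C, univalent h /\ IVP_solution f lambda h)
     <-> Omega beta lambda) /\
  (exists h : C -> C,
     IVP_solution f lambda h /\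
     (forall g, IVP_solution f lambda g -> forall z, Delta z -> g z = h z) /\
     (forall mu, Omega_plus beta mu ->
        exists h1 : C -> C, branch_power h (mu / lambda) h1 /\
        exists H : C -> C -> C,
          (forall tau, Delta tau -> Sp tau (H tau)) /\
          cvg_compacts_tau_to_1 H h1) /\
     (Omega_plus beta lambda ->
        exists H : C -> C -> C,
          (forall tau, Delta tau -> Sp tau (H tau)) /\
          cvg_compacts_tau_to_1 H h) /\
     (forall mu, Omega_minus beta mu ->
        exists h1 : C -> C, branch_power h (mu / lambda) h1 /\
        exists H : C -> C -> C,
          (forall tau, Delta tau ->
             meromorphic_unique_simple_pole tau (H tau)) /\
          cvg_compacts_tau_to_1 H h1)).
Proof.
  destruct (Gplus1_decomposition f beta hf) as (q & q_hol & q_re & f_dec).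
  assert (f_hol := generator_hol f (Gplus1_G f beta hf)). assert (Hb := Gplus1_pos f beta hf).
  assert (f_neq_0 : forall z, disc 1 z -> f z <> 0).
  { intros z Hz. rewrite f_dec by auto. pose proof (Delta_neq_1 z Hz) as N.
    replace (- ((1 - z) * (1 - z)) * (RtoC (beta / 2) * cayley z + q z))
      with (- (((1 - z) * (1 - z)) * (RtoC (beta / 2) * cayley z + q z))) by ring.
    intros Z. apply (Cmult_neq_0 ((1 - z) * (1 - z)) (RtoC (beta / 2) * cayley z + q z)).
    - now apply Cmult_neq_0.
    - apply re_pos_neq_0. rewrite re_plus, re_scal_l, cayley_re by auto. specialize (q_re z Hz).
      assert (0 < Cmod (1 - z))%R by now apply Cmod_gt_0. unfold disc in Hz. pose proof (Cmod_ge_0 z).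
      assert (0 < (1 - Cmod z * Cmod z) / (Cmod (1 - z) * Cmod (1 - z)))%R by (apply Rdiv_lt_0_compat; nra). nra.
    - match goal with |- ?u = _ => replace u with (- - u) by ring end. rewrite Z. ring. }
  assert (finv : forall z, disc 1 z -> exists d, cd (fun z => / f z) z d).
  { intros z Hz. destruct (f_hol z Hz) as [d Hd]. eexists. apply cd_inv; eauto. }
  (* [Phi] is the integral of [1 / f] from 0. The required logarithm of the solution is
     [lambda * Phi], so its power of exponent [mu / lambda] is [exp (mu * Phi)]. *)
  destruct (primitive_disc 1 (fun z => / f z) 0 0) as (Phi & Phi_0 & Phi_der); [lra | | auto |].
  { intros z Hz. destruct (finv z Hz) as [d Hd]. exact (cd_cont _ _ _ Hd). }
  split; [now apply (univalent_solution_iff f beta q Phi) |].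
  assert (Hpow : forall mu, branch_power (fun z => Cexp (lambda * Phi z)) (mu / lambda) (fun z => Cexp (mu * Phi z))).
  { intros mu. exists (fun z => lambda * Phi z). split; [| split; [rewrite Phi_0; ring | split; [auto |]]].
    - intros z Hz. eexists. apply cd_mult; [apply cd_const | now apply Phi_der].
    - intros z _. f_equal. field. auto. }
  assert (Happ := approximants f beta q Phi hf q_hol q_re f_dec Phi_0 Phi_der).
  assert (Hplus : forall mu, Omega_plus beta mu -> exists H : C -> C -> C,
     (forall tau, Delta tau -> Sp tau (H tau)) /\ cvg_compacts_tau_to_1 H (fun z => Cexp (mu * Phi z))).
  { intros mu Hmu. destruct (Happ mu Hmu) as (H & E & HSp & Hlim). exists H. split.
    - intros tau Ht. now apply HSp.
    - apply cvg_compacts_of_unif. intros rho Hrho. now apply Hlim. }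
  exists (fun z => Cexp (lambda * Phi z)). split; [| split; [| split; [| split]]].
  - now apply exponential_solution.
  - intros g Hg z Hz. now apply (solution_unique f Phi).
  - intros mu Hmu. exists (fun z => Cexp (mu * Phi z)). auto.
  - auto.
  - intros mu [Hmu Nmu]. exists (fun z => Cexp (mu * Phi z)). split; [auto |].
    (* [- mu] lies in [Omega_plus]; the inverses of its spirallike approximants have their only pole
       at [tau] and converge to [exp (mu * Phi)]. *)
    destruct (Happ (- mu)) as (H & E & HSp & Hlim).
    { split; [| intros Z; apply Nmu; replace mu with (- - mu) by ring; rewrite Z; ring].
      replace (- mu - beta) with (- (mu + beta)) by ring. now rewrite Cmod_opp. }
    exists (fun tau z => / H tau z). split.
    + intros tau Ht. destruct (HSp tau Ht) as ([[[Hh _] _] _] & HE & Hz).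
      now apply (inverse_simple_pole tau (H tau) (E tau)).
    + apply cvg_compacts_of_unif. intros rho Hrho. destruct (Hlim rho Hrho) as (_ & K & _).
      eapply ulim_ext; [| | exact K]; apply filter_forall; [reflexivity |].
      intros x. rewrite <- Cexp_opp. f_equal. ring.
Qed.
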